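(* Let $G$ be a locally compact, Hausdorff, second countable groupoid with left Haar system $\lambda$ and quasi-invariant measure $\mu$ on $G^0$, let $H=L^2(G,\nu)$, let $\alpha$, $\hat\beta$ and $\beta=\alpha$ be the $C^*$-factorizations of $H$ defined by $L^2(G,\lambda)$ and $L^2(G,\lambda^{-1})$, and let $V\colon H\,{}_{\hat\beta}\otimes_\alpha H\to H\,{}_\alpha\otimes_\beta H$ be the $C^*$-pseudo-multiplicative unitary given by $(V\zeta)(x,y)=\zeta(x,x^{-1}y)$ (all as specified in the context). Then $V$ is regular, i.e. $[\langle\alpha|_1V|\alpha\rangle_2]=[\alpha\alpha^*]$.
   Context: **Notation.** $[Y]$ is the closed linear span of a subset $Y$ of a normed space. For sets of operators, $XY=\{xy\}$, $X^*=\{x^*\}$. **Bases, factorizations, relative tensor product.** A $C^*$-base is a triple $\mathfrak b=(\mathfrak B,\mathfrak H,\mathfrak B^\dagger)$ of a Hilbert space $\mathfrak H$ and two commuting nondegenerate $C^*$-algebras $\mathfrak B,\mathfrak B^\dagger\subseteq\mathcal L(\mathfrak H)$; $\mathfrak b^\dagger=(\mathfrak B^\dagger,\mathfrak H,\mathfrak B)$. A $C^*$-factorization of a Hilbert space $H$ w.r.t. $\mathfrak b$ is a closed subspace $\alpha\subseteq\mathcal L(\mathfrak H,H)$ with $[\alpha^*\alpha]=\mathfrak B$, $[\alpha\mathfrak B]=\alpha$, $[\alpha\mathfrak H]=H$. If $\alpha,\beta$ are $C^*$-factorizations of $H,K$ w.r.t. $\mathfrak b,\mathfrak b^\dagger$,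 respectively, $H\,{}_\alpha\otimes_\beta K$ is the separated completion of $\alpha\odot\mathfrak H\odot\beta$ for $\langle\xi\otimes\zeta\otimes\eta|\xi'\otimes\zeta'\otimes\eta'\rangle=\langle\zeta|\xi^*\xi'\eta^*\eta'\zeta'\rangle$. Operators $|\xi\rangle_1\colon K\to H\,{}_\alpha\otimes_\beta K$ ($\xi\in\alpha$), $|\eta\rangle_2\colon H\to H\,{}_\alpha\otimes_\beta K$ ($\eta\in\beta$) are given by $|\xi\rangle_1\eta\zeta=\xi\otimes\zeta\otimes\eta=|\eta\rangle_2\xi\zeta$; $\langle\xi|_1,\langle\eta|_2$ are their adjoints; $|\alpha\rangle_1=\{|\xi\rangle_1:\xi\in\alpha\}$, $\langle\alpha|_1=\{\langle\xi|_1:\xi\in\alpha\}$, etc. **Regularity.** A $C^*$-pseudo-multiplicative unitary $V\colon H\,{}_{\hat\beta}\otimes_\alpha H\to H\,{}_\alpha\otimes_\beta H$ is regular if $[\langle\alpha|_1V|\alpha\rangle_2]=[\alpha\alpha^*]$ as subspaces of $\mathcal L(H)$, where $|\alpha\rangle_2\subseteq\mathcal L(H,H\,{}_{\hat\beta}\otimes_\alpha H)$ and $\langle\alpha|_1\subseteq\mathcal L(H\,{}_\alpha\otimes_\beta H,H)$. **Groupoid data.** $G$ has unit space $G^0$, range map $r_G$, source map $s_G$; $G^u=r_G^{-1}(u)$, $G_u=s_G^{-1}(u)$; $\lambda=(\lambda^u)$ is a left Haar system and $\lambda^{-1}=(\lambda^{-1}_u)$ the associated right Haar system (image under inversion). $\mu$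 is a Radon measure on $G^0$ with support $G^0$; $\int_Gf\,d\nu=\int_{G^0}\int_{G^u}f\,d\lambda^u\,d\mu(u)$, $\nu^{-1}$ is the image of $\nu$ under inversion; $\mu$ is quasi-invariant, i.e. $\nu\sim\nu^{-1}$; $D=d\nu/d\nu^{-1}$. Put $\mathfrak H=L^2(G^0,\mu)$, $\pi_\mu\colon C_0(G^0)\to\mathcal L(\mathfrak H)$ the representation by multiplication, $\mathfrak B=\mathfrak B^\dagger=\pi_\mu(C_0(G^0))\cong C_0(G^0)$, $\mathfrak b=(\mathfrak B,\mathfrak H,\mathfrak B^\dagger)=\mathfrak b^\dagger$, $H=L^2(G,\nu)$. $L^2(G,\lambda)$ and $L^2(G,\lambda^{-1})$ are the $C^*$-modules over $C_0(G^0)$ obtained by completing $C_c(G)$ w.r.t. $\langle\xi'|\xi\rangle(u)=\int_{G^u}\overline{\xi'}\xi\,d\lambda^u$, $(\xi f)(x)=\xi(x)f(r_G(x))$, resp. $\langle\xi'|\xi\rangle(u)=\int_{G_u}\overline{\xi'}\xi\,d\lambda^{-1}_u$, $(\xi f)(x)=\xi(x)f(s_G(x))$. Isometric embeddings $j\colon L^2(G,\lambda)\to\mathcal L(\mathfrak H,H)$, $\hat j\colon L^2(G,\lambda^{-1})\to\mathcal L(\mathfrak H,H)$ are given by $(j(\xi)\zeta)(x)=\xi(x)\zeta(r_G(x))$, $(\hat j(\xi)\zeta)(x)=\xi(x)D^{-1/2}(x)\zeta(s_G(x))$ for $\xi\in C_c(G)$. Put $\alpha=\beta=j(L^2(G,\lambda))$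 and $\hat\beta=\hat j(L^2(G,\lambda^{-1}))$; these are $C^*$-factorizations of $H$ w.r.t. $\mathfrak b$. $G^2_{s,r}=\{(x,y)\in G^2:s_G(x)=r_G(y)\}$ and $G^2_{r,r}=\{(x,y)\in G^2:r_G(x)=r_G(y)\}$ carry the measures $\int f\,d\nu^2_{s,r}=\int_{G^0}\int_{G^u}\int_{G^{s_G(x)}}f(x,y)\,d\lambda^{s_G(x)}(y)\,d\lambda^u(x)\,d\mu(u)$ and $\int g\,d\nu^2_{r,r}=\int_{G^0}\int_{G^u}\int_{G^u}g(x,y)\,d\lambda^u(y)\,d\lambda^u(x)\,d\mu(u)$. The identifications $H\,{}_{\hat\beta}\otimes_\alpha H\cong L^2(G^2_{s,r},\nu^2_{s,r})$ and $H\,{}_\alpha\otimes_\beta H\cong L^2(G^2_{r,r},\nu^2_{r,r})$ send $|j(\xi)\rangle_2\omega$ to $(x,y)\mapsto\omega(x)\xi(y)$ ($\omega\in H$, $\xi\in C_c(G)$). With respect to these, $V$ is the unitary with $(V\zeta)(x,y)=\zeta(x,x^{-1}y)$ for $\zeta\in L^2(G^2_{s,r},\nu^2_{s,r})$, $(x,y)\in G^2_{r,r}$. *)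

(* Defs.v *)
From HB Require Import structures.
From mathcomp Require Import all_boot all_order all_algebra.
From mathcomp Require Import all_classical all_reals all_analysis.
From mathcomp Require Import measurable_realfun.
From mathcomp Require Import complex ring lra.

Set Implicit Arguments.
Unset Strict Implicit.
Unset Printing Implicit Defensive.

Import Order.TTheory GRing.Theory Num.Theory.
Import numFieldNormedType.Exports.
Local Open Scope classical_set_scope.
Local Open Scope ring_scope.

Local Notation Re := (@complex.Re _).
Local Notation Im := (@complex.Im _).

(* The inner product is conjugate linear in the first variable. *)
HB.mixin Record isInnerProduct (R : realType) U of NormedModule R[i] U := {
  dot : U -> U -> R[i];
  dotC : forall x y, dot x y = (dot y x)^*%C;
  dotDr : forall x y z, dot x (y + z) = dot x y + dot x z;
  dotZr : forall (a : R[i]) x y, dot x (a *: y) = a * dot x y;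
  dot_norm : forall x, dot x x = `|x| ^+ 2
}.

#[short(type="innerProductType")]
HB.structure Definition InnerProduct (R : realType) :=
  {U of NormedModule R[i] U & isInnerProduct R U}.

#[short(type="hilbertType")]
HB.structure Definition Hilbert (R : realType) :=
  {U of InnerProduct R U & Complete U}.

Section CauchySchwarz.
Context (R : realType) (U : lmodType R[i]) (b : U -> U -> R[i]).
Hypothesis bC : forall x y, b x y = (b y x)^*%C.
Hypothesis bDr : forall x y z, b x (y + z) = b x y + b x z.
Hypothesis bZr : forall (a : R[i]) x y, b x (a *: y) = a * b x y.
Hypothesis b_ge0 : forall x, 0 <= b x x.
Hypothesis b_eq0 : forall x, b x x = 0 -> x = 0.

Let q x : R := Re (b x x).

Lemma form_selfE x : b x x = (q x)%:C%C.
Proof. by rewrite /q [LHS]complexE (ger0_Im (b_ge0 x)) mulr0 addr0. Qed.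

Lemma form_q_ge0 x : 0 <= q x.
Proof. by have := b_ge0 x; rewrite form_selfE lecR. Qed.

Lemma form_q_eq0 x : q x = 0 -> x = 0.
Proof. by move=> qx; apply: b_eq0; rewrite form_selfE qx. Qed.

Lemma form_Re_sym x y : Re (b y x) = Re (b x y).
Proof. by rewrite (bC y x); case: (b x y). Qed.

Lemma form_qD x y : q (x + y) = q x + 2 * Re (b x y) + q y.
Proof.
have bDl u v w : b (u + v) w = b u w + b v w.
  by rewrite bC bDr rmorphD /= -!bC.
rewrite /q bDr !bDl.
have := form_Re_sym x y; move: (b x x) (b y y) (b x y) (b y x).
by move=> [? ?] [? ?] [? ?] [? ?] /= ->; ring.
Qed.

Lemma form_qZ (a : R[i]) x : q (a *: x) = (Re a ^+ 2 + Im a ^+ 2) * q x.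
Proof.
have bZl u v : b (a *: u) v = a^*%C * b u v.
  by rewrite bC bZr rmorphM /= -bC.
rewrite /q bZr bZl; move: (ger0_Im (b_ge0 x)).
by case: a {bZl} => c e; case: (b x x) => u v /= ->; ring.
Qed.

Lemma form_Re_CS x y : Re (b x y) ^+ 2 <= q x * q y.
Proof.
have [q0|q0] := eqVneq (q y) 0.
  rewrite q0 mulr0 (form_q_eq0 q0) -(scale0r 0) bZr mul0r /=.
  by rewrite expr0n.
have qy : 0 < q y by rewrite lt_neqAle eq_sym q0 form_q_ge0.
have := form_q_ge0 (x + (- (Re (b x y) / q y))%:C%C *: y).
rewrite form_qD form_qZ bZr.
set t := - _.
have -> : Re (t%:C%C * b x y) = t * Re (b x y).
  by case: (b x y) => ? ? /=; rewrite mul0r subr0.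
rewrite /= expr0n addr0 /t => h.
rewrite -subr_ge0 -(pmulr_lge0 _ (_ : 0 < (q y)^-1)) ?invr_gt0//.
by apply: le_trans h _; rewrite le_eqVlt; apply/orP; left; apply/eqP; field.
Qed.

Lemma form_sqrt_ler_normD x y :
  Num.sqrt (q (x + y)) <= Num.sqrt (q x) + Num.sqrt (q y).
Proof.
rewrite -(@ler_pXn2r _ 2) ?nnegrE ?addr_ge0 ?sqrtr_ge0//.
rewrite sqr_sqrtr ?form_q_ge0// form_qD sqrrD !sqr_sqrtr ?form_q_ge0//.
rewrite lerD2r lerD2l -[leRHS]mulr_natl ler_wpM2l// -sqrtrM ?form_q_ge0//.
apply: le_trans (ler_norm _) _.
by rewrite -sqrtr_sqr ler_wsqrtr// form_Re_CS.
Qed.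

End CauchySchwarz.

Section ComplexIntegral.
Context d (T : measurableType d) (R : realType).

Definition cintegral (mu : {measure set T -> \bar R}) (D : set T)
    (f : T -> R[i]) : R[i] :=
  Complex (\int[mu]_(x in D) Re (f x)) (\int[mu]_(x in D) Im (f x)).

Definition sqmod (z : R[i]) : R := Re z ^+ 2 + Im z ^+ 2.

Variable mu : {measure set T -> \bar R}.
Implicit Types f g : T -> R[i].

Definition cmeasurable f :=
  measurable_fun setT (Re \o f) /\ measurable_fun setT (Im \o f).

Definition square_integrable f :=
  cmeasurable f /\ (\int[mu]_x (sqmod (f x))%:E < +oo)%E.

Definition cintegrable f :=
  mu.-integrable setT (EFin \o (Re \o f)) /\
  mu.-integrable setT (EFin \o (Im \o f)).

Lemma sqmod_ge0 z : 0 <= sqmod z.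
Proof. by rewrite addr_ge0 ?sqr_ge0. Qed.

Lemma sqmod_eq0 z : sqmod z = 0 -> z = 0.
Proof.
case: z => a b /eqP; rewrite paddr_eq0 ?sqr_ge0// !sqrf_eq0 /=.
by case/andP => /eqP-> /eqP->.
Qed.

Lemma cmeasurable_sqmod f : cmeasurable f -> measurable_fun setT (sqmod \o f).
Proof.
by case=> mR mI; apply: measurable_funD; apply: measurable_funX.
Qed.

Lemma integrable_sqmod f : square_integrable f ->
  mu.-integrable setT (EFin \o (sqmod \o f)).
Proof.
case=> mf fo; apply/integrableP; split.
  by apply/measurable_EFinP; exact: cmeasurable_sqmod.
rewrite (le_lt_trans _ fo)// le_eqVlt; apply/orP; left; apply/eqP.
by apply: eq_integral => x _ /=; rewrite ger0_norm ?sqmod_ge0.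
Qed.

Lemma square_integrable_dominated f g : cmeasurable f -> square_integrable g ->
  forall h, square_integrable h -> forall c : R,
  (forall x, sqmod (f x) <= c * (sqmod (g x) + sqmod (h x))) ->
  square_integrable f.
Proof.
move=> mf ig h ih c fgh; split => //.
have : mu.-integrable setT (EFin \o (sqmod \o f)).
  apply: (@le_integrable _ _ _ _ _ measurableT _
    (fun x => c%:E * ((EFin \o (sqmod \o g)) \+ (EFin \o (sqmod \o h))) x)%E).
  - by apply/measurable_EFinP; exact: cmeasurable_sqmod.
  - move=> x _ /=; rewrite lee_fin ger0_norm ?sqmod_ge0//.
    exact: le_trans (fgh x) (ler_norm _).
  - by apply: integrableZl => //; apply: integrableD => //;
      exact: integrable_sqmod.
case/integrableP => _; apply: le_lt_trans.
rewrite le_eqVlt; apply/orP; left; apply/eqP.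
by apply: eq_integral => x _ /=; rewrite ger0_norm ?sqmod_ge0.
Qed.

Lemma square_integrable0 : square_integrable (0 : T -> R[i]).
Proof.
split; first by split; exact: measurable_cst.
under eq_integral do rewrite /sqmod /= expr0n addr0.
by rewrite integral0.
Qed.

Lemma cmeasurable_lin (a : R[i]) f g :
  cmeasurable f -> cmeasurable g -> cmeasurable (a *: f + g).
Proof.
move=> [fR fI] [gR gI]; split.
- rewrite (_ : _ \o _ = (fun x => Re a * Re (f x) - Im a * Im (f x) + Re (g x))).
    apply: measurable_funD => //.
    by apply: measurable_funB; apply: measurable_funM => //; exact: measurable_cst.
  apply/funext => x /=; rewrite -[(a *: f + g) x]/(a * f x + g x).
  by case: a (f x) (g x) => ? ? [? ?] [? ?].
- rewrite (_ : _ \o _ = (fun x => Re a * Im (f x) + Im a * Re (f x) + Im (g x))).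
    apply: measurable_funD => //.
    by apply: measurable_funD; apply: measurable_funM => //; exact: measurable_cst.
  apply/funext => x /=; rewrite -[(a *: f + g) x]/(a * f x + g x).
  by case: a (f x) (g x) => ? ? [? ?] [? ?].
Qed.

Lemma sqmod_lin (a z w : R[i]) :
  sqmod (a * z + w) <= (2 * sqmod a + 2) * (sqmod z + sqmod w).
Proof.
case: a z w => a b [x y] [u v]; rewrite /sqmod /=.
have h1 : 0 <= a ^+ 2 + b ^+ 2 by rewrite addr_ge0 ?sqr_ge0.
have h2 : 0 <= x ^+ 2 + y ^+ 2 by rewrite addr_ge0 ?sqr_ge0.
have h3 : 0 <= u ^+ 2 + v ^+ 2 by rewrite addr_ge0 ?sqr_ge0.
have := mulr_ge0 h1 h3.
have := sqr_ge0 (a * x - b * y - u); have := sqr_ge0 (a * y + b * x - v).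
rewrite -subr_ge0 => k1; rewrite -subr_ge0 => k2; rewrite -subr_ge0 => k3.
rewrite -subr_ge0.
set e := (X in 0 <= X).
suff -> : e = (a * x - b * y - u) ^+ 2 + (a * y + b * x - v) ^+ 2 +
  2 * ((a ^+ 2 + b ^+ 2) * (u ^+ 2 + v ^+ 2)) + 2 * (x ^+ 2 + y ^+ 2).
  by rewrite !addr_ge0 ?sqr_ge0 ?mulr_ge0 ?addr_ge0 ?sqr_ge0.
by rewrite /e; ring.
Qed.

Lemma square_integrable_lin (a : R[i]) f g : square_integrable f ->
  square_integrable g -> square_integrable (a *: f + g).
Proof.
move=> If Ig; apply: (square_integrable_dominated _ If Ig
  (c := 2 * sqmod a + 2)); first by apply: cmeasurable_lin; [case: If|case: Ig].
by move=> x; exact: sqmod_lin.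
Qed.

Lemma cintegrable_conjM f g : square_integrable f -> square_integrable g ->
  cintegrable (fun x => (f x)^*%C * g x).
Proof.
move=> If Ig; have [[fR fI] _] := If; have [[gR gI] _] := Ig.
have Ifg : mu.-integrable setT
    ((EFin \o (sqmod \o f)) \+ (EFin \o (sqmod \o g)))%E.
  by apply: integrableD => //; exact: integrable_sqmod.
have ab (a b c e : R) : `|a * c + b * e| <= (a ^+ 2 + b ^+ 2) + (c ^+ 2 + e ^+ 2).
  have := sqr_ge0 (a - c); have := sqr_ge0 (a + c).
  have := sqr_ge0 (b - e); have := sqr_ge0 (b + e).
  by rewrite ler_norml => *; apply/andP; split; nra.
split; apply: le_integrable Ifg => //.
- apply/measurable_EFinP.
  rewrite (_ : _ \o _ = (fun x => Re (f x) * Re (g x) + Im (f x) * Im (g x))).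
    by apply: measurable_funD; exact: measurable_funM.
  by apply/funext => x /=; case: (f x) (g x) => ? ? [? ?] /=; ring.
- move=> x _ /=; rewrite lee_fin (ger0_norm (addr_ge0 (sqmod_ge0 _) (sqmod_ge0 _))).
  case: (f x) (g x) => a b [c e] /=; rewrite mulNr opprK; exact: ab.
- apply/measurable_EFinP.
  rewrite (_ : _ \o _ = (fun x => Re (f x) * Im (g x) - Im (f x) * Re (g x))).
    by apply: measurable_funB; exact: measurable_funM.
  by apply/funext => x /=; case: (f x) (g x) => ? ? [? ?] /=; ring.
- move=> x _ /=; rewrite lee_fin (ger0_norm (addr_ge0 (sqmod_ge0 _) (sqmod_ge0 _))).
  case: (f x) (g x) => a b [c e] /=; rewrite mulNr /sqmod /= -mulrN.
  rewrite (addrC (c ^+ 2)) -(sqrrN b) mulrN -mulNr; exact: ab.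
Qed.

Lemma cintegralE f (u v : T -> R) : (forall x, f x = Complex (u x) (v x)) ->
  cintegral mu setT f = Complex (\int[mu]_x u x) (\int[mu]_x v x).
Proof.
by move=> fE; congr Complex; apply: eq_Rintegral => x _; rewrite fE.
Qed.

Lemma cintegralD f g : cintegrable f -> cintegrable g ->
  cintegral mu setT (fun x => f x + g x) =
  cintegral mu setT f + cintegral mu setT g.
Proof.
move=> [fR fI] [gR gI].
rewrite (@cintegralE _ (fun x => Re (f x) + Re (g x))
  (fun x => Im (f x) + Im (g x))); first by rewrite !RintegralD.
by move=> x; case: (f x) (g x) => ? ? [].
Qed.

Lemma cintegralZ (a : R[i]) f : cintegrable f ->
  cintegral mu setT (fun x => a * f x) = a * cintegral mu setT f.
Proof.
move=> [fR fI].
rewrite (@cintegralE _ (fun x => Re a * Re (f x) - Im a * Im (f x))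
  (fun x => Re a * Im (f x) + Im a * Re (f x))); last first.
  by move=> x; case: a (f x) => ? ? [].
have kf (k : R) h : mu.-integrable setT (EFin \o h) ->
    mu.-integrable setT (EFin \o (fun x => k * h x)).
  by move=> ih; exact: (integrableZl measurableT k ih).
rewrite RintegralB; [|exact: measurableT|exact: kf|exact: kf].
rewrite RintegralD; [|exact: measurableT|exact: kf|exact: kf].
by rewrite !RintegralZl//; case: a.
Qed.

Lemma cintegral_conj f : cintegrable f ->
  cintegral mu setT (fun x => (f x)^*%C) = (cintegral mu setT f)^*%C.
Proof.
move=> [fR fI].
rewrite (@cintegralE _ (fun x => Re (f x)) (fun x => -1 * Im (f x))); last first.
  by move=> x; case: (f x) => ? ? /=; rewrite mulN1r.
by rewrite RintegralZl// mulN1r.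
Qed.

Lemma cintegral_sqmod f :
  cintegral mu setT (fun x => (f x)^*%C * f x) =
  (\int[mu]_x sqmod (f x))%:C%C.
Proof.
rewrite (@cintegralE _ (fun x => sqmod (f x)) (fun=> 0)).
  by rewrite Rintegral_cst// mul0r.
move=> x; rewrite /sqmod; case: (f x) => a b /=.
by apply/eqP; rewrite eq_complex /=; apply/andP; split; apply/eqP; ring.
Qed.

Lemma eq_ae_cintegral f g : cintegrable f -> cintegrable g ->
  {ae mu, forall x, f x = g x} ->
  cintegral mu setT f = cintegral mu setT g.
Proof.
move=> [/measurable_int fR /measurable_int fI].
move=> [/measurable_int gR /measurable_int gI] fg.
rewrite /cintegral; congr Complex; congr fine;
  (apply: ae_eq_integral => //; apply: filterS fg => x /= -> //).
Qed.

Definition ae_zero f := {ae mu, forall x, f x = 0}.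

Lemma ae_zero_sqmod f : square_integrable f ->
  \int[mu]_x sqmod (f x) = 0 -> ae_zero f.
Proof.
move=> If; have := integrable_sqmod If => iF.
move=> I0.
have h : (\int[mu]_x (sqmod (f x))%:E = 0)%E.
  by rewrite -[RHS]/(0%:E) -I0 /Rintegral fineK//; exact: integrable_fin_num.
have mE : measurable_fun setT (EFin \o (sqmod \o f)).
  by apply/measurable_EFinP; apply: cmeasurable_sqmod; case: If.
have /(ae_eq_integral_abs mu measurableT mE) :
    (\int[mu]_x `|(EFin \o (sqmod \o f)) x| = 0)%E.
  rewrite -[RHS]h; apply: eq_integral => x _ /=.
  by rewrite ger0_norm ?sqmod_ge0.
by apply: filterS => x /(_ I) [/sqmod_eq0].
Qed.

End ComplexIntegral.

Section L2.
Context d (T : measurableType d) (R : realType) (mu : {measure set T -> \bar R}).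

Definition L2pred : {pred T -> R[i]} := fun f => `[< square_integrable mu f >].

Lemma L2pred_submod_closed : submod_closed L2pred.
Proof.
split; first exact/asboolP/square_integrable0.
by move=> a f g /asboolP ? /asboolP ?; exact/asboolP/square_integrable_lin.
Qed.

HB.instance Definition _ :=
  GRing.isSubmodClosed.Build R[i] (T -> R[i]) L2pred L2pred_submod_closed.

Record L2fun := MkL2fun { L2fun_val :> T -> R[i]; _ : L2fun_val \in L2pred }.

HB.instance Definition _ := [isSub for L2fun_val].
HB.instance Definition _ := [Choice of L2fun by <:].
HB.instance Definition _ := [SubChoice_isSubLmodule of L2fun by <:].

Lemma L2funP (f : L2fun) : square_integrable mu f.
Proof. by have /asboolP := valP f. Qed.

Definition L2null : {pred L2fun} := fun f => `[< ae_zero mu f >].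

Lemma L2null_submod_closed : submod_closed L2null.
Proof.
split; first by apply/asboolP; exact: aeW.
move=> a f g /asboolP f0 /asboolP g0; apply/asboolP.
apply: filterS2 f0 g0 => x f0 g0.
by rewrite -[LHS]/(a * f x + g x) f0 g0 mulr0 addr0.
Qed.

HB.instance Definition _ :=
  GRing.isSubmodClosed.Build R[i] L2fun L2null L2null_submod_closed.

Local Open Scope quotient_scope.

Definition L2 : Type := Quotient.quot L2null.
HB.instance Definition _ := GRing.Zmodule.on L2.
HB.instance Definition _ := Quotient.on L2.

(* Applying F : L2 to a point uses a chosen representative, so that pointwise
   statements about F are only meaningful almost everywhere. *)
Definition L2_repr (F : L2) : T -> R[i] := repr F.
Coercion L2_repr : L2 >-> Funclass.

Implicit Types F G K : L2.

Definition L2_class (f : L2fun) : L2 := \pi_L2 f.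

Lemma L2_eqP (f g : L2fun) :
  L2_class f = L2_class g <-> {ae mu, forall x, f x = g x}.
Proof.
have -> : L2_class f = L2_class g <-> ae_zero mu (f - g : L2fun).
  rewrite /L2_class; split=> [/eqP|h].
    by rewrite -[_ == _]Quotient.idealrBE => /asboolP.
  by apply/eqP; rewrite -[_ == _]Quotient.idealrBE; exact/asboolP.
split; apply: filterS => x.
  by rewrite -[X in X = 0]/(f x - g x) => /subr0_eq.
by move=> fg; rewrite -[LHS]/(f x - g x) fg subrr.
Qed.

Lemma L2_reprK (F : L2) : L2_class (repr F) = F.
Proof. exact: reprK. Qed.

Lemma L2_classE (f : L2fun) : {ae mu, forall x, L2_class f x = f x}.
Proof. exact/L2_eqP/L2_reprK. Qed.

Lemma L2_ext (F G : L2) : {ae mu, forall x, F x = G x} -> F = G.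
Proof. by move=> FG; rewrite -(L2_reprK F) -(L2_reprK G); exact/L2_eqP. Qed.

Lemma L2_classD f g : L2_class (f + g) = L2_class f + L2_class g.
Proof. by rewrite /L2_class raddfD. Qed.

Definition L2_scale (a : R[i]) (F : L2) : L2 := L2_class (a *: repr F).

Lemma L2_class_scale a f : L2_class (a *: f) = L2_scale a (L2_class f).
Proof.
apply/L2_eqP; apply: filterS (L2_classE f) => x fx.
rewrite -[LHS]/(a * f x) -[RHS]/(a * L2_class f x).
by rewrite fx.
Qed.

Lemma L2_scaleA a b F : L2_scale a (L2_scale b F) = L2_scale (a * b) F.
Proof. by rewrite -(L2_reprK F) -!L2_class_scale scalerA. Qed.

Lemma L2_scale1 : left_id 1 L2_scale.
Proof. by move=> F; rewrite -(L2_reprK F) -!L2_class_scale scale1r. Qed.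

Lemma L2_scaleDr : right_distributive L2_scale +%R.
Proof.
move=> a F G; rewrite -(L2_reprK F) -(L2_reprK G).
by rewrite -L2_classD -!L2_class_scale -L2_classD scalerDr.
Qed.

Lemma L2_scaleDl F : {morph L2_scale^~ F : a b / a + b}.
Proof.
move=> a b; rewrite -(L2_reprK F).
by rewrite -!L2_class_scale -L2_classD scalerDl.
Qed.

HB.instance Definition _ := GRing.Zmodule_isLmodule.Build R[i] L2
  L2_scaleA L2_scale1 L2_scaleDr L2_scaleDl.

Lemma L2_addE (F G : L2) : {ae mu, forall x, (F + G : L2) x = F x + G x}.
Proof.
have := L2_classE (repr F + repr G); rewrite L2_classD !L2_reprK.
by apply: filterS => x ->.
Qed.

Lemma L2_scaleE (a : R[i]) (F : L2) : {ae mu, forall x, (a *: F : L2) x = a * F x}.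
Proof. by have := L2_classE (a *: repr F); apply: filterS => x ->. Qed.

Lemma L2_square_integrable (F : L2) : square_integrable mu F.
Proof. exact: L2funP. Qed.
Hint Resolve L2_square_integrable : core.

Definition L2_dot (F G : L2) : R[i] :=
  cintegral mu setT (fun x => (F x)^*%C * G x).

Lemma L2_dotC F G : L2_dot F G = (L2_dot G F)^*%C.
Proof.
rewrite /L2_dot -cintegral_conj; last exact: cintegrable_conjM.
congr (cintegral _ _ _); apply/funext => x.
by case: (F x) (G x) => ? ? [? ?] /=; congr Complex; ring.
Qed.

Lemma L2_dotDr F G K : L2_dot F (G + K) = L2_dot F G + L2_dot F K.
Proof.
rewrite /L2_dot -cintegralD; try exact: cintegrable_conjM.
rewrite (_ : (fun x => _ + _) = (fun x => (F x)^*%C * (G x + K x))); last first.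
  by apply/funext => x; rewrite mulrDr.
apply: eq_ae_cintegral; [exact: cintegrable_conjM| |].
  apply: cintegrable_conjM => //.
  by rewrite (_ : (fun _ => _) = 1 *: (G : T -> R[i]) + K);
    [exact: square_integrable_lin|rewrite scale1r].
by apply: filterS (L2_addE G K) => x ->.
Qed.

Lemma L2_dotZr (a : R[i]) F G : L2_dot F (a *: G) = a * L2_dot F G.
Proof.
rewrite /L2_dot -cintegralZ; last exact: cintegrable_conjM.
rewrite (_ : (fun x => a * _) = (fun x => (F x)^*%C * (a * G x))); last first.
  by apply/funext => x; rewrite mulrCA.
apply: eq_ae_cintegral; [exact: cintegrable_conjM| |].
  apply: cintegrable_conjM => //.
  rewrite (_ : (fun _ => _) = a *: (G : T -> R[i]) + 0);
    last by rewrite addr0.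
  by apply: square_integrable_lin => //; exact: square_integrable0.
by apply: filterS (L2_scaleE a G) => x ->.
Qed.

Lemma L2_dot_ge0 F : 0 <= L2_dot F F.
Proof.
by rewrite /L2_dot cintegral_sqmod lecR Rintegral_ge0// => x _; exact: sqmod_ge0.
Qed.

Lemma L2_dot_eq0 F : L2_dot F F = 0 -> F = 0.
Proof.
rewrite /L2_dot cintegral_sqmod => -[/ae_zero_sqmod F0].
rewrite -(L2_reprK F) -[0 in RHS](_ : L2_class 0 = _); last exact: raddf0.
by apply/L2_eqP; apply: filterS (F0 (L2_square_integrable F)) => x Fx; exact: Fx.
Qed.

Definition L2_norm (F : L2) : R[i] := (Num.sqrt (Re (L2_dot F F)))%:C%C.

Lemma L2_ler_normD F G : L2_norm (F + G) <= L2_norm F + L2_norm G.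
Proof.
rewrite -rmorphD lecR; apply: form_sqrt_ler_normD.
- exact: L2_dotC.
- exact: L2_dotDr.
- exact: L2_dotZr.
- exact: L2_dot_ge0.
- exact: L2_dot_eq0.
Qed.

Lemma L2_normZ (a : R[i]) F : L2_norm (a *: F) = `|a| * L2_norm F.
Proof.
rewrite /L2_norm (form_qZ L2_dotC L2_dotZr L2_dot_ge0).
by rewrite sqrtrM ?addr_ge0 ?sqr_ge0// rmorphM normc_def.
Qed.

Lemma L2_norm_eq0 F : L2_norm F = 0 -> F = 0.
Proof.
move=> [] /eqP; rewrite sqrtr_eq0 => h.
apply: (form_q_eq0 L2_dot_ge0 L2_dot_eq0).
by apply/eqP; rewrite eq_le h (form_q_ge0 L2_dot_ge0).
Qed.

HB.instance Definition _ := Lmodule_isNormed.Build R[i] L2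
  L2_ler_normD L2_normZ L2_norm_eq0.

Lemma L2_dot_norm F : L2_dot F F = `|F| ^+ 2.
Proof.
rewrite -[`|F|]/(L2_norm F) /L2_norm -rmorphXn sqr_sqrtr.
  exact: (form_selfE L2_dot_ge0).
exact: (form_q_ge0 L2_dot_ge0).
Qed.

HB.instance Definition _ := isInnerProduct.Build R L2
  L2_dotC L2_dotDr L2_dotZr L2_dot_norm.

(* Meaningful only when f is square integrable. *)
Definition toL2 (f : T -> R[i]) : L2 :=
  if pselect (f \in L2pred) is left h then L2_class (MkL2fun h) else 0.

Lemma toL2E f : square_integrable mu f -> {ae mu, forall x, toL2 f x = f x}.
Proof.
rewrite /toL2 => If; case: pselect => [h|[]]; last exact/asboolP.
exact: (L2_classE (MkL2fun h)).
Qed.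

End L2.
Arguments toL2 {d T R} mu f.

Section Operators.
Context (R : realType).

Definition bounded_linear (U V : normedModType R[i]) (A : U -> V) : Prop :=
  linear A /\ continuous A.

(* The default value 0 only occurs when there is no adjoint, hence never for
   bounded operators between Hilbert spaces, such as the L^2-spaces below. *)
Definition adj (U V : innerProductType R) (A : U -> V) : V -> U :=
  xget (cst 0) [set B : V -> U | forall x y, dot (A x) y = dot x (B y)].

Definition unitary (U V : innerProductType R) (A : U -> V) : Prop :=
  [/\ linear A, forall x y, dot (A x) (A y) = dot x y & range A = setT].

Definition lspan (V : lmodType R[i]) (Y : set V) : set V :=
  [set x | exists n (c : 'I_n -> R[i]) (y : 'I_n -> V),
    (forall i, Y (y i)) /\ x = \sum_(i < n) c i *: y i].

(* ||A - B|| <= e for the operator norm *)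
Definition opdist_le (U V : normedModType R[i]) (A B : U -> V) (e : R) : Prop :=
  forall x, `|A x - B x| <= e%:C%C * `|x|.

(* [Y] for a set Y of bounded operators: closure in operator norm *)
Definition clspan (U V : normedModType R[i]) (Y : set (U -> V)) :
    set (U -> V) :=
  [set A | bounded_linear A /\
    forall e : R, 0 < e -> exists2 S, lspan Y S & opdist_le A S e].

(* Separated completion of alpha (.) h (.) beta: by the Gram formula and
   totality, the map alpha * h * beta -> H_alpha (x)_beta K factors through an
   isometry with dense range from the separated quotient, hence the Hilbert
   space is determined up to a unique unitary. The values of [rt_elem] outside
   of alpha * h * beta are irrelevant. *)
Record rtensor (h H K : innerProductType R)
    (alpha : set (h -> H)) (beta : set (h -> K)) := RTensor {
  rt_space :> hilbertType R;
  rt_elem : (h -> H) -> h -> (h -> K) -> rt_space;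
  rt_dot : forall xi zeta eta xi' zeta' eta',
    alpha xi -> beta eta -> alpha xi' -> beta eta' ->
    dot (rt_elem xi zeta eta) (rt_elem xi' zeta' eta') =
    dot zeta (adj xi (xi' (adj eta (eta' zeta'))));
  rt_total : closure (lspan [set w | exists xi zeta eta,
    [/\ alpha xi, beta eta & w = rt_elem xi zeta eta]]) = setT
}.

Arguments rt_elem {h H K alpha beta} r _ _ _.

(* |xi>_1 and |eta>_2 are the unique bounded operators with these values, as
   [beta h] = K and [alpha h] = H for C*-factorizations. *)
Definition ket1 (h H K : innerProductType R) (alpha : set (h -> H))
    (beta : set (h -> K)) (W : rtensor alpha beta) (xi : h -> H) : K -> W :=
  xget (cst 0) [set A : K -> W | bounded_linear A /\
    forall eta zeta, beta eta -> A (eta zeta) = rt_elem W xi zeta eta].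

Definition ket2 (h H K : innerProductType R) (alpha : set (h -> H))
    (beta : set (h -> K)) (W : rtensor alpha beta) (eta : h -> K) : H -> W :=
  xget (cst 0) [set A : H -> W | bounded_linear A /\
    forall xi zeta, alpha xi -> A (xi zeta) = rt_elem W xi zeta eta].

Arguments ket1 {h H K alpha beta} W xi _.

Definition bra1 (h H K : innerProductType R) (alpha : set (h -> H))
    (beta : set (h -> K)) (W : rtensor alpha beta) (xi : h -> H) : W -> K :=
  adj (ket1 W xi).

Arguments ket2 {h H K alpha beta} W eta _.
Arguments bra1 {h H K alpha beta} W xi _.

Definition regular (h H : innerProductType R)
    (alpha beta betahat : set (h -> H))
    (S : rtensor betahat alpha) (W : rtensor alpha beta) (V : S -> W) : Prop :=
  clspan [set bra1 W xi \o V \o ket2 S eta | xi in alpha & eta in alpha] =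
  clspan [set xi \o adj eta | xi in alpha & eta in alpha].

End Operators.

(* [gmul x y] is only meaningful when [gsrc x = grng y]; [gunit] embeds the
   unit space G0 into G. *)
Record groupoid (G0 G : Type) := Groupoid {
  grng : G -> G0;
  gsrc : G -> G0;
  gunit : G0 -> G;
  gmul : G -> G -> G;
  ginv : G -> G;
  grng_unit : forall u, grng (gunit u) = u;
  gsrc_unit : forall u, gsrc (gunit u) = u;
  grng_mul : forall x y, gsrc x = grng y -> grng (gmul x y) = grng x;
  gsrc_mul : forall x y, gsrc x = grng y -> gsrc (gmul x y) = gsrc y;
  gmulA : forall x y z, gsrc x = grng y -> gsrc y = grng z ->
    gmul x (gmul y z) = gmul (gmul x y) z;
  gmul1l : forall x, gmul (gunit (grng x)) x = x;
  gmul1r : forall x, gmul x (gunit (gsrc x)) = x;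
  grng_inv : forall x, grng (ginv x) = gsrc x;
  gsrc_inv : forall x, gsrc (ginv x) = grng x;
  gmulVl : forall x, gmul (ginv x) x = gunit (gsrc x);
  gmulVr : forall x, gmul x (ginv x) = gunit (grng x)
}.

Definition topological_groupoid (G0 G : topologicalType) (g : groupoid G0 G) :=
  [/\ continuous (grng g), continuous (gsrc g), continuous (gunit g),
      continuous (ginv g) &
      {within [set p : G * G | gsrc g p.1 = grng g p.2],
        continuous (fun p : G * G => gmul g p.1 p.2)}].

Definition grfib (G0 G : Type) (g : groupoid G0 G) (u : G0) : set G :=
  [set x | grng g x = u].
Definition gsfib (G0 G : Type) (g : groupoid G0 G) (u : G0) : set G :=
  [set x | gsrc g x = u].

Notation borel X := (g_sigma_algebraType (@open X)).

Section RadonMeasures.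
Context (R : realType) (X : ptopologicalType).

Definition Cc : set (X -> R[i]) :=
  [set f | continuous (f : X -> R[i]^o) /\
           compact (closure [set x | f x != 0])].

Variable m : {measure set borel X -> \bar R}.

Definition radon_measure : Prop :=
  [/\ forall K : set X, compact K -> (m K < +oo)%E,
      forall A : set (borel X), measurable A ->
        m A = ereal_inf [set m U | U in [set U : set X | open U /\ A `<=` U]] &
      forall U : set X, open U ->
        m U = ereal_sup [set m K | K in [set K : set X | compact K /\ K `<=` U]]].

Definition msupport : set X :=
  [set x | forall U : set X, open U -> U x -> (0 < m U)%E].

End RadonMeasures.

Arguments ket1 {R h H K alpha beta} W xi _.
Arguments ket2 {R h H K alpha beta} W eta _.
Arguments bra1 {R h H K alpha beta} W xi _.

Section GroupoidMeasures.
Context (R : realType) (G0 G : ptopologicalType) (g : groupoid G0 G).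
Variables (lam : G0 -> {measure set borel G -> \bar R})
  (mu : {measure set borel G0 -> \bar R})
  (nu : {measure set borel G -> \bar R}).

Definition left_haar_system : Prop :=
  [/\ forall u, radon_measure (lam u),
      forall u, msupport (lam u) = grfib g u,
      forall f : G -> R[i], Cc f ->
        continuous (fun u : G0 => cintegral (lam u) (grfib g u) f : R[i]^o) &
      forall x (f : G -> R[i]), Cc f ->
        cintegral (lam (gsrc g x)) (grfib g (gsrc g x)) (fun y => f (gmul g x y))
        = cintegral (lam (grng g x)) (grfib g (grng g x)) f].

Definition is_nu : Prop :=
  forall f : borel G -> \bar R, measurable_fun setT f -> (forall x, 0 <= f x)%E ->
    (\int[nu]_x f x = \int[mu]_u \int[lam u]_(x in grfib g u) f x)%E.

(* The measures on the closed subsets G^2_{s,r} and G^2_{r,r} are viewed as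
   measures on G x G carried by these subsets, so that the L^2-spaces agree. As
   G is second countable, the product sigma-algebra is the Borel one. *)
Definition is_nu2_sr (m : {measure set (borel G * borel G) -> \bar R}) : Prop :=
  forall f : (borel G * borel G)%type -> \bar R,
    measurable_fun setT f -> (forall p, 0 <= f p)%E ->
    (\int[m]_p f p = \int[mu]_u \int[lam u]_(x in grfib g u)
       \int[lam (gsrc g x)]_(y in grfib g (gsrc g x)) f (x, y))%E.

Definition is_nu2_rr (m : {measure set (borel G * borel G) -> \bar R}) : Prop :=
  forall f : (borel G * borel G)%type -> \bar R,
    measurable_fun setT f -> (forall p, 0 <= f p)%E ->
    (\int[m]_p f p = \int[mu]_u \int[lam u]_(x in grfib g u)
       \int[lam u]_(y in grfib g u) f (x, y))%E.

Definition ginv_image (m : set (borel G) -> \bar R) : set (borel G) -> \bar R :=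
  pushforward m (ginv g : borel G -> borel G).

Definition quasi_invariant : Prop :=
  nu `<< ginv_image nu /\ ginv_image nu `<< nu.

Definition is_modular_density (D : borel G -> R) : Prop :=
  [/\ measurable_fun setT D, forall x, 0 <= D x &
      forall A : set (borel G), measurable A ->
        nu A = (\int[ginv_image nu]_(x in A) (D x)%:E)%E].

Definition jmap (xi : G -> R[i]) (zeta : L2 mu) : L2 nu :=
  toL2 nu (fun x => xi x * zeta (grng g x)).

Definition jhatmap (D : borel G -> R) (xi : G -> R[i]) (zeta : L2 mu) : L2 nu :=
  toL2 nu (fun x => xi x * ((Num.sqrt (D x))^-1)%:C%C * zeta (gsrc g x)).

(* square of the norm of the C*-module obtained by completing C_c(G) *)
Definition module_sqnorm (fib : G0 -> set G)
    (m : G0 -> set (borel G) -> \bar R) (xi : G -> R[i]) : \bar R :=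
  ereal_sup [set (\int[m u]_(x in fib u) (sqmod (xi x))%:E)%E | u in [set: G0]].

(* Image of the completion of C_c(G) under the continuous extension of j: the
   points of the completion are represented by Cauchy sequences in C_c(G). *)
Definition completed_image (fib : G0 -> set G)
    (m : G0 -> set (borel G) -> \bar R)
    (j : (G -> R[i]) -> L2 mu -> L2 nu) : set (L2 mu -> L2 nu) :=
  [set a | bounded_linear a /\ exists xi : nat -> G -> R[i],
    [/\ forall n, Cc (xi n),
        forall e : R, 0 < e -> exists N, forall p q, (N <= p)%N -> (N <= q)%N ->
          (module_sqnorm fib m (xi p - xi q)%R <= (e ^+ 2)%:E)%E &
        forall e : R, 0 < e ->
          \forall n \near \oo, opdist_le (j (xi n)) a e]].

Definition alpha_fact : set (L2 mu -> L2 nu) :=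
  completed_image (grfib g) lam jmap.

Definition betahat_fact (D : borel G -> R) : set (L2 mu -> L2 nu) :=
  completed_image (gsfib g) (fun u => ginv_image (lam u)) (jhatmap D).

(* |j(xi)>_2 omega is identified with (x, y) |-> omega(x) xi(y) *)
Definition rtensor_identification (gamma : set (L2 mu -> L2 nu))
    (W : rtensor gamma alpha_fact)
    (m : {measure set (borel G * borel G) -> \bar R}) (Phi : W -> L2 m) : Prop :=
  unitary Phi /\
  forall (xi : G -> R[i]) (omega : L2 nu), Cc xi ->
    Phi (ket2 W (jmap xi) omega) = toL2 m (fun p => omega p.1 * xi p.2).

End GroupoidMeasures.
Arguments alpha_fact {R G0 G} g lam mu nu.
Arguments betahat_fact {R G0 G} g lam mu nu D.

(* Main.v *)
Require Import Defs.
From HB Require Import structures.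
From mathcomp Require Import all_boot all_order all_algebra.
From mathcomp Require Import all_classical all_reals all_analysis.
From mathcomp Require Import measurable_realfun finmap.
From mathcomp Require Import complex ring lra.

Set Implicit Arguments.
Unset Strict Implicit.
Unset Printing Implicit Defensive.

Import Order.TTheory GRing.Theory Num.Theory.
Import numFieldNormedType.Exports.
Local Open Scope classical_set_scope.
Local Open Scope ring_scope.
Import HBNNSimple.

(** Write $j$ for the embedding of $C_c(G)$ into $\mathcal L(\mathfrak H,H)$, so
    that $\alpha=\beta$ is the closure of $j(C_c(G))$, and identify the two
    relative tensor products with $L^2(G^2_{s,r})$ and $L^2(G^2_{r,r})$. For $a$,
    $b$, $c$, $d$ in $C_c(G)$ the two families of operators that generate the
    spaces to be compared have integral kernels on $G^2_{r,r}$: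
    $$\langle\omega'|\langle j(a)|_1V|j(b)\rangle_2\omega\rangle=
      \int\overline{\omega'(y)}\,\overline{a(x)}\,b(x^{-1}y)\,\omega(x)\,
      d\nu^2_{r,r}(x,y),$$
    $$\langle\omega'|j(c)j(d)^*\omega\rangle=
      \int\overline{\omega'(y)}\,\overline{d(x)}\,c(y)\,\omega(x)\,
      d\nu^2_{r,r}(x,y).$$
    The second formula holds because $j(c)j(d)^*=\langle j(d)|_1|j(c)\rangle_2$
    ([bra1_ket2]), which follows from the Gram formula and the fact that the
    operators $j(d)^*j(e)$ are multiplications by functions on $G^0$ and hence
    commute.

    The kernel $\overline{a(x)}b(x^{-1}y)$ is a continuous compactly supported
    function on the closed set $G^2_{r,r}$, so it is approximated by finite sums
    $\sum_v\overline{d_v(x)}c_v(y)$ ([bra_V_ket_approx]). Conversely, in the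
    coordinates $(x,z)=(x,x^{-1}y)$ the kernel $\overline{d(x)}c(y)$ becomes the
    continuous compactly supported function $\overline{d(x)}c(xz)$ on
    $G^2_{s,r}$, which is approximated by sums
    $\sum_v\overline{a_v(x)}b_v(z)$ ([rank_one_approx]).

    Uniform closeness is not enough to control operator norms. The approximation
    lemma [kernel_approx] bounds the error by $\epsilon\,p(x)q(y)$ with weights
    $p,q\in C_c(G)$ that do not depend on $\epsilon$. By the Cauchy-Schwarz
    inequality the operator with such a kernel has norm at most $\epsilon$ times
    the product of the norms of $p$ and $q$ in $L^2(G,\lambda)$
    ([kernel_bound]); in the second case the weight $q(x^{-1}y)$ is the kernel of
    $V|j(q)\rangle_2$, whose norm is that of $|j(q)\rangle_2$ as $V$ is unitary.

    Most of the text establishes what makes these formulas meaningful. Adjoints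
    exist because bounded functionals on $L^2$-spaces are represented by vectors
    ([riesz], [L2_seq_complete]). Creation operators are given as choices among
    the bounded operators with prescribed values, so their existence and
    uniqueness have to be proved: uniqueness from the density of
    $\alpha\mathfrak H$ and $\hat\beta\mathfrak H$ in $H$, existence of
    $|j(b)\rangle_2$ from the given identifications with $L^2$-spaces
    ([ket2_jmap]), existence of $|j(a)\rangle_1$ by transporting a multiplication
    operator ([ket1_jmap]), and the general case by passing to limits. Left
    invariance is extended from test functions to Borel functions
    ([left_invariance]), which shows that the shear
    $(x,y)\mapsto(x,x^{-1}y)$ carries $\nu^2_{r,r}$ to $\nu^2_{s,r}$
    ([shear_integral]) and so turns the almost everywhere description of $V$ into
    the first kernel formula. *)

Local Notation Re := (@complex.Re _).
Local Notation Im := (@complex.Im _).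

(** * Hilbert space preliminaries *)

Section RealNorm.
Context (R : realType).

Lemma ReD (a b : R[i]) : Re (a + b) = Re a + Re b.
Proof. by case: a b => ? ? [? ?]. Qed.

Lemma ReN (a : R[i]) : Re (- a) = - Re a.
Proof. by case: a. Qed.

Lemma ReZ (t : R) (a : R[i]) : Re (t%:C%C * a) = t * Re a.
Proof. by case: a => ? ? /=; rewrite mul0r subr0. Qed.

Lemma Re_conj (a : R[i]) : Re (a^*%C) = Re a.
Proof. by case: a. Qed.

Lemma norm_real (t : R) : 0 <= t -> `|t%:C%C : R[i]| = t%:C%C.
Proof. by move=> t0; rewrite ger0_norm// lecR. Qed.

Lemma complexP (a b : R[i]) : Re a = Re b -> Im a = Im b -> a = b.
Proof. by case: a b => ? ? [? ?] /= -> ->. Qed.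

Definition nrm (U : normedModType R[i]) (x : U) : R := Re `|x|.

Lemma nrmE (U : normedModType R[i]) (x : U) : `|x| = (nrm x)%:C%C.
Proof. by rewrite /nrm [LHS]complexE (ger0_Im (normr_ge0 x)) mulr0 addr0. Qed.

Section normed.
Variable U : normedModType R[i].
Implicit Types x y : U.

Lemma nrm_ge0 x : 0 <= nrm x.
Proof. by have := normr_ge0 x; rewrite nrmE lecR. Qed.

Lemma nrm0 : nrm (0 : U) = 0.
Proof. by rewrite /nrm normr0. Qed.

Lemma nrm_eq0 x : nrm x = 0 -> x = 0.
Proof. by move=> h; apply: normr0_eq0; rewrite nrmE h. Qed.

Lemma nrmD x y : nrm (x + y) <= nrm x + nrm y.
Proof. by have := ler_normD x y; rewrite !nrmE -rmorphD lecR. Qed.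

Lemma nrmN x : nrm (- x) = nrm x.
Proof. by rewrite /nrm normrN. Qed.

Lemma nrmB x y : nrm (x - y) = nrm (y - x).
Proof. by rewrite -nrmN opprB. Qed.

Lemma nrm_le_dist x y : nrm x <= nrm (x - y) + nrm y.
Proof. by apply: le_trans (nrmD _ _); rewrite subrK. Qed.

Lemma nrm_tri x y z : nrm (x - z) <= nrm (x - y) + nrm (y - z).
Proof. by apply: le_trans (nrmD _ _); rewrite addrA subrK. Qed.

Lemma nrmZ (a : R[i]) x : nrm (a *: x) = Re `|a| * nrm x.
Proof.
have -> : `|a| = (Re `|a|)%:C%C.
  by rewrite [LHS]complexE (ger0_Im (normr_ge0 a)) mulr0 addr0.
by rewrite /nrm normrZ nrmE [X in X * _]complexE (ger0_Im (normr_ge0 a)) mulr0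
  addr0 -rmorphM.
Qed.

Lemma nrm_le0P x : (forall e : R, 0 < e -> nrm x <= e) -> x = 0.
Proof.
move=> h; apply: nrm_eq0; apply/eqP; rewrite eq_le nrm_ge0 andbT.
by apply/ler_addgt0Pr => e e0; rewrite add0r h.
Qed.

End normed.

Section operators.
Variables U V : normedModType R[i].

Lemma opdist_leP (A B : U -> V) (e : R) :
  opdist_le A B e <-> forall x, nrm (A x - B x) <= e * nrm x.
Proof.
by split=> h x; have := h x; rewrite !nrmE -rmorphM lecR.
Qed.

(** Sequential completeness, stated with the real-valued norm so that it can
    be proved for $L^2$-spaces without building a complete uniform structure. *)
Definition seq_complete (W : normedModType R[i]) : Prop :=
  forall x : nat -> W,
  (forall e : R, 0 < e -> exists N, forall p q, (N <= p)%N -> (N <= q)%N ->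
     nrm (x p - x q) <= e) ->
  exists l, forall e : R, 0 < e -> exists N, forall n, (N <= n)%N ->
     nrm (x n - l) <= e.

Definition bounded_by (A : U -> V) (c : R) : Prop :=
  forall x, nrm (A x) <= c * nrm x.

Lemma linear_add (A : U -> V) : linear A -> forall x y, A (x + y) = A x + A y.
Proof. by move=> lA x y; have := lA 1 x y; rewrite !scale1r. Qed.

Lemma linear_zero (A : U -> V) : linear A -> A 0 = 0.
Proof.
by move=> lA; have := linear_add lA 0 0; rewrite addr0 => /eqP;
  rewrite -subr_eq0 opprD addNKr oppr_eq0 => /eqP.
Qed.

Lemma linear_scale (A : U -> V) :
  linear A -> forall (a : R[i]) x, A (a *: x) = a *: A x.
Proof.
by move=> lA a x; have := lA a x 0; rewrite (linear_zero lA) !addr0.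
Qed.

Lemma linear_opp (A : U -> V) : linear A -> forall x, A (- x) = - A x.
Proof. by move=> lA x; rewrite -scaleN1r (linear_scale lA) scaleN1r. Qed.

Lemma linear_sub (A : U -> V) : linear A -> forall x y, A (x - y) = A x - A y.
Proof. by move=> lA x y; rewrite (linear_add lA) (linear_opp lA). Qed.

Lemma bounded_linearI (A : U -> V) (c : R) :
  linear A -> bounded_by A c -> bounded_linear A.
Proof.
move=> lA bA; split=> // x; apply/cvgrPdist_le => /= e e0.
have eR : e = (Re e)%:C%C.
  by rewrite [LHS]complexE (ger0_Im (ltW e0)) mulr0 addr0.
have re0 : 0 < Re e by move: e0; rewrite eR ltcR.
have d0 : 0 < Re e / (`|c| + 1).
  by rewrite divr_gt0// ltr_wpDl.
near=> y.
have : nrm (x - y) <= Re e / (`|c| + 1).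
  have : `|x - y| <= (Re e / (`|c| + 1))%:C%C.
    near: y; apply: cvgr_dist_le; first exact: cvg_id.
    by rewrite ltcR.
  by rewrite nrmE lecR.
move=> h; rewrite -(linear_sub lA) nrmE eR lecR.
apply: le_trans (bA _) _.
apply: (@le_trans _ _ ((`|c| + 1) * nrm (x - y))).
  rewrite ler_wpM2r ?nrm_ge0//; apply: le_trans (ler_norm _) _.
  by rewrite lerDl.
by rewrite mulrC -ler_pdivlMr// ltr_wpDl.
Unshelve. all: by end_near. Qed.

Lemma bounded_linear_bound (A : U -> V) :
  bounded_linear A -> exists2 c : R, 0 < c & bounded_by A c.
Proof.
move=> [lA /(_ 0) /cvgrPdist_le /= /(_ 1 ltr01)].
rewrite (linear_zero lA).
rewrite -nbhs_ballE => -[/= d d0 h].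
have dR : d = (Re d)%:C%C.
  by rewrite [LHS]complexE (ger0_Im (ltW d0)) mulr0 addr0.
have rd0 : 0 < Re d by move: d0; rewrite dR ltcR.
exists (2 / Re d); first by rewrite divr_gt0.
move=> x; have [->|x0] := eqVneq x 0.
  by rewrite (linear_zero lA) !nrm0 mulr0.
have nx : 0 < nrm x.
  by rewrite lt0r nrm_ge0 andbT; apply: contra_neq x0 => /nrm_eq0.
pose t := Re d / 2 / nrm x.
have t0 : 0 < t by rewrite /t !divr_gt0.
have : nrm (A (t%:C%C *: x)) <= 1.
  have /h : ball (0 : U) d (t%:C%C *: x).
    rewrite -ball_normE /= sub0r normrN nrmE nrmZ norm_real ?ltW//=.
    rewrite /t divfK ?gt_eqF// dR ltcR.
    by rewrite ltr_pdivrMr// ltr_pMr// ltr1n.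
  by rewrite sub0r normrN nrmE -[1]/(1%:C%C) lecR.
rewrite (linear_scale lA) nrmZ norm_real ?(ltW t0)//=.
move=> hA; suff : t * nrm (A x) <= t * (2 / Re d * nrm x) by rewrite ler_pM2l.
have -> : t * (2 / Re d * nrm x) = 1 by rewrite /t; field; rewrite !gt_eqF.
exact: hA.
Unshelve. all: by end_near. Qed.

End operators.
End RealNorm.

Lemma hilbert_seq_complete (R : realType) (W : hilbertType R) :
  seq_complete W.
Proof.
move=> x cx.
have : cvg (x @ \oo).
  apply: cauchy_cvg; apply: cauchy_exP => /= e e0.
  have eR : e = (Re e)%:C%C.
    by rewrite [LHS]complexE (ger0_Im (ltW e0)) mulr0 addr0.
  have re0 : 0 < Re e by move: e0; rewrite eR ltcR.
  have [|N hN] := cx (Re e / 2); first by rewrite divr_gt0.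
  exists (x N); exists N => // n /= Nn.
  rewrite -ball_normE /= nrmE eR ltcR.
  by apply: le_lt_trans (hN _ _ (leqnn _) Nn) _; rewrite ltr_pdivrMr// ltr_pMr// ltr1n.
move=> /cvg_ex[l /cvgrPdist_le /= h]; exists l => e e0.
have /h[N _ hN] : 0 < e%:C%C :> R[i] by rewrite ltcR.
by exists N => n /hN /=; rewrite nrmE lecR nrmB.
Qed.

Section InnerProduct.
Context (R : realType).
Implicit Types U V : innerProductType R.

Lemma dotDl U (x y z : U) : dot (x + y) z = dot x z + dot y z.
Proof. by rewrite dotC dotDr rmorphD /= -!dotC. Qed.

Lemma dot0r U (x : U) : dot x 0 = 0.
Proof. by rewrite -(scale0r (0 : U)) dotZr mul0r. Qed.

Lemma dotNr U (x y : U) : dot x (- y) = - dot x y.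
Proof. by rewrite -scaleN1r dotZr mulN1r. Qed.

Lemma dotNl U (x y : U) : dot (- x) y = - dot x y.
Proof. by rewrite dotC dotNr rmorphN /= -dotC. Qed.

Lemma dotBr U (x y z : U) : dot x (y - z) = dot x y - dot x z.
Proof. by rewrite dotDr dotNr. Qed.

Lemma dotBl U (x y z : U) : dot (x - y) z = dot x z - dot y z.
Proof. by rewrite dotDl dotNl. Qed.

Lemma dotxx U (x : U) : dot x x = (nrm x ^+ 2)%:C%C.
Proof. by rewrite dot_norm nrmE rmorphXn. Qed.

Lemma Re_dotxx U (x : U) : Re (dot x x) = nrm x ^+ 2.
Proof. by rewrite dotxx. Qed.

Lemma Re_dot_sym U (x y : U) : Re (dot y x) = Re (dot x y).
Proof. by rewrite (dotC y x) Re_conj. Qed.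

Lemma nrm_sqrD U (x y : U) :
  nrm (x + y) ^+ 2 = nrm x ^+ 2 + 2 * Re (dot x y) + nrm y ^+ 2.
Proof.
rewrite -!Re_dotxx dotDl !dotDr !ReD (Re_dot_sym x y); ring.
Qed.

Lemma sqr_ler (a b : R) : 0 <= b -> a ^+ 2 <= b ^+ 2 -> a <= b.
Proof. by move=> b0 h; rewrite leNgt; apply/negP => ab; nra. Qed.

Lemma Re_dot_le U (x y : U) : `|Re (dot x y)| <= nrm x * nrm y.
Proof.
apply: sqr_ler; first by rewrite mulr_ge0 ?nrm_ge0.
rewrite real_normK ?num_real// exprMn -!Re_dotxx.
apply: form_Re_CS.
- exact: dotC.
- exact: dotDr.
- exact: dotZr.
- by move=> z; rewrite dotxx lecR sqr_ge0.
- by move=> z; rewrite dotxx => -[] /eqP; rewrite sqrf_eq0 => /eqP /nrm_eq0.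
Qed.

(** Vectors $x$ near $y$ have $\mathrm{Re}\langle x|y\rangle$ near $\|y\|^2$, so
    that real parts on a dense set suffice. *)
Lemma nrm_le_dense U (y : U) (X : set U) (c : R) : 0 <= c ->
  (forall e : R, 0 < e -> exists2 x, X x & nrm (y - x) <= e) ->
  (forall x, X x -> Re (dot x y) <= c * nrm x) -> nrm y <= c.
Proof.
move=> c0 dX h.
have [y0|y0] := eqVneq (nrm y) 0; first by rewrite y0.
have ny : 0 < nrm y by rewrite lt0r y0 nrm_ge0.
apply/ler_addgt0Pr => e e0.
pose d := e * nrm y / (c + nrm y).
have d0 : 0 < d by rewrite /d divr_gt0 ?mulr_gt0 ?ltr_wpDl.
have [x Xx yx] := dX _ d0.
have := h x Xx.
have xE : x = y - (y - x) by rewrite opprB addrC subrK.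
have h1 : nrm y ^+ 2 - d * nrm y <= Re (dot x y).
  rewrite [X in dot X _]xE dotBl ReD ReN Re_dotxx lerD2l lerN2.
  apply: le_trans (ler_norm _) _; apply: le_trans (Re_dot_le _ _) _.
  by rewrite ler_wpM2r ?nrm_ge0.
have h2 : nrm x <= nrm y + d.
  by rewrite [X in nrm X]xE; apply: le_trans (nrmD _ _) _; rewrite nrmN lerD2l.
move=> /(le_trans h1) h3.
have {h3} h3 : nrm y ^+ 2 - d * nrm y <= c * (nrm y + d).
  by apply: le_trans h3 _; rewrite ler_wpM2l.
have dE : d * (c + nrm y) = e * nrm y by rewrite /d divfK// gt_eqF ?ltr_wpDl.
have : nrm y * nrm y <= (c + e) * nrm y.
  rewrite (mulrDl c e) -dE; move: h3; rewrite expr2 => h3.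
  rewrite -subr_ge0; move: h3; rewrite -subr_ge0.
  by congr (0 <= _); ring.
by rewrite ler_pM2r.
Qed.

Lemma nrm_le_dot U (y : U) (c : R) : 0 <= c ->
  (forall x, Re (dot x y) <= c * nrm x) -> nrm y <= c.
Proof.
move=> c0 h; apply: (@nrm_le_dense _ y setT) => // e e0.
by exists y => //; rewrite subrr nrm0 ltW.
Qed.

Lemma Re_dot_inj U (y z : U) :
  (forall x, Re (dot x y) = Re (dot x z)) -> y = z.
Proof.
move=> h; apply/eqP; rewrite -subr_eq0; apply/eqP/nrm_eq0.
by apply/eqP; rewrite -sqrf_eq0 -Re_dotxx dotBr ReD ReN h subrr.
Qed.

Lemma dot_inj U (y z : U) : (forall x, dot x y = dot x z) -> y = z.
Proof. by move=> h; apply: Re_dot_inj => x; rewrite h. Qed.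

(** The representing vector of $f$ minimises $\|x\|^2 - 2\,\mathrm{Re}\,f(x)$;
    minimising sequences are Cauchy by the parallelogram law, so that no
    orthogonal projection is needed. *)
Lemma riesz U (f : U -> R[i]) (c : R) : seq_complete U ->
  (forall x y, f (x + y) = f x + f y) ->
  (forall (a : R[i]) x, f (a *: x) = a * f x) ->
  (forall x, `|Re (f x)| <= c * nrm x) ->
  exists y, forall x, f x = dot y x.
Proof.
move=> cU fD fZ fb.
pose J x := nrm x ^+ 2 - 2 * Re (f x).
pose A := [set J x | x in [set: U]].
have J_ge x : - (c ^+ 2) <= J x.
  have := fb x; rewrite ler_norml => /andP[_ h].
  by have := sqr_ge0 (nrm x - c); rewrite /J; nra.
have lbA : has_lbound A by exists (- (c ^+ 2)) => _ [x _ <-].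
have A0 : A !=set0 by exists (J 0); exists 0.
have mJ x : inf A <= J x by apply: ge_inf => //; exists x.
have /choice[x hx] (n : nat) : exists x, J x <= inf A + n.+1%:R^-1.
  have [||_ [x _ <-] /ltW h] := @inf_adherent _ A n.+1%:R^-1; last by exists x.
  - by rewrite invr_gt0 ltr0n.
  - by split.
have paral u v : nrm (u - v) ^+ 2 <= 2 * (J u - inf A) + 2 * (J v - inf A).
  have := mJ (2^-1%:C%C *: (u + v)).
  rewrite /J nrmZ fZ fD ReZ ReD norm_real ?invr_ge0//= exprMn nrm_sqrD.
  rewrite (nrm_sqrD u (- v)) dotNr nrmN ReN.
  move: (inf A) (nrm u) (nrm v) (Re (f u)) (Re (f v)) (Re (dot u v)).
  move=> m a b r s t.
  rewrite -subr_ge0 => h; rewrite -subr_ge0; move: h; set X := (X in 0 <= X).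
  set Y := (Y in _ -> 0 <= Y); have -> : Y = 4 * X by rewrite /X /Y; field.
  by move=> h; rewrite mulr_ge0.
have ninv (e : R) : 0 < e -> exists N, forall n, (N <= n)%N -> n.+1%:R^-1 <= e.
  move=> e0; exists (Num.trunc e^-1) => n Nn.
  rewrite -[leRHS]invrK lef_pV2 ?posrE ?invr_gt0 ?ltr0n//.
  apply: ltW; apply: lt_le_trans (truncnS_gt _) _.
  by rewrite ler_nat ltnS.
have [|l hl] := cU x.
  move=> e e0; have [|N hN] := ninv (e ^+ 2 / 4).
    by rewrite divr_gt0 ?exprn_gt0.
  exists N => p q /hN hp /hN hq; apply: sqr_ler; first exact: ltW.
  apply: le_trans (paral _ _) _.
  move: hp hq (hx p) (hx q); move: (p.+1%:R^-1 : R) (q.+1%:R^-1 : R) => P Q *.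
  by lra.
exists l.
have ReE z : Re (f z) = Re (dot l z).
  have key (t : R) : 0 <= t ^+ 2 * nrm z ^+ 2 + 2 * t * (Re (dot l z) - Re (f z)).
    apply/ler_addgt0Pr => e e0.
    have [|N1 hN1] := ninv (e / 2); first by rewrite divr_gt0.
    pose d := e / 2 / (2 * (`|t| * nrm z) + 1).
    have den : 0 < 2 * (`|t| * nrm z) + 1.
      by rewrite ltr_wpDl// !mulr_ge0 ?nrm_ge0.
    have d0 : 0 < d by rewrite /d !divr_gt0.
    have [N2 hN2] := hl d d0.
    pose n := maxn N1 N2.
    have h1 := hN1 n (leq_maxl _ _); have h2 := hN2 n (leq_maxr _ _).
    have h3 := hx n.
    have := mJ (x n + t%:C%C *: z).
    rewrite /J nrm_sqrD dotZr nrmZ fD fZ ReD !ReZ.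
    have -> : Re `|t%:C%C : R[i]| = `|t|.
      by rewrite normc_def /= expr0n addr0 sqrtr_sqr.
    rewrite exprMn real_normK ?num_real// => h4.
    have h5 : 2 * t * Re (dot (x n) z) <= 2 * t * Re (dot l z) + e / 2.
      rewrite -lerBlDl -mulrBr -ReN -ReD -dotNl -dotDl.
      apply: le_trans (ler_norm _) _; rewrite !normrM (ger0_norm (ler0n _ 2)).
      apply: (@le_trans _ _ (2 * `|t| * (d * nrm z))).
        rewrite ler_wpM2l ?mulr_ge0//; apply: le_trans (Re_dot_le _ _) _.
        by rewrite ler_wpM2r ?nrm_ge0.
      have -> : 2 * `|t| * (d * nrm z) = d * (2 * (`|t| * nrm z)) by ring.
      rewrite /d mulrAC ler_pdivrMr// ler_wpM2l ?lerDl// ltW// divr_gt0//.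
    move: h3 h4 h5 h1; rewrite /J; move: (n.+1%:R^-1 : R) => P.
    move: (nrm (x n) ^+ 2) (Re (f (x n))) (inf A) => a b m.
    move: (t ^+ 2 * nrm z ^+ 2) => s.
    rewrite mulrBr !mulrDr.
    move: (2 * t * Re (dot l z)) => p.
    rewrite !(mulrA 2 t).
    move: (2 * t * Re (dot (x n) z)) (2 * t * Re (f z)) => q r.
    move=> *; lra.
  apply/eqP; rewrite -subr_eq0 -oppr_eq0 opprB.
  move: (Re (dot l z) - Re (f z)) key => s key.
  have [z0|z0] := eqVneq (nrm z ^+ 2) 0.
    have := key (- s); have := sqr_ge0 s; rewrite z0 mulr0 add0r => p q.
    by rewrite -sqrf_eq0 eq_le p andbT; nra.
  have zp : 0 < nrm z ^+ 2 by rewrite lt0r z0 sqr_ge0.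
  have := key (- s / nrm z ^+ 2).
  have -> : (- s / nrm z ^+ 2) ^+ 2 * nrm z ^+ 2 + 2 * (- s / nrm z ^+ 2) * s
    = - (s ^+ 2 / nrm z ^+ 2) by field; move: z0; rewrite sqrf_eq0.
  rewrite oppr_ge0 => h.
  rewrite -sqrf_eq0 eq_le sqr_ge0 andbT.
  by move: h; rewrite ler_pdivrMr// mul0r.
move=> z; apply: complexP; first exact: ReE.
have := ReE ('i%C *: z); rewrite fZ dotZr.
case: (f z) (dot l z) => a b [p q] /=.
by rewrite !mul0r !mul1r !sub0r => /eqP; rewrite eqr_opp => /eqP.
Qed.

Lemma adjP U V (A : U -> V) : seq_complete U -> bounded_linear A ->
  forall x y, dot (A x) y = dot x (adj A y).
Proof.
move=> cU bA; have [c c0 hc] := bounded_linear_bound bA; have [lA _] := bA.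
suff /choice[B hB] (y : V) : exists w, forall x, dot (A x) y = dot x w.
  rewrite /adj; case: xgetP => [C _ //|/(_ B)]; by case.
have [w hw] : exists w, forall x, dot y (A x) = dot w x.
  apply: (@riesz _ _ (nrm y * c)) => //.
  - by move=> u v; rewrite (linear_add lA) dotDr.
  - by move=> a u; rewrite (linear_scale lA) dotZr.
  - move=> x; apply: le_trans (Re_dot_le _ _) _.
    by rewrite -mulrA ler_wpM2l ?nrm_ge0.
by exists w => x; rewrite dotC hw -dotC.
Qed.

Section adjoint.
Variables (U V : innerProductType R) (A : U -> V).
Hypotheses (cU : seq_complete U) (bA : bounded_linear A).

Lemma adj_linear : linear (adj A).
Proof.
move=> a x y; apply: dot_inj => z.
by rewrite -(adjP cU bA) !dotDr !dotZr !(adjP cU bA).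
Qed.

Lemma adj_bound (c : R) : 0 <= c -> bounded_by A c -> bounded_by (adj A) c.
Proof.
move=> c0 hc y; apply: nrm_le_dot => [|x]; first by rewrite mulr_ge0 ?nrm_ge0.
rewrite -(adjP cU bA); apply: le_trans (ler_norm _) _.
apply: le_trans (Re_dot_le _ _) _.
by rewrite mulrAC ler_wpM2r ?nrm_ge0.
Qed.

Lemma adj_bounded : bounded_linear (adj A).
Proof.
have [c c0 hc] := bounded_linear_bound bA.
apply: (@bounded_linearI _ _ _ _ c); first exact: adj_linear.
by apply: adj_bound => //; exact: ltW.
Qed.

End adjoint.

Lemma adj_opdist U V (A B : U -> V) (e : R) : seq_complete U ->
  bounded_linear A -> bounded_linear B -> 0 <= e ->
  opdist_le A B e -> opdist_le (adj A) (adj B) e.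
Proof.
move=> cU bA bB e0 /opdist_leP h; apply/opdist_leP => y.
apply: nrm_le_dot => [|x]; first by rewrite mulr_ge0 ?nrm_ge0.
rewrite dotBr -(adjP cU bA) -(adjP cU bB) -dotBl.
apply: le_trans (ler_norm _) _; apply: le_trans (Re_dot_le _ _) _.
by rewrite mulrAC ler_wpM2r ?nrm_ge0.
Qed.

End InnerProduct.

(** * Operator-norm limits and closed spans *)

Section OperatorLimits.
Context (R : realType).

Definition opcvg (U V : normedModType R[i]) (A_ : nat -> U -> V) (A : U -> V) :
    Prop :=
  forall e : R, 0 < e -> exists N, forall n, (N <= n)%N -> opdist_le (A_ n) A e.

Lemma opdist_le_trans (U V : normedModType R[i]) (A B C : U -> V) (e f : R) :
  opdist_le A B e -> opdist_le B C f -> opdist_le A C (e + f).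
Proof.
move=> /opdist_leP h /opdist_leP k; apply/opdist_leP => x.
by apply: le_trans (nrm_tri _ (B x) _) _; rewrite mulrDl lerD.
Qed.

Lemma opdist_le_sym (U V : normedModType R[i]) (A B : U -> V) (e : R) :
  opdist_le A B e -> opdist_le B A e.
Proof. by move=> /opdist_leP h; apply/opdist_leP => x; rewrite nrmB. Qed.

Lemma opdist_le_mono (U V : normedModType R[i]) (A B : U -> V) (e f : R) :
  e <= f -> opdist_le A B e -> opdist_le A B f.
Proof.
move=> ef /opdist_leP h; apply/opdist_leP => x; apply: le_trans (h x) _.
by rewrite ler_wpM2r ?nrm_ge0.
Qed.

Lemma opdist_bounded (U V : normedModType R[i]) (A B : U -> V) (e c : R) :
  opdist_le A B e -> bounded_by B c -> bounded_by A (e + c).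
Proof.
move=> /opdist_leP h k x; apply: le_trans (nrm_le_dist _ (B x)) _.
by rewrite mulrDl lerD.
Qed.

Lemma opcvg_comp (U V Z : normedModType R[i]) (A_ : nat -> V -> Z) A
    (B_ : nat -> U -> V) B :
  bounded_linear A -> bounded_linear B -> opcvg A_ A -> opcvg B_ B ->
  opcvg (fun n => A_ n \o B_ n) (A \o B).
Proof.
move=> bA bB cA cB e e0; have [lA _] := bA.
have [a a0 ha] := bounded_linear_bound bA.
have [b b0 hb] := bounded_linear_bound bB.
pose d := Num.min 1 (e / (1 + b + a)).
have s0 : 0 < 1 + b + a by rewrite !addr_gt0.
have d0 : 0 < d by rewrite lt_min ltr01 divr_gt0.
have [N1 h1] := cA d d0; have [N2 h2] := cB d d0.
exists (maxn N1 N2) => n; rewrite geq_max => /andP[/h1 k1 /h2 k2].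
apply/opdist_leP => x /=.
apply: le_trans (nrm_tri _ (A (B_ n x)) _) _.
have /opdist_leP/(_ (B_ n x)) q1 := k1.
have q2 := opdist_bounded k2 hb x.
have /opdist_leP/(_ x) q3 := k2.
have q4 := ha (B_ n x - B x); rewrite (linear_sub lA) in q4.
have d1 : d <= 1 by rewrite ge_min lexx.
have de : d * (1 + b + a) <= e.
  by rewrite -ler_pdivlMr// ge_min lexx orbT.
have nx := nrm_ge0 x.
apply: (@le_trans _ _ (d * ((1 + b) * nrm x) + a * (d * nrm x))).
  apply: lerD.
    apply: le_trans q1 _; rewrite ler_wpM2l ?(ltW d0)//.
    by apply: le_trans q2 _; rewrite ler_wpM2r// lerD2r.
  by apply: le_trans q4 _; rewrite ler_wpM2l ?(ltW a0).
have -> : d * ((1 + b) * nrm x) + a * (d * nrm x) = d * (1 + b + a) * nrm x.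
  by ring.
by rewrite ler_wpM2r.
Qed.

Lemma bounded_linear_comp (U V Z : normedModType R[i]) (A : V -> Z) (B : U -> V) :
  bounded_linear A -> bounded_linear B -> bounded_linear (A \o B).
Proof.
move=> [lA cA] [lB cB]; split; first by move=> a x y /=; rewrite lB lA.
by move=> x; apply: continuous_comp; [exact: cB|exact: cA].
Qed.

Lemma opcvg_cst (U V : normedModType R[i]) (A : U -> V) : opcvg (fun=> A) A.
Proof.
move=> e e0; exists 0%N => n _; apply/opdist_leP => x.
by rewrite subrr nrm0 mulr_ge0 ?nrm_ge0// ltW.
Qed.

Lemma opcvg_adj (U V : innerProductType R) (A_ : nat -> U -> V) A :
  seq_complete U -> (forall n, bounded_linear (A_ n)) -> bounded_linear A ->
  opcvg A_ A -> opcvg (fun n => adj (A_ n)) (adj A).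
Proof.
move=> cU bA_ bA cA e e0; have [N hN] := cA e e0; exists N => n /hN h.
by apply: adj_opdist => //; exact: ltW.
Qed.

Lemma opcvg_pointwise (U V : normedModType R[i]) (A_ : nat -> U -> V) A x :
  opcvg A_ A -> forall e : R, 0 < e ->
  exists N, forall n, (N <= n)%N -> nrm (A_ n x - A x) <= e.
Proof.
move=> cA e e0; have n1 : 0 < nrm x + 1 by rewrite ltr_wpDl ?nrm_ge0.
have [|N hN] := cA (e / (nrm x + 1)); first by rewrite divr_gt0.
exists N => n /hN /opdist_leP/(_ x) h; apply: le_trans h _.
by rewrite mulrAC ler_pdivrMr// ler_wpM2l ?(ltW e0)// lerDl.
Qed.

Definition opcauchy (U V : normedModType R[i]) (A_ : nat -> U -> V) : Prop :=
  forall e : R, 0 < e -> exists N, forall p q, (N <= p)%N -> (N <= q)%N ->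
    opdist_le (A_ p) (A_ q) e.

Lemma seq_limit_eq (V : normedModType R[i]) (x : nat -> V) (l m : V) :
  (forall e : R, 0 < e -> exists N, forall n, (N <= n)%N -> nrm (x n - l) <= e) ->
  (forall e : R, 0 < e -> exists N, forall n, (N <= n)%N -> nrm (x n - m) <= e) ->
  l = m.
Proof.
move=> hl hm; apply/eqP; rewrite -subr_eq0; apply/eqP/nrm_le0P => e e0.
have e2 : 0 < e / 2 by rewrite divr_gt0.
have [N1 h1] := hl _ e2; have [N2 h2] := hm _ e2.
apply: le_trans (nrm_tri _ (x (maxn N1 N2)) _) _.
rewrite (splitr e) lerD//; last exact/h2/leq_maxr.
by rewrite nrmB; exact/h1/leq_maxl.
Qed.

Lemma opcauchy_opcvg (U V : normedModType R[i]) (A_ : nat -> U -> V) :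
  seq_complete V -> (forall n, bounded_linear (A_ n)) -> opcauchy A_ ->
  exists2 A, bounded_linear A & opcvg A_ A.
Proof.
move=> cV bA cA.
have /choice[A hA] (x : U) : exists l, forall e : R, 0 < e ->
    exists N, forall n, (N <= n)%N -> nrm (A_ n x - l) <= e.
  apply: cV => e e0; have n1 : 0 < nrm x + 1 by rewrite ltr_wpDl ?nrm_ge0.
  have [|N hN] := cA (e / (nrm x + 1)); first by rewrite divr_gt0.
  exists N => p q Np Nq; have /opdist_leP/(_ x) h := hN _ _ Np Nq.
  apply: le_trans h _.
  by rewrite mulrAC ler_pdivrMr// ler_wpM2l ?(ltW e0)// lerDl.
have cvgA : opcvg A_ A.
  move=> e e0; have [N hN] := cA e e0; exists N => n Nn.
  apply/opdist_leP => x; apply/ler_addgt0Pr => d d0.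
  have [M hM] := hA x d d0.
  apply: le_trans (nrm_tri _ (A_ (maxn N M) x) _) _; apply: lerD.
    have /opdist_leP/(_ x) := hN n (maxn N M) Nn (leq_maxl _ _); exact.
  exact/hM/leq_maxr.
have lA : linear A.
  move=> a x y; apply: (seq_limit_eq (hA (a *: x + y))) => e e0.
  have a1 : 0 < Re `|a| + 1.
    by rewrite ltr_wpDl//; have := nrm_ge0 (a : R[i]^o).
  have [|N1 h1] := hA x (e / 2 / (Re `|a| + 1)); first by rewrite !divr_gt0.
  have [|N2 h2] := hA y (e / 2); first by rewrite divr_gt0.
  exists (maxn N1 N2) => n; rewrite geq_max => /andP[/h1 k1 /h2 k2].
  have [-> _] := bA n.
  rewrite opprD addrACA -scalerBr; apply: le_trans (nrmD _ _) _.
  rewrite [leRHS](splitr e) lerD// nrmZ.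
  apply: (@le_trans _ _ ((Re `|a| + 1) * nrm (A_ n x - A x))).
    by rewrite ler_wpM2r ?nrm_ge0// lerDl.
  by rewrite mulrC -ler_pdivlMr.
exists A => //.
have [N hN] := cvgA 1 ltr01.
have [c c0 hc] := bounded_linear_bound (bA N).
apply: (@bounded_linearI _ _ _ _ (1 + c)) => //.
by apply: opdist_bounded hc; apply: opdist_le_sym; exact: hN.
Qed.

Lemma bounded_linear_eq_dense (U V : normedModType R[i]) (A B : U -> V)
    (X : set U) : bounded_linear A -> bounded_linear B ->
  (forall y (e : R), 0 < e -> exists2 x, X x & nrm (y - x) <= e) ->
  (forall x, X x -> A x = B x) -> A = B.
Proof.
move=> bA bB dX AB; have [a a0 ha] := bounded_linear_bound bA.
have [b b0 hb] := bounded_linear_bound bB.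
have [lA _] := bA; have [lB _] := bB.
apply/funext => y; apply/eqP; rewrite -subr_eq0; apply/eqP/nrm_le0P => e e0.
have [|x /AB Xx yx] := dX y (e / (a + b)); first by rewrite divr_gt0// addr_gt0.
have -> : A y - B y = A (y - x) - B (y - x).
  by rewrite (linear_sub lA) (linear_sub lB) Xx opprB addrA subrK.
apply: le_trans (nrmD _ _) _; rewrite nrmN.
apply: le_trans (lerD (ha _) (hb _)) _.
by rewrite -mulrDl mulrC -ler_pdivlMr// addr_gt0.
Qed.

Section spans.
Variables U V : normedModType R[i].
Implicit Types Y Z : set (U -> V).

Lemma lspan_sub Y : Y `<=` lspan Y.
Proof.
move=> A YA; exists 1%N, (fun=> 1), (fun=> A); split=> //.
by rewrite big_ord1 scale1r.
Qed.

Lemma lspan0 Y : lspan Y 0.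
Proof.
exists 0%N, (fun=> 0), (fun=> 0); split; last by rewrite big_ord0.
by case.
Qed.

Lemma lspanD Y A B : lspan Y A -> lspan Y B -> lspan Y (A + B).
Proof.
move=> [n [a [y [hy ->]]]] [m [b [z [hz ->]]]].
exists (n + m)%N, (fun i => match fintype.split i with inl j => a j | inr j => b j end),
  (fun i => match fintype.split i with inl j => y j | inr j => z j end).
split; first by move=> i; case: (fintype.split i).
rewrite big_split_ord/=; congr (_ + _); apply: eq_bigr => i _.
  by rewrite -[lshift m i]/(unsplit (inl i)) unsplitK.
by rewrite -[rshift n i]/(unsplit (inr i)) unsplitK.
Qed.

Lemma lspanZ Y (c : R[i]) A : lspan Y A -> lspan Y (c *: A).
Proof.
move=> [n [a [y [hy ->]]]]; exists n, (fun i => c * a i), y; split=> //.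
by rewrite scaler_sumr; apply: eq_bigr => i _; rewrite scalerA.
Qed.

(** The coefficients of a finite combination are fixed before its terms are
    approximated, so that the errors can be chosen small relative to them. *)
Lemma clspan_subset Y Z :
  (forall A, Y A -> forall e : R, 0 < e -> exists2 S, lspan Z S & opdist_le A S e) ->
  clspan Y `<=` clspan Z.
Proof.
move=> YZ A [bA hA]; split=> // e e0.
have e2 : 0 < e / 2 by rewrite divr_gt0.
have [S [n [c [y [Yy ->]]]] AS] := hA _ e2.
suff [T ZT ST] : exists2 T, lspan Z T & opdist_le (\sum_(i < n) c i *: y i) T (e / 2).
  by exists T => //; rewrite (splitr e); exact: opdist_le_trans AS ST.
elim: n c y Yy (e / 2) e2 {AS} => [|n IH] c y Yy {}e {}e0.
  exists 0; first exact: lspan0.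
  apply/opdist_leP => x; rewrite big_ord0 subrr nrm0 mulr_ge0 ?nrm_ge0//.
  exact: ltW.
have e2 : 0 < e / 2 by rewrite divr_gt0.
rewrite big_ord_recr /=.
have [T1 Z1 h1] := IH (fun i => c (widen_ord (leqnSn n) i))
  (fun i => y (widen_ord (leqnSn n) i)) (fun i => Yy _) _ e2.
set r := c ord_max.
have r1 : 0 < Re `|r| + 1.
  by rewrite ltr_wpDl//; have := nrm_ge0 (r : R[i]^o).
have [|T2 Z2 h2] := YZ _ (Yy ord_max) (e / 2 / (Re `|r| + 1)).
  by rewrite !divr_gt0.
exists (T1 + r *: T2); first by apply: lspanD => //; exact: lspanZ.
apply/opdist_leP => x.
rewrite -[X in nrm (X - _)]/((\sum_(i < n) _) x + r *: y ord_max x).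
rewrite -[X in nrm (_ - X)]/(T1 x + r *: T2 x).
rewrite opprD addrACA -scalerBr; apply: le_trans (nrmD _ _) _.
rewrite [e in leRHS](splitr e) mulrDl; apply: lerD.
  by have /opdist_leP := h1; apply.
rewrite nrmZ; apply: (@le_trans _ _ ((Re `|r| + 1) * nrm (y ord_max x - T2 x))).
  by rewrite ler_wpM2r ?nrm_ge0// lerDl.
have /opdist_leP/(_ x) h := h2.
rewrite mulrC -ler_pdivlMr// (le_trans h)//.
by rewrite le_eqVlt; apply/orP; left; apply/eqP; field; rewrite gt_eqF.
Qed.

Lemma opcvg_approx (A_ : nat -> U -> V) A Z : opcvg A_ A ->
  (forall n (e : R), 0 < e -> exists2 S, lspan Z S & opdist_le (A_ n) S e) ->
  forall e : R, 0 < e -> exists2 S, lspan Z S & opdist_le A S e.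
Proof.
move=> cA hZ e e0; have e2 : 0 < e / 2 by rewrite divr_gt0.
have [N hN] := cA _ e2; have [S ZS AS] := hZ N _ e2; exists S => //.
by rewrite (splitr e); apply: opdist_le_trans AS; exact/opdist_le_sym/hN.
Qed.

End spans.
End OperatorLimits.

(** * Creation operators of relative tensor products *)

Section RelativeTensor.
Context (R : realType) (h H K : innerProductType R).
Variables (alpha : set (h -> H)) (beta : set (h -> K)).
Variable X : rtensor alpha beta.
Hypothesis hc : seq_complete h.
Hypothesis alphaB : forall xi, alpha xi -> bounded_linear xi.
Hypothesis betaB : forall eta, beta eta -> bounded_linear eta.

Local Notation rt := (@rt_elem _ _ _ _ _ _ X).

Lemma rt_dotE xi zeta eta xi' zeta' eta' :
  alpha xi -> beta eta -> alpha xi' -> beta eta' ->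
  dot (rt xi zeta eta) (rt xi' zeta' eta') =
  dot (xi zeta) (xi' (adj eta (eta' zeta'))).
Proof.
by move=> a b a' b'; rewrite rt_dot// -(adjP hc)//; exact: alphaB.
Qed.

(** By the Gram formula the squared distance is $\langle\xi\zeta|\xi w\rangle$ with
    $w=(\eta-\eta')^*(\eta-\eta')\zeta$, which is of second order in
    $\eta-\eta'$. *)
Lemma rt_elem_dist2 xi eta eta' zeta (c e : R) :
  alpha xi -> beta eta -> beta eta' -> 0 <= c -> 0 <= e ->
  bounded_by xi c -> opdist_le eta eta' e ->
  nrm (rt xi zeta eta - rt xi zeta eta') <= c * e * nrm zeta.
Proof.
move=> a b b' c0 e0 bxi ee'.
apply: sqr_ler; first by rewrite !mulr_ge0 ?nrm_ge0.
pose u := eta zeta - eta' zeta.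
pose w := adj eta u - adj eta' u.
have [lxi _] := alphaB a.
have leta := adj_linear hc (betaB b); have leta' := adj_linear hc (betaB b').
have -> : nrm (rt xi zeta eta - rt xi zeta eta') ^+ 2 = Re (dot (xi zeta) (xi w)).
  rewrite -Re_dotxx dotBr !dotBl !rt_dotE//.
  rewrite /w /u !(linear_sub leta) !(linear_sub leta') !(linear_sub lxi) !dotBr.
  by congr (Re _); ring.
have hu : nrm u <= e * nrm zeta by have /opdist_leP := ee'; apply.
have hw : nrm w <= e * nrm u.
  by have /opdist_leP := adj_opdist hc (betaB b) (betaB b') e0 ee'; apply.
apply: le_trans (ler_norm _) _; apply: le_trans (Re_dot_le _ _) _.
have h1 := bxi zeta; have h2 := bxi w.
have -> : (c * e * nrm zeta) ^+ 2 = (c * nrm zeta) * (c * (e * (e * nrm zeta))).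
  by ring.
rewrite ler_pM ?nrm_ge0//; apply: le_trans h2 _; rewrite ler_wpM2l//.
by apply: le_trans hw _; rewrite ler_wpM2l.
Qed.

Lemma rt_elem_dist1 xi xi' eta zeta (c e : R) :
  alpha xi -> alpha xi' -> beta eta -> 0 <= c -> 0 <= e ->
  bounded_by eta c -> opdist_le xi xi' e ->
  nrm (rt xi zeta eta - rt xi' zeta eta) <= c * e * nrm zeta.
Proof.
move=> a a' b c0 e0 beta_ ee'.
apply: sqr_ler; first by rewrite !mulr_ge0 ?nrm_ge0.
pose y := adj eta (eta zeta).
have -> : nrm (rt xi zeta eta - rt xi' zeta eta) ^+ 2 =
    Re (dot (xi zeta - xi' zeta) (xi y - xi' y)).
  by rewrite -Re_dotxx !dotBl !dotBr !rt_dotE.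
apply: le_trans (ler_norm _) _; apply: le_trans (Re_dot_le _ _) _.
have /opdist_leP k := ee'.
have hy : nrm y <= c * (c * nrm zeta).
  apply: le_trans (adj_bound hc (betaB b) c0 beta_ _) _.
  by rewrite ler_wpM2l.
have -> : (c * e * nrm zeta) ^+ 2 = (e * nrm zeta) * (e * (c * (c * nrm zeta))).
  by ring.
rewrite ler_pM ?nrm_ge0//; apply: le_trans (k y) _.
by rewrite ler_wpM2l.
Qed.

(** The defining property of $|\eta\rangle_2$; it may fail for the chosen operator
    [ket2 X eta] when no operator satisfies it. *)
Definition is_ket2 eta (A : H -> X) : Prop := bounded_linear A /\
  forall xi zeta, alpha xi -> A (xi zeta) = rt xi zeta eta.

Definition is_ket1 xi (A : K -> X) : Prop := bounded_linear A /\
  forall eta zeta, beta eta -> A (eta zeta) = rt xi zeta eta.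

Lemma ket2P eta A : is_ket2 eta A -> is_ket2 eta (ket2 X eta).
Proof. by rewrite /ket2; case: xgetP => [B _ //|/(_ A) + /[dup] _ /[dup]]. Qed.

Lemma ket1P xi A : is_ket1 xi A -> is_ket1 xi (ket1 X xi).
Proof. by rewrite /ket1; case: xgetP => [B _ //|/(_ A) + /[dup] _ /[dup]]. Qed.

Definition acts_densely (U V : innerProductType R) (gamma : set (U -> V)) : Prop :=
  forall y (e : R), 0 < e ->
  exists2 x, [set x | exists xi zeta, gamma xi /\ x = xi zeta] x & nrm (y - x) <= e.

Lemma ket2_unique eta A : acts_densely alpha -> is_ket2 eta A -> ket2 X eta = A.
Proof.
move=> dA hA; have [bB hB] := ket2P hA; have [bA {}hA] := hA.
apply: (bounded_linear_eq_dense bB bA dA) => _ [xi [zeta [axi ->]]].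
by rewrite hB// hA.
Qed.

Lemma ket1_unique xi A : acts_densely beta -> is_ket1 xi A -> ket1 X xi = A.
Proof.
move=> dA hA; have [bB hB] := ket1P hA; have [bA {}hA] := hA.
apply: (bounded_linear_eq_dense bB bA dA) => _ [eta [zeta [beta_ ->]]].
by rewrite hB// hA.
Qed.

(** The limit operator exists as the target is complete. It has the prescribed
    values because these depend continuously on $\eta$, and by density of
    $\alpha\mathfrak H$ it is the only such operator. *)
Lemma ket2_opcvg (eta_ : nat -> h -> K) eta : acts_densely alpha ->
  (forall n, beta (eta_ n)) -> beta eta -> opcvg eta_ eta ->
  (forall n, is_ket2 (eta_ n) (ket2 X (eta_ n))) ->
  opcauchy (fun n => ket2 X (eta_ n)) ->
  is_ket2 eta (ket2 X eta) /\ opcvg (fun n => ket2 X (eta_ n)) (ket2 X eta).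
Proof.
move=> dA be_ be ce ke_ ck.
have [|A bA cA] := opcauchy_opcvg (@hilbert_seq_complete _ X) _ ck.
  by move=> n; case: (ke_ n).
suff kA : is_ket2 eta A by split; [exact: ket2P kA|rewrite (ket2_unique dA kA)].
split=> // xi zeta axi.
apply: (seq_limit_eq (opcvg_pointwise (xi zeta) cA)) => e e0.
have [c c0 hc'] := bounded_linear_bound (alphaB axi).
have d0 : 0 < c * (nrm zeta + 1) by rewrite mulr_gt0// ltr_wpDl ?nrm_ge0.
have [|N hN] := ce (e / (c * (nrm zeta + 1))); first by rewrite divr_gt0.
exists N => n /hN h1; have [_ ->] := ke_ n; last by [].
apply: le_trans (rt_elem_dist2 zeta axi (be_ n) be (ltW c0) _ hc' h1) _.
  by rewrite ltW// divr_gt0.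
rewrite mulrA mulrAC (mulrAC c) ler_pdivrMr// mulrC ler_wpM2l ?(ltW e0)//.
by rewrite ler_wpM2l ?(ltW c0)// lerDl.
Qed.

Lemma ket1_opcvg (xi_ : nat -> h -> H) xi : acts_densely beta ->
  (forall n, alpha (xi_ n)) -> alpha xi -> opcvg xi_ xi ->
  (forall n, is_ket1 (xi_ n) (ket1 X (xi_ n))) ->
  opcauchy (fun n => ket1 X (xi_ n)) ->
  is_ket1 xi (ket1 X xi) /\ opcvg (fun n => ket1 X (xi_ n)) (ket1 X xi).
Proof.
move=> dA be_ be ce ke_ ck.
have [|A bA cA] := opcauchy_opcvg (@hilbert_seq_complete _ X) _ ck.
  by move=> n; case: (ke_ n).
suff kA : is_ket1 xi A by split; [exact: ket1P kA|rewrite (ket1_unique dA kA)].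
split=> // eta zeta beta_.
apply: (seq_limit_eq (opcvg_pointwise (eta zeta) cA)) => e e0.
have [c c0 hc'] := bounded_linear_bound (betaB beta_).
have d0 : 0 < c * (nrm zeta + 1) by rewrite mulr_gt0// ltr_wpDl ?nrm_ge0.
have [|N hN] := ce (e / (c * (nrm zeta + 1))); first by rewrite divr_gt0.
exists N => n /hN h1; have [_ ->] := ke_ n; last by [].
apply: le_trans (rt_elem_dist1 zeta (be_ n) be beta_ (ltW c0) _ hc' h1) _.
  by rewrite ltW// divr_gt0.
rewrite mulrA mulrAC (mulrAC c) ler_pdivrMr// mulrC ler_wpM2l ?(ltW e0)//.
by rewrite ler_wpM2l ?(ltW c0)// lerDl.
Qed.

(** Creation by the zero operator is zero, so that it never falls back on a
    default value. *)
Lemma is_ket2_zero : beta (cst 0) -> is_ket2 (cst 0) (cst 0 : H -> X).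
Proof.
move=> b0; split.
  apply: (@bounded_linearI _ _ _ _ 0) => [a x y|x]; first by rewrite scaler0 addr0.
  by rewrite nrm0 mul0r.
move=> xi zeta axi; apply/esym/nrm_eq0/eqP; rewrite -sqrf_eq0 -Re_dotxx.
have [lxi _] := alphaB axi.
rewrite rt_dotE// (linear_zero (adj_linear hc (betaB b0))) (linear_zero lxi).
by rewrite dot0r.
Qed.

End RelativeTensor.

(** * The spaces $L^2$ *)

Section L2Facts.
Context d (T : measurableType d) (R : realType) (m : {measure set T -> \bar R}).
Implicit Types (F G : L2 m) (f g : T -> R[i]).

Definition sqint f : \bar R := (\int[m]_x (sqmod (f x))%:E)%E.

Lemma measurable_sqmod f : cmeasurable f ->
  measurable_fun setT (fun x => (sqmod (f x))%:E).
Proof. by move=> mf; apply/measurable_EFinP; exact: cmeasurable_sqmod. Qed.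

Lemma sqmod_ge0E (z : R[i]) : (0 <= (sqmod z)%:E)%E.
Proof. by rewrite lee_fin sqmod_ge0. Qed.

Lemma L2_nrm_sqr F : ((nrm F ^+ 2)%:E = sqint F)%E.
Proof.
have sF := @L2_square_integrable _ _ _ _ F.
have : dot F F = (\int[m]_x sqmod (F x))%:C%C by exact: cintegral_sqmod.
rewrite dotxx => -[->]; rewrite /Rintegral fineK//.
exact: (integrable_fin_num _ (integrable_sqmod sF)).
Qed.

Lemma sqint_eq_ae f g : cmeasurable f -> cmeasurable g ->
  {ae m, forall x, f x = g x} -> sqint f = sqint g.
Proof.
move=> mf mg fg; apply: ge0_ae_eq_integral => //.
- exact: measurable_sqmod.
- exact: measurable_sqmod.
- by move=> x _; exact: sqmod_ge0E.
- by move=> x _; exact: sqmod_ge0E.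
- by apply: filterS fg => x -> _.
Qed.

Lemma toL2_nrm_sqr f : square_integrable m f ->
  ((nrm (toL2 m f) ^+ 2)%:E = sqint f)%E.
Proof.
move=> sf; rewrite L2_nrm_sqr; apply: sqint_eq_ae; last exact: toL2E.
- by case: (@L2_square_integrable _ _ _ _ (toL2 m f)).
- by case: sf.
Qed.

Lemma toL2_nrm_le f (c : R) : cmeasurable f -> 0 <= c ->
  (sqint f <= (c ^+ 2)%:E)%E -> nrm (toL2 m f) <= c.
Proof.
move=> mf c0 h; apply: sqr_ler => //; rewrite -lee_fin toL2_nrm_sqr//.
by split=> //; apply: le_lt_trans h _; rewrite ltry.
Qed.

Lemma toL2_ext f g : square_integrable m f -> square_integrable m g ->
  {ae m, forall x, f x = g x} -> toL2 m f = toL2 m g.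
Proof.
move=> sf sg fg; apply: L2_ext.
by apply: filterS3 (toL2E sf) (toL2E sg) fg => x -> ->.
Qed.

Lemma toL2_repr F : toL2 m F = F.
Proof. by apply: L2_ext; exact/toL2E/L2_square_integrable. Qed.

Lemma toL2_lin (a : R[i]) f g : square_integrable m f -> square_integrable m g ->
  toL2 m (fun x => a * f x + g x) = a *: toL2 m f + toL2 m g.
Proof.
move=> sf sg; apply: L2_ext.
have s1 : square_integrable m (fun x => a * f x + g x).
  exact: (square_integrable_lin a sf sg).
have h1 := toL2E s1; have h2 := toL2E sf; have h3 := toL2E sg.
have h4 := L2_addE (a *: toL2 m f) (toL2 m g).
have h5 := L2_scaleE a (toL2 m f).
apply: filterS2 (filterI h1 h2) (filterI h3 (filterI h4 h5)) => x [-> k2].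
by move=> [k3 [-> ->]]; rewrite k2 k3.
Qed.

Lemma square_integrableB f g : square_integrable m f -> square_integrable m g ->
  square_integrable m (fun x => f x - g x).
Proof.
move=> sf sg; have := square_integrable_lin (-1) sg sf.
congr (square_integrable m _); apply/funext => x.
by rewrite -[LHS]/(-1 * g x + f x) mulN1r addrC.
Qed.

Lemma toL2B f g : square_integrable m f -> square_integrable m g ->
  toL2 m (fun x => f x - g x) = toL2 m f - toL2 m g.
Proof.
move=> sf sg; rewrite addrC -scaleN1r -toL2_lin//; congr (toL2 m _).
by apply/funext => x; rewrite mulN1r addrC.
Qed.

Lemma dot_toL2 f g : square_integrable m f -> square_integrable m g ->
  dot (toL2 m f) (toL2 m g) = cintegral m setT (fun x => (f x)^*%C * g x).
Proof.
move=> sf sg; rewrite [LHS]/(L2_dot _ _) /L2_dot; apply: eq_ae_cintegral.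
- by apply: cintegrable_conjM; exact: L2_square_integrable.
- exact: cintegrable_conjM.
- by apply: filterS2 (toL2E sf) (toL2E sg) => x -> ->.
Qed.

Lemma toL2_dist_sqr f g : square_integrable m f -> square_integrable m g ->
  ((nrm (toL2 m f - toL2 m g) ^+ 2)%:E = sqint (fun x => f x - g x)%R)%E.
Proof.
by move=> sf sg; rewrite -toL2B// toL2_nrm_sqr//; exact: square_integrableB.
Qed.

Lemma measurable_limn_einf (g : nat -> T -> \bar R) :
  (forall n, measurable_fun setT (g n)) ->
  measurable_fun setT (fun t => limn_einf (g^~ t)).
Proof.
move=> mg.
have -> : (fun t => limn_einf (g^~ t)) =
    (fun t => - limn_esup (fun n => - g n t))%E.
  by apply/funext => t; rewrite -[LHS]oppeK -limn_esupN.
have mN (h : T -> \bar R) : measurable_fun setT h ->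
    measurable_fun setT (fun t => - h t)%E.
  by move=> mh; apply: (@measurableT_comp _ _ _ _ _ _ oppe) => //; exact: oppe_measurable.
have h n : measurable_fun setT (fun t => - g n t)%E by exact: mN.
exact: (mN _ (measurable_fun_limn_esup h)).
Qed.

Lemma cvg_of_summable_steps (u : nat -> R) (c : R) : 0 <= c ->
  (forall k, `|u k.+1 - u k| <= c * 2^-1 ^+ k) -> cvgn u.
Proof.
move=> c0 hu.
pose v k := u k.+1 - u k.
have cv : cvgn (series v).
  apply: normed_cvg.
  apply: (@series_le_cvg _ _ (geometric c 2^-1)) => //.
  - by move=> n; exact: normr_ge0.
  - by move=> n; rewrite /geometric /= mulr_ge0// exprn_ge0.
  - by apply: is_cvg_geometric_series; rewrite ger0_norm ?invf_lt1// ?ltr1n.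
have -> : u = (fun n => u 0%N + series v n).
  apply/funext => n; rewrite /series /=.
  by rewrite telescope_sumr// addrC subrK.
by apply: is_cvgD => //; exact: is_cvg_cst.
Qed.

(** Passing to a subsequence with $\int|f_{k+1}-f_k|^2\le16^{-k}$, the weighted
    sum $\sum_k4^k|f_{k+1}-f_k|^2$ is integrable, hence finite almost
    everywhere, which makes the steps at almost every point geometrically
    small; Fatou's lemma then identifies the pointwise limit as the limit in
    norm. *)
Lemma L2_seq_complete : seq_complete (L2 m).
Proof.
move=> x cx.
have h16 (k : nat) : (0 : R) < 4^-1 ^+ k by rewrite exprn_gt0// invr_gt0.
have /choice[N hN] (k : nat) : exists N, forall p q, (N <= p)%N -> (N <= q)%N ->
    nrm (x p - x q) <= 4^-1 ^+ k by apply: cx.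
pose n_ k := (\sum_(i < k.+1) N i)%N.
have Nn k : (N k <= n_ k)%N by rewrite /n_ big_ord_recr/= leq_addl.
have nS k : (n_ k <= n_ k.+1)%N.
  by rewrite /n_ [leqRHS]big_ord_recr/= leq_addr.
have nmono k l : (k <= l)%N -> (n_ k <= n_ l)%N.
  by move=> kl; apply: (homo_leq (leqnn) (fun _ _ _ => @leq_trans _ _ _)).
pose f k : T -> R[i] := L2_repr (x (n_ k)).
have sf k : square_integrable m (f k) by exact: L2_square_integrable.
have mfR k : measurable_fun setT (Re \o f k) by case: (sf k) => -[].
have mfI k : measurable_fun setT (Im \o f k) by case: (sf k) => -[].
have sd k l : square_integrable m (fun t => f k t - f l t).
  exact: square_integrableB.
have sqd k l : sqint (fun t => f k t - f l t)%R = ((nrm (x (n_ k) - x (n_ l))) ^+ 2)%:E.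
  by rewrite -toL2_dist_sqr// !toL2_repr.
have step k l : (k <= l)%N ->
    (sqint (fun t => f l t - f k t)%R <= (16^-1 ^+ k)%:E)%E.
  move=> kl; rewrite sqd lee_fin.
  apply: (@le_trans _ _ ((4^-1 ^+ k) ^+ 2)).
    rewrite ler_pXn2r ?nnegrE ?nrm_ge0 ?(ltW (h16 k))//.
    by rewrite hN// (leq_trans (Nn k))// nmono.
  rewrite -exprM mulnC exprM le_eqVlt; apply/orP; left; apply/eqP.
  by congr (_ ^+ _); field.
pose w k t := (4 ^+ k * sqmod (f k.+1 t - f k t))%:E.
have w0 k t : (0 <= w k t)%E by rewrite lee_fin mulr_ge0 ?exprn_ge0 ?sqmod_ge0.
have mw k : measurable_fun setT (w k).
  apply/measurable_EFinP; apply: measurable_funM => //.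
  by apply: cmeasurable_sqmod; case: (sd k.+1 k).
pose S t := (\sum_(0 <= k <oo) w k t)%E.
have S0 t : (0 <= S t)%E by apply: nneseries_ge0 => k _ _.
have mS : measurable_fun setT S.
  have h := @ge0_emeasurable_sum _ _ _ setT w xpredT (fun k t _ _ => w0 k t)
    (fun k _ => mw k).
  by move: h; apply: eq_measurable_fun.
have intS : (\int[m]_t S t < +oo)%E.
  rewrite /S integral_nneseries//.
  have wk k : (\int[m]_t w k t <= (geometric 1 4^-1 k)%:E)%E.
    rewrite /w; under eq_integral do rewrite EFinM.
    rewrite ge0_integralZl_EFin ?exprn_ge0//; last 2 first.
    - by move=> t _; exact: sqmod_ge0E.
    - by apply: measurable_sqmod; case: (sd k.+1 k).
    apply: (@le_trans _ _ ((4 ^+ k)%:E * (16^-1 ^+ k)%:E)%E).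
      by apply: lee_wpmul2l; [rewrite lee_fin exprn_ge0|exact: step].
    rewrite -EFinM lee_fin -exprMn /geometric /= mul1r le_eqVlt; apply/orP; left.
    by apply/eqP; congr (_ ^+ _); field.
  apply: (@le_lt_trans _ _ (\sum_(0 <= k <oo) (geometric 1 4^-1 k)%:E)%E).
    by apply: lee_nneseries => k _ => [_|]; [apply: integral_ge0 => t _|].
  have cg : series (geometric 1 4^-1) @ \oo --> (1 * (1 - 4^-1)^-1 : R).
    by apply: cvg_geometric_series; rewrite ger0_norm ?invf_lt1// ?ltr1n.
  have /cvg_lim -> // : (fun n => \sum_(0 <= k < n) (geometric 1 4^-1 k)%:E)%E @ \oo
      --> (1 * (1 - 4^-1)^-1 : R)%:E.
    under eq_fun do rewrite sumEFin.
    by apply/cvg_EFin; [exact: nearW|exact: cg].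
  by rewrite ltry.
have Sfin : {ae m, forall t, S t \is a fin_num}.
  have : m.-integrable setT S.
    apply/integrableP; split=> //.
    by under eq_integral do rewrite gee0_abs//.
  by move=> /(integrable_ae measurableT); apply: filterS => t; exact.
have stepb t : S t \is a fin_num -> exists2 c : R, 0 <= c &
    forall k, sqmod (f k.+1 t - f k t) <= (c * 2^-1 ^+ k) ^+ 2.
  move=> St; exists (Num.sqrt (fine (S t))); first exact: sqrtr_ge0.
  move=> k; rewrite exprMn sqr_sqrtr ?fine_ge0// -exprM mulnC exprM.
  have : (w k t <= S t)%E.
    apply: le_trans (@nneseries_lim_ge _ (fun k => w k t) xpredT 0%N k.+1
      (fun n _ _ => w0 n t)).
    rewrite big_nat_recr//=; by apply: leeDr; apply: sume_ge0 => i _.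
  rewrite -[S t]fineK// /w lee_fin => h.
  have -> : (2^-1 ^+ 2 : R) = 4^-1 by field.
  by rewrite exprVn ler_pdivlMr ?exprn_gt0// mulrC.
pose F t : R[i] := Complex (fine (limn_esup (fun k => (Re (f k t))%:E)))
                    (fine (limn_esup (fun k => (Im (f k t))%:E))).
have mF : cmeasurable F.
  have mE (u : nat -> T -> R) : (forall k, measurable_fun setT (u k)) ->
      measurable_fun setT (fun t => fine (limn_esup (fun k => (u k t)%:E))).
    move=> mu; have h : measurable_fun setT (fun t => limn_esup (fun k => (u k t)%:E)).
      apply: (@measurable_fun_limn_esup _ _ _ _ (fun k t => (u k t)%:E)) => k.
      exact/measurable_EFinP.
    exact: (measurableT_comp (fine_measurable measurableT) h).
  by split; [exact: (mE (fun k t => Re (f k t)))|exact: (mE (fun k t => Im (f k t)))].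
have cvF t : S t \is a fin_num -> (fun k => Re (f k t)) @ \oo --> Re (F t) /\
    (fun k => Im (f k t)) @ \oo --> Im (F t).
  move=> /stepb[c c0 hc].
  have key (u : nat -> R) : (forall k, (u k.+1 - u k) ^+ 2 <= (c * 2^-1 ^+ k) ^+ 2) ->
      u @ \oo --> fine (limn_esup (fun k => (u k)%:E)).
    move=> hu; have cu : cvgn u.
      apply: (@cvg_of_summable_steps _ c) => // k; apply: sqr_ler.
        by rewrite mulr_ge0// exprn_ge0.
      by rewrite real_normK ?num_real.
    have /cvg_ex[l ul] := cu.
    have /cvg_limn_einf_sup[_ ->] : (fun k => (u k)%:E) @ \oo --> l%:E.
      by apply/cvg_EFin; [exact: nearW|exact: ul].
    by [].
  split; apply: key => k; apply: le_trans (hc k); rewrite /sqmod.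
  - by case: (f k.+1 t) (f k t) => a b [a' b'] /=; rewrite lerDl sqr_ge0.
  - by case: (f k.+1 t) (f k t) => a b [a' b'] /=; rewrite lerDr sqr_ge0.
have lim_le k : (sqint (fun t => F t - f k t)%R <= (16^-1 ^+ k)%:E)%E.
  pose g j t := (sqmod (f (k + j)%N t - f k t))%:E.
  have mg j : measurable_fun setT (g j).
    by apply: measurable_sqmod; case: (sd (k + j)%N k).
  have mFk : cmeasurable (fun t => F t - f k t).
    have := cmeasurable_lin (-1) (proj1 (sf k)) mF.
    congr cmeasurable; apply/funext => t.
    by rewrite -[LHS]/(-1 * f k t + F t) mulN1r addrC.
  apply: (@le_trans _ _ (\int[m]_t limn_einf (g^~ t))%E).
    rewrite le_eqVlt; apply/orP; left; apply/eqP.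
    apply: ge0_ae_eq_integral => //.
    - exact: measurable_sqmod.
    - exact: measurable_limn_einf.
    - by move=> t _; exact: sqmod_ge0E.
    - move=> t _; rewrite limn_einf_lim; apply: lime_ge.
        exact: is_cvg_einfs.
      apply: nearW => n; apply: le_ereal_inf_tmp => _ [j _ <-].
      by rewrite /g; exact: sqmod_ge0E.
    - apply: filterS Sfin => t /cvF[cR cI] _.
      suff /cvg_limn_einf_sup[-> _] : g^~ t @ \oo --> (sqmod (F t - f k t))%:E by [].
      apply/cvg_EFin; first exact: nearW.
      have -> : (fine \o g^~ t) =
          (fun j => (Re (f (k + j)%N t) - Re (f k t)) ^+ 2
                    + (Im (f (k + j)%N t) - Im (f k t)) ^+ 2).
        apply/funext => j /=; rewrite /g /sqmod.
        by case: (f (k + j)%N t) (f k t) => a b [a' b'].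
      have -> : sqmod (F t - f k t) =
          (Re (F t) - Re (f k t)) ^+ 2 + (Im (F t) - Im (f k t)) ^+ 2.
        by rewrite /sqmod; case: (F t) (f k t) => a b [a' b'].
      have cR' : (fun j => Re (f (k + j)%N t)) @ \oo --> Re (F t).
        by have := cR; rewrite -(cvg_shiftn k) /=; under eq_fun do rewrite addnC.
      have cI' : (fun j => Im (f (k + j)%N t)) @ \oo --> Im (F t).
        by have := cI; rewrite -(cvg_shiftn k) /=; under eq_fun do rewrite addnC.
      have sq (u : nat -> R) (a l : R) : u @ \oo --> l ->
          (fun j => (u j - a) ^+ 2) @ \oo --> (l - a) ^+ 2.
        move=> ul; rewrite expr2; under eq_fun do rewrite expr2.
        by apply: cvgM; apply: cvgB => //; exact: cvg_cst.
      apply: cvgD.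
        exact: (sq (fun j => Re (f (k + j)%N t))).
      exact: (sq (fun j => Im (f (k + j)%N t))).
  apply: le_trans (fatou _ _ mg _) _ => //.
    by move=> n t _; exact: sqmod_ge0E.
  rewrite limn_einf_lim; apply: lime_le; first exact: is_cvg_einfs.
  apply: nearW => n; apply: (@le_trans _ _ (\int[m]_x g n x)%E).
    by apply: ereal_inf_lbound; exists n => //=.
  exact: step (leq_addr _ _).
have sFk k : square_integrable m (fun t => F t - f k t).
  split; last by apply: le_lt_trans (lim_le k) _; rewrite ltry.
  have := cmeasurable_lin (-1) (proj1 (sf k)) mF.
  congr cmeasurable; apply/funext => t.
  by rewrite -[LHS]/(-1 * f k t + F t) mulN1r addrC.
have sF : square_integrable m F.
  have := square_integrable_lin 1 (sFk 0%N) (sf 0%N).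
  congr (square_integrable m _); apply/funext => t.
  by rewrite -[LHS]/(1 * (F t - f 0%N t) + f 0%N t) mul1r subrK.
exists (toL2 m F) => e e0.
have [k hk] : exists k, 4^-1 ^+ k <= e / 2 :> R.
  have : geometric 1 (4^-1 : R) @ \oo --> 0.
    by apply: cvg_geometric; rewrite ger0_norm ?invf_lt1// ?ltr1n.
  move=> /cvgrPdist_le/(_ (e / 2)); rewrite divr_gt0// => /(_ isT)[k _ /(_ k)].
  rewrite /= sub0r normrN mul1r ger0_norm ?(ltW (h16 k))// => h.
  by exists k; exact: h.
exists (n_ k) => n kn.
apply: le_trans (nrm_tri _ (x (n_ k)) _) _; rewrite [leRHS]splitr lerD//.
  by apply: le_trans hk; rewrite hN// (leq_trans (Nn k)).
apply: le_trans hk.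
rewrite -[x (n_ k)]toL2_repr nrmB; apply: sqr_ler; first exact: ltW.
rewrite -lee_fin (toL2_dist_sqr sF (sf k)); apply: le_trans (lim_le k) _.
rewrite lee_fin -exprM mulnC exprM le_eqVlt; apply/orP; left; apply/eqP.
by congr (_ ^+ _); field.
Qed.

End L2Facts.

(** * Compactly supported functions *)

Section Topology.
Context (R : realType) (X : ptopologicalType).
Hypothesis Xhaus : hausdorff_space X.
Hypothesis Xlc : locally_compact [set: X].
Implicit Types (f g : X -> R[i]) (h : X -> R) (K U : set X).

Definition csupported (T : zmodType) (f : X -> T) : Prop :=
  exists2 C : set X, compact C & forall x, f x != 0 -> C x.

Lemma CcP f : Cc f <-> continuous (f : X -> R[i]^o) /\ csupported f.
Proof.
split=> [[cf kf]|[cf [C cC fC]]].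
  by split=> //; exists (closure [set x | f x != 0]) => // x fx; exact: subset_closure.
split=> //; apply: (subclosed_compact _ cC); first exact: closed_closure.
have -> : C = closure C by apply/closure_id; exact: compact_closed.
exact: closureS.
Qed.

Lemma norm_complex_le (z : R[i]) (e : R) :
  `|Re z| <= e -> `|Im z| <= e -> Re `|z| <= 2 * e.
Proof.
move=> h k; rewrite normc_def /=.
have e0 : 0 <= e by apply: le_trans h.
rewrite -[leRHS]ger0_norm ?mulr_ge0// -sqrtr_sqr ler_wsqrtr//.
move: h k; rewrite !ler_norml => /andP[h1 h2] /andP[k1 k2]; nra.
Qed.

Lemma Re_norm_le (z : R[i]) : `|Re z| <= Re `|z|.
Proof.
rewrite normc_def /= -sqrtr_sqr ler_wsqrtr// lerDl sqr_ge0 //.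
Qed.

Lemma Im_norm_le (z : R[i]) : `|Im z| <= Re `|z|.
Proof.
rewrite normc_def /= -sqrtr_sqr ler_wsqrtr// lerDr sqr_ge0 //.
Qed.

Lemma norm_ReE (z : R[i]) : `|z| = (Re `|z|)%:C%C.
Proof. by rewrite [LHS]complexE (ger0_Im (normr_ge0 z)) mulr0 addr0. Qed.

Lemma ImB (a b : R[i]) : Im (a - b) = Im a - Im b.
Proof. by case: a b => ? ? [? ?]. Qed.

Lemma cvg_complexP (T : Type) (F : set_system T) {FF : Filter F}
    (f : T -> R[i]) (l : R[i]) :
  (f : T -> R[i]^o) @ F --> (l : R[i]^o) <->
  ((Re \o f) @ F --> Re l) /\ ((Im \o f) @ F --> Im l).
Proof.
split=> [/cvgrPdist_le h|[/cvgrPdist_le h /cvgrPdist_le k]].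
  split; apply/cvgrPdist_le => e e0.
    have /h : 0 < (e%:C%C : R[i]) by rewrite ltcR.
    apply: filterS => x; rewrite norm_ReE lecR => /(le_trans (Re_norm_le _)).
    by rewrite /= ReD ReN.
  have /h : 0 < (e%:C%C : R[i]) by rewrite ltcR.
  apply: filterS => x; rewrite norm_ReE lecR => /(le_trans (Im_norm_le _)).
  by rewrite ImB.
apply/cvgrPdist_le => e e0.
have eR : e = (Re e)%:C%C.
  by rewrite [LHS]complexE (ger0_Im (ltW e0)) mulr0 addr0.
have re0 : 0 < Re e / 2 by rewrite divr_gt0//; move: e0; rewrite eR ltcR.
apply: filterS2 (h _ re0) (k _ re0) => x hx kx.
rewrite norm_ReE eR lecR [leRHS](_ : _ = 2 * (Re e / 2)); last by field.
by apply: norm_complex_le; rewrite ?ImB ?ReD ?ReN.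
Qed.

Lemma continuous_complexP (Y : topologicalType) (f : Y -> R[i]) :
  continuous (f : Y -> R[i]^o) <-> continuous (Re \o f) /\ continuous (Im \o f).
Proof.
have P x := @cvg_complexP Y (nbhs x) _ f (f x).
split=> [cf|[cR cI] x]; last by apply/P; split; [exact: cR|exact: cI].
by split=> x; have /P[] := cf x.
Qed.

Lemma continuous_real (Y : topologicalType) (h : Y -> R) : continuous h ->
  continuous (fun x => (h x)%:C%C : R[i]^o).
Proof. by move=> ch; apply/continuous_complexP; split=> // x; exact: cvg_cst. Qed.

Lemma continuous_conj (Y : topologicalType) (f : Y -> R[i]) :
  continuous (f : Y -> R[i]^o) -> continuous (fun x => (f x)^*%C : R[i]^o).
Proof.
move=> /continuous_complexP[cR cI]; apply/continuous_complexP; split.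
  by rewrite (_ : _ \o _ = Re \o f)//; apply/funext => x /=; case: (f x).
rewrite (_ : _ \o _ = (fun x => - Im (f x))).
  by move=> x; apply: cvgN; exact: cI.
by apply/funext => x /=; case: (f x).
Qed.

Lemma csupported_mull f g : csupported g -> csupported (fun x => f x * g x).
Proof.
move=> [C cC gC]; exists C => // x fg; apply: gC.
by move: fg; apply: contra_neq => ->; rewrite mulr0.
Qed.

Lemma CcMl f g : continuous (f : X -> R[i]^o) -> Cc g -> Cc (fun x => f x * g x).
Proof.
move=> cf /CcP[cg sg]; apply/CcP; split; last exact: csupported_mull.
by move=> x; apply: cvgM; [exact: cf|exact: cg].
Qed.

Lemma Cc_continuous f : Cc f -> continuous (f : X -> R[i]^o).
Proof. by case. Qed.

Lemma CcM f g : Cc f -> Cc g -> Cc (fun x => f x * g x).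
Proof. by move=> /Cc_continuous; exact: CcMl. Qed.

Lemma Cc_conj f : Cc f -> Cc (fun x => (f x)^*%C).
Proof.
move=> /CcP[cf [C cC fC]]; apply/CcP; split; first exact: continuous_conj.
exists C => // x; rewrite fmorph_eq0; exact: fC.
Qed.

Lemma Cc0 : Cc (0 : X -> R[i]).
Proof.
apply/CcP; split; first by move=> x; exact: cvg_cst.
by exists set0; [exact: compact0|move=> x; rewrite eqxx].
Qed.

Lemma CcD f g : Cc f -> Cc g -> Cc (fun x => f x + g x).
Proof.
move=> /CcP[cf [C cC fC]] /CcP[cg [C' cC' gC]]; apply/CcP; split.
  by move=> x; apply: cvgD; [exact: cf|exact: cg].
exists (C `|` C'); first exact: compactU.
move=> x; have [->|/fC] := eqVneq (f x) 0; last by left.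
by rewrite add0r => /gC; right.
Qed.

Lemma CcZ (a : R[i]) f : Cc f -> Cc (fun x => a * f x).
Proof. by apply: CcMl => x; exact: cvg_cst. Qed.

Lemma CcN f : Cc f -> Cc (fun x => - f x).
Proof. by move=> /(CcZ (-1)); congr Cc; apply/funext => x; rewrite mulN1r. Qed.

Lemma CcB f g : Cc f -> Cc g -> Cc (fun x => f x - g x).
Proof. by move=> cf /CcN; exact: CcD. Qed.

Lemma Cc_real h : continuous h -> csupported h -> Cc (fun x => (h x)%:C%C).
Proof.
move=> ch [C cC hC]; apply/CcP; split; first exact: continuous_real.
by exists C => // x hx; apply: hC; move: hx; apply: contra_neq => ->.
Qed.

Lemma bump_at x U : open U -> U x -> exists h, [/\ continuous h,
  forall y, 0 <= h y <= 1, h x = 1, csupported h & forall y, h y != 0 -> U y].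
Proof.
move=> oU Ux.
have [C nC [cC clC]] : exists2 C, nbhs x C & compact C /\ closed C.
  by have := @Xlc x I; rewrite withinET => -[C ? ?]; exists C.
pose O := U `&` C°.
have oO : open O by apply: openI => //; exact: open_interior.
have Ox : O x by split.
have := @locally_compact_completely_regular X R Xlc Xhaus x (~` O).
have cO : closed (~` O) by exact: open_closedC.
move=> /(_ cO)/(_ (fun k => k Ox)) /(@uniform_separatorP X R)[h [ch h01 h0 h1]].
exists (fun y => 1 - h y).
have hO y : 1 - h y != 0 -> O y.
  apply: contra_neqP => nO; have -> : h y = 1 by apply: h1; exists y.
  by rewrite subrr.
split.
- by move=> y; apply: cvgB; [exact: cvg_cst|exact: ch].
- move=> y; have /= := h01 (h y); rewrite in_itv/= => /(_ (ex_intro2 _ _ y I erefl)).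
  by case/andP=> *; apply/andP; split; lra.
- by rewrite (_ : h x = 0) ?subr0//; apply: h0; exists x.
- by exists C => // y /hO[_ /interior_subset].
- by move=> y /hO[].
Qed.

Lemma continuous_sum (I : eqType) (r : seq I) (phi : I -> X -> R) :
  (forall z, z \in r -> continuous (phi z)) ->
  continuous (fun x => \sum_(z <- r) phi z x).
Proof.
elim: r => [|z r IH] cr.
  rewrite (_ : (fun x => _) = cst 0); first by move=> x; exact: cvg_cst.
  by apply/funext => x; rewrite big_nil.
rewrite (_ : (fun x => _) = (fun x => phi z x + \sum_(w <- r) phi w x)); last first.
  by apply/funext => x; rewrite big_cons.
move=> x; apply: cvgD; first by apply: cr; rewrite mem_head.
by apply: IH => w wr; apply: cr; rewrite inE wr orbT.
Qed.

(** Normalising finitely many bumps by $\max(s,1/2)$, where $s$ is their sum,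
    gives a partition of unity on $K$ without dividing by zero elsewhere. *)
Lemma partition_of_unity K (O : X -> set X) : compact K ->
  (forall x, K x -> open (O x) /\ O x x) ->
  exists (r : seq X) (phi : X -> X -> R),
   [/\ (forall z, z \in r -> [/\ K z, continuous (phi z), csupported (phi z),
          (forall x, 0 <= phi z x) & (forall x, phi z x != 0 -> O z x)]),
       (forall x, \sum_(z <- r) phi z x <= 1) &
       (forall x, K x -> \sum_(z <- r) phi z x = 1)].
Proof.
move=> cK hO.
have /choice[h hh] (x : X) : exists h : X -> R, K x -> [/\ continuous h,
    forall y, 0 <= h y <= 1, h x = 1, csupported h & forall y, h y != 0 -> O x y].
  have [Kx|nKx] := pselect (K x); last by exists 0.
  by have [oO Ox] := hO x Kx; have [h ?] := bump_at oO Ox; exists h.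
move: (cK); rewrite compact_cover => /(_ X K (fun x => [set y | 2^-1 < h x y])).
case.
- move=> x Kx; have [ch _ _ _ _] := hh x Kx.
  exact: (open_comp (fun y _ => ch y) (@open_gt _ 2^-1)).
- by move=> x Kx; exists x => //=; have [_ _ -> _ _] := hh x Kx; rewrite invf_lt1// ltr1n.
move=> D DK Dcov; pose r := enum_fset D.
have rK z : z \in r -> K z by move=> /DK /set_mem.
have h0 z y : z \in r -> 0 <= h z y.
  by move=> /rK /hh[_ /(_ y) /andP[]].
pose s y := \sum_(z <- r) h z y.
have s0 y : 0 <= s y by rewrite /s big_seq; apply: sumr_ge0 => z /h0.
have cs : continuous s.
  by apply: continuous_sum => z /rK /hh[].
pose t y := Num.max (s y) 2^-1.
have t0 y : 0 < t y by rewrite /t lt_max invr_gt0 ltr0n orbT.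
have ct : continuous t.
  move=> y; apply: (@continuous_max _ _ s (cst 2^-1)); first exact: cs.
  exact: cvg_cst.
exists r, (fun z y => h z y / t y); split.
- move=> z zr; have [ch h01 hz [C cC hC] hU] := hh z (rK z zr); split.
  + exact: rK.
  + by move=> y; apply: cvgM; [exact: ch|apply: cvgV; [rewrite gt_eqF|exact: ct]].
  + exists C => // y; rewrite mulf_eq0 negb_or => /andP[+ _]; exact: hC.
  + by move=> y; rewrite divr_ge0 ?h0// ltW.
  + move=> y; rewrite mulf_eq0 negb_or => /andP[+ _]; exact: hU.
- by move=> y; rewrite -mulr_suml ler_pdivrMr// mul1r le_max lexx.
move=> y Ky; rewrite -mulr_suml -/(s y) /t.
have [z zD /= hz] := Dcov y Ky.
have : 2^-1 <= s y.
  rewrite /s (big_rem z)//= (le_trans (ltW hz))// lerDl big_seq.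
  by apply: sumr_ge0 => w /mem_rem /h0.
move=> hs; rewrite max_l// divff// gt_eqF// (lt_le_trans _ hs)//.
Qed.

(** Urysohn's lemma for a compact set inside an open one. *)
Lemma compact_cutoff K U : compact K -> open U -> K `<=` U ->
  exists h, [/\ continuous h, csupported h, forall x, 0 <= h x <= 1,
    forall x, K x -> h x = 1 & forall x, h x != 0 -> U x].
Proof.
move=> cK oU KU.
have [r [phi [hphi p1 pK]]] := @partition_of_unity K (fun=> U) cK
  (fun x Kx => conj oU (KU x Kx)).
exists (fun x => \sum_(z <- r) phi z x); split.
- by apply: continuous_sum => z /hphi[].
- elim: r hphi {p1 pK} => [|z r IH] hphi.
    by exists set0; [exact: compact0|move=> x; rewrite big_nil eqxx].
  have [C cC hC] : csupported (fun x => \sum_(z <- r) phi z x).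
    by apply: IH => w wr; apply: hphi; rewrite inE wr orbT.
  have [_ _ [C' cC' hC'] _ _] := hphi z (mem_head _ _).
  exists (C' `|` C); first exact: compactU.
  move=> x; rewrite big_cons; have [->|/hC'] := eqVneq (phi z x) 0; last by left.
  by rewrite add0r => /hC; right.
- move=> x; rewrite p1 andbT big_seq; apply: sumr_ge0 => z /hphi[_ _ _ + _].
  exact.
- exact: pK.
- move=> x; apply: contra_neqP => nU; rewrite big_seq big1// => z /hphi[_ _ _ _ hz].
  by apply/eqP; apply: contra_notT nU => /hz.
Qed.

End Topology.

Section KernelApproximation.
Context (R : realType) (X : ptopologicalType).
Hypothesis Xhaus : hausdorff_space X.
Hypothesis Xlc : locally_compact [set: X].

Lemma Re_normM (a b : R[i]) : Re `|a * b| = Re `|a| * Re `|b|.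
Proof. by rewrite normrM (norm_ReE a) (norm_ReE b) -rmorphM. Qed.

Lemma Re_norm_real (t : R) : Re `|t%:C%C : R[i]| = `|t|.
Proof. by rewrite normc_def /= expr0n addr0 sqrtr_sqr. Qed.

Lemma Re_norm_sum (I : Type) (s : seq I) (P : pred I) (f : I -> R[i]) :
  Re `|\sum_(i <- s | P i) f i| <= \sum_(i <- s | P i) Re `|f i|.
Proof.
elim/big_ind2 : _ => [|a b c e h1 h2|//]; first by rewrite normr0.
apply: le_trans (lerD h1 h2); have := ler_normD b e.
by rewrite (norm_ReE (b + e)) (norm_ReE b) (norm_ReE e) -rmorphD lecR.
Qed.

Lemma open_finite_inter (I : eqType) (s : seq I) (f : I -> set X) :
  (forall z, z \in s -> open (f z)) -> open [set x | forall z, z \in s -> f z x].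
Proof.
elim: s => [|z s IH] os.
  by rewrite (_ : [set _ | _] = setT); [exact: openT|apply/seteqP; split].
rewrite (_ : [set _ | _] = f z `&` [set x | forall w, w \in s -> f w x]).
  apply: openI; first by apply: os; rewrite mem_head.
  by apply: IH => w ws; apply: os; rewrite inE ws orbT.
apply/seteqP; split=> [x h|x [zx h] w].
  by split=> [|w ws]; apply: h; rewrite inE ?eqxx// ws orbT.
by rewrite inE => /predU1P[->//|/h].
Qed.

(** A kernel on a closed set $F$ that is locally nearly constant is, on a compact
    box, a finite sum of products: nested partitions of unity (first in the
    second variable, then in the first) replace it by its values at sample
    points. The cut-offs $p$, $q$ do not depend on $e$, so that the error is
    small for any norm controlled by compactly supported weights. *)
Lemma kernel_approx (F : set (X * X)) (k : X * X -> R[i]) (K L : set X) :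
  closed F -> compact K -> compact L ->
  (forall w, F w -> (k : X * X -> R[i]^o) @ within F (nbhs w) --> (k w : R[i]^o)) ->
  (forall w, F w -> k w != 0 -> K w.1 /\ L w.2) ->
  exists p q : X -> R, [/\ (forall x, 0 <= p x) /\ (forall x, 0 <= q x),
    Cc (fun x => (p x)%:C%C), Cc (fun x => (q x)%:C%C) &
    forall e : R, 0 < e -> exists (s : seq (X * X)) (a b : X * X -> X -> R[i]),
      (forall v, v \in s -> Cc (a v) /\ Cc (b v)) /\
      forall x y, F (x, y) ->
        Re `|k (x, y) - \sum_(v <- s) a v x * b v y| <= e * (p x * q y)].
Proof.
move=> clF cK cL ck suppk.
have [p [cp sp p01 pK _]] := compact_cutoff R Xhaus Xlc cK openT (@subsetT _ _).
have [q [cq sq q01 qL _]] := compact_cutoff R Xhaus Xlc cL openT (@subsetT _ _).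
have p0 x : 0 <= p x by have /andP[] := p01 x.
have q0 x : 0 <= q x by have /andP[] := q01 x.
have Cp := Cc_real Xhaus cp sp; have Cq := Cc_real Xhaus cq sq.
exists p, q; split=> // e e0.
have [K' cK' hK'] := sp; have [L' cL' hL'] := sq.
have /choice[B hB] (w : X * X) : exists B : set X * set X * R[i],
    [/\ open B.1.1, open B.1.2, B.1.1 w.1, B.1.2 w.2 &
     forall v, F v -> B.1.1 v.1 -> B.1.2 v.2 -> Re `|k v - B.2| <= e].
  have box (N : set (X * X)) : nbhs w N -> exists U V : set X,
      [/\ open U, open V, U w.1, V w.2 & forall v, U v.1 -> V v.2 -> N v].
    case=> -[U V] /= [nU nV] UV; exists (U°), (V°); split.
    - exact: open_interior.
    - exact: open_interior.
    - exact: nU.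
    - exact: nV.
    - by move=> [v1 v2] /= /interior_subset h1 /interior_subset h2; exact: UV.
  have [Fw|nFw] := pselect (F w).
    have /cvgrPdist_le/(_ (e%:C%C)) := ck w Fw.
    rewrite ltcR => /(_ e0) /box[U [V [oU oV Uw Vw h]]].
    exists (U, V, k w); split=> //= v Fv Uv Vv.
    by have := h v Uv Vv Fv; rewrite /= distrC norm_ReE lecR.
  have /box[U [V [oU oV Uw Vw h]]] : nbhs w (~` F).
    by apply: open_nbhs_nbhs; split=> //; exact: closed_openC.
  by exists (U, V, 0); split=> //= v Fv Uv Vv; case: (h v Uv Vv).
have /choice[rp hrp] (x : X) : exists rp : seq X * (X -> X -> R),
   [/\ (forall z, z \in rp.1 -> [/\ L' z, continuous (rp.2 z), csupported (rp.2 z),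
          (forall y, 0 <= rp.2 z y) & (forall y, rp.2 z y != 0 -> (B (x, z)).1.2 y)]),
       (forall y, \sum_(z <- rp.1) rp.2 z y <= 1) &
       (forall y, L' y -> \sum_(z <- rp.1) rp.2 z y = 1)].
  have [|r [psi h]] := @partition_of_unity R X Xhaus Xlc L'
      (fun y => (B (x, y)).1.2) cL'; last by exists (r, psi).
  by move=> y _; have [] := hB (x, y).
pose r x := (rp x).1; pose psi x := (rp x).2.
pose U x := [set x' | forall z, z \in r x -> (B (x, z)).1.1 x'].
have [|t [phi [hphi phi1 phiK]]] := @partition_of_unity R X Xhaus Xlc K' U cK'.
  move=> x _; split; last by move=> z _; have [] := hB (x, z).
  by apply: open_finite_inter => z _; have [] := hB (x, z).
pose s := [seq (x, y) | x <- t, y <- r x].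
exists s, (fun v x => (p x)%:C%C * (phi v.1 x)%:C%C),
  (fun v y => (q y)%:C%C * ((psi v.1 v.2 y)%:C%C * (B v).2)).
have ins v : v \in s -> v.1 \in t /\ v.2 \in r v.1.
  by case/allpairsPdep => x [y [xt yr ->]].
split.
  move=> v /ins[v1 v2]; split.
    have [_ c1 s1 _ _] := hphi _ v1.
    by apply: (CcM Xhaus) => //; exact: Cc_real.
  have [/(_ _ v2)[_ c1 s1 _ _] _ _] := hrp v.1.
  apply: (CcM Xhaus) => //.
  have := CcZ Xhaus (B v).2 (Cc_real Xhaus c1 s1).
  by congr Cc; apply/funext => y; rewrite mulrC.
move=> x y Fw.
pose S := \sum_(v <- s) (phi v.1 x)%:C%C * (psi v.1 v.2 y)%:C%C * (B v).2.
have -> : \sum_(v <- s) (p x)%:C%C * (phi v.1 x)%:C%C *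
    ((q y)%:C%C * ((psi v.1 v.2 y)%:C%C * (B v).2)) = (p x * q y)%:C%C * S.
  rewrite /S mulr_sumr; apply: eq_bigr => v _; rewrite rmorphM /=; ring.
have -> : k (x, y) = (p x * q y)%:C%C * k (x, y).
  have [->|k0] := eqVneq (k (x, y)) 0; first by rewrite mulr0.
  by have [/= Kx Ly] := suppk _ Fw k0; rewrite pK// qL// mulr1 mul1r.
rewrite -mulrBr Re_normM Re_norm_real ger0_norm ?mulr_ge0// mulrC.
have [pq0|pq0] := eqVneq (p x * q y) 0; first by rewrite pq0 !mulr0.
rewrite ler_wpM2r ?mulr_ge0//.
have [px qy] : p x != 0 /\ q y != 0.
  by move: pq0; rewrite mulf_eq0 negb_or => /andP.
have K'x := hK' x px; have L'y := hL' y qy.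
have one : \sum_(v <- s) phi v.1 x * psi v.1 v.2 y = 1.
  rewrite /s big_allpairs_dep /= -(phiK x K'x); apply: eq_bigr => z _.
  rewrite -mulr_sumr; have [_ _ h] := hrp z.
  by rewrite h// mulr1.
have -> : k (x, y) - S =
    \sum_(v <- s) (phi v.1 x * psi v.1 v.2 y)%:C%C * (k (x, y) - (B v).2).
  have kE : k (x, y) =
      \sum_(v <- s) (phi v.1 x * psi v.1 v.2 y)%:C%C * k (x, y).
    by rewrite -mulr_suml -rmorph_sum one mul1r.
  rewrite [X in X - _]kE /S -sumrB.
  by apply: eq_bigr => v _; rewrite mulrBr rmorphM.
apply: le_trans (Re_norm_sum _ _ _) _.
rewrite -[leRHS]mul1r -one mulr_suml.
rewrite big_seq [leRHS]big_seq; apply: ler_sum => v /ins[v1 v2].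
have [_ _ _ ph0 phU] := hphi _ v1.
have [/(_ _ v2)[_ _ _ ps0 psV] _ _] := hrp v.1.
have pp : 0 <= phi v.1 x * psi v.1 v.2 y by rewrite mulr_ge0// ps0.
rewrite Re_normM Re_norm_real ger0_norm//.
have [->|n0] := eqVneq (phi v.1 x * psi v.1 v.2 y) 0; first by rewrite !mul0r.
rewrite ler_wpM2l//.
move: n0; rewrite mulf_eq0 negb_or => /andP[/phU Ux /psV Vy].
have [_ _ _ _ h] := hB v.
have vE : (v.1, v.2) = v by case: (v).
apply: (h (x, y)) => //; last by rewrite -vE.
by have := Ux v.2 v2; rewrite vE.
Qed.

(** In [kernel_approx] the functions at indices outside of $s$ are arbitrary; here
    they are zero, so that every index gives operators of the required kind. *)
Lemma kernel_approx_all (F : set (X * X)) (k : X * X -> R[i]) (K L : set X) :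
  closed F -> compact K -> compact L ->
  (forall w, F w -> (k : X * X -> R[i]^o) @ within F (nbhs w) --> (k w : R[i]^o)) ->
  (forall w, F w -> k w != 0 -> K w.1 /\ L w.2) ->
  exists p q : X -> R, [/\ (forall x, 0 <= p x) /\ (forall x, 0 <= q x),
    Cc (fun x => (p x)%:C%C), Cc (fun x => (q x)%:C%C) &
    forall e : R, 0 < e -> exists (s : seq (X * X)) (a b : X * X -> X -> R[i]),
      (forall v, Cc (a v) /\ Cc (b v)) /\
      forall x y, F (x, y) ->
        Re `|k (x, y) - \sum_(v <- s) a v x * b v y| <= e * (p x * q y)].
Proof.
move=> clF cK cL ck suppk.
have [p [q [pq0 Cp Cq h]]] := kernel_approx clF cK cL ck suppk.
exists p, q; split=> // e /h[s [a [b [Cab hab]]]].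
exists s, (fun (v : X * X) (x : X) => if v \in s then a v x else 0),
  (fun (v : X * X) (x : X) => if v \in s then b v x else 0).
split.
  move=> v; case: (boolP (v \in s)) => vs; first exact: Cab.
  by have := @Cc0 R X Xhaus.
move=> x y Fxy; have := hab x y Fxy.
suff -> : \sum_(v <- s) a v x * b v y = \sum_(v <- s)
    (if v \in s then a v x else 0) * (if v \in s then b v y else 0) by [].
by apply: eq_big_seq => v ->.
Qed.

End KernelApproximation.

(** * Borel measures on locally compact second countable spaces *)

Section BorelMeasures.
Context (R : realType) (X : ptopologicalType).
Hypothesis Xhaus : hausdorff_space X.
Hypothesis Xlc : locally_compact [set: X].
Hypothesis Xsc : @second_countable X.

Lemma borel_open (U : set X) : open U -> measurable (U : set (borel X)).
Proof. by move=> oU; apply: sub_sigma_algebra. Qed.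

Lemma borel_closed (U : set X) : closed U -> measurable (U : set (borel X)).
Proof.
move=> cU; have mU : measurable (~` U : set (borel X)).
  by apply: borel_open; exact: closed_openC.
by rewrite -[U]setCK; exact: measurableC.
Qed.

Lemma borel_compact (K : set X) : compact K -> measurable (K : set (borel X)).
Proof. by move=> cK; apply: borel_closed; exact: compact_closed. Qed.

Lemma continuous_borel (h : X -> R) :
  continuous h -> measurable_fun setT (h : borel X -> R).
Proof.
move=> ch; apply: (measurability _ (RGenOInfty.measurableE R)).
move=> _ [_ [a ->] <-]; rewrite setTI; apply: borel_open.
apply: open_comp; first by move=> x _; exact: ch.
exact: interval_open.
Qed.

Lemma continuous_cmeasurable (f : X -> R[i]) :
  continuous (f : X -> R[i]^o) -> cmeasurable (f : borel X -> R[i]).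
Proof. by move=> /continuous_complexP[cR cI]; split; exact: continuous_borel. Qed.

Lemma countable_base : exists e : nat -> set X, (forall n, open (e n)) /\
  forall (U : set X) x, open U -> U x -> exists n, e n x /\ e n `<=` U.
Proof.
have [B cB [oB bB]] := Xsc.
move: cB => /pfcard_geP[B0|[e]].
  exists (fun=> set0); split=> [n|U x oU Ux]; first exact: open0.
  have [V [BV _] _] := bB x U (open_nbhs_nbhs (conj oU Ux)).
  by move: BV; rewrite B0.
exists e; split=> [n|U x oU Ux].
  by apply: oB; exact: (@funS _ _ _ _ e n Logic.I).
have [V [BV Vx] VU] := bB x U (open_nbhs_nbhs (conj oU Ux)).
have [n _ en] := @surj _ _ _ _ e V BV.
by exists n; rewrite en.
Qed.

(** The functions are maxima of bumps, one for each set of a countable base that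
    lies in the region where some bump inside $U$ exceeds $1/2$. *)
Lemma open_exhaustion (U : set X) : open U -> exists h : nat -> X -> R,
  [/\ forall n, continuous (h n), forall n, csupported (h n),
      forall n x, 0 <= h n x <= 1, forall n m x, (n <= m)%N -> h n x <= h m x &
      (forall n x, h n x != 0 -> U x) /\
      (forall x, U x -> exists N, forall n, (N <= n)%N -> h n x = 1)].
Proof.
move=> oU; have [e [oe be]] := countable_base.
pose good n (g : X -> R) := [/\ continuous g, csupported g, forall x, 0 <= g x <= 1,
  forall x, g x != 0 -> U x & forall x, e n x -> g x = 1].
pose zero : X -> R := fun=> 0.
have z0 : [/\ continuous zero, csupported zero, forall x, 0 <= zero x <= 1 &
    forall x, zero x != 0 -> U x].
  split=> [x||x|x]; first exact: cvg_cst.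
  - by exists set0; [exact: compact0|move=> x; rewrite eqxx].
  - by rewrite /zero lexx ler01.
  - by rewrite eqxx.
have /choice[g hg] n : exists g : X -> R, [/\ continuous g, csupported g,
    forall x, 0 <= g x <= 1, forall x, g x != 0 -> U x &
    (exists g', good n g') -> good n g].
  have [[g' hg']|no] := pselect (exists g', good n g').
    by exists g'; case: (hg').
  by exists zero; case: z0.
pose fix h (n : nat) : X -> R := if n is n'.+1 then h n' \max g n else g 0%N.
exists h.
have hS n : h n.+1 = h n \max g n.+1 by [].
split.
- elim=> [|n IH]; first by have [] := hg 0%N.
  rewrite hS => x; apply: (@continuous_max _ _ (h n) (g n.+1)); first exact: IH.
  by have [+ _ _ _ _] := hg n.+1; apply.
- elim=> [|n [C cC hC]]; first by have [] := hg 0%N.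
  have [_ [C' cC' hC'] _ _ _] := hg n.+1.
  exists (C `|` C'); first exact: compactU.
  move=> x; rewrite hS /= /Num.max; case: ifP => _.
    by move=> /hC'; right.
  by move=> /hC; left.
- elim=> [|n IH] x; first by have [_ _ + _ _] := hg 0%N; apply.
  have [_ _ /(_ x) + _ _] := hg n.+1; have := IH x.
  by rewrite hS /= /Num.max; case: ifP.
- move=> n m x; elim: m => [|m IH]; first by rewrite leqn0 => /eqP ->.
  rewrite leq_eqVlt => /predU1P[->//|]; rewrite ltnS => /IH /le_trans; apply.
  by rewrite hS /= le_max lexx.
- split.
    elim=> [|n IH] x; first by have [_ _ _ + _] := hg 0%N; apply.
    rewrite hS /= /Num.max; case: ifP => _; last exact: IH.
    by have [_ _ _ + _] := hg n.+1; apply.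
  move=> x Ux; have [b [cb b01 bx sb bU]] := bump_at R Xhaus Xlc oU Ux.
  have [||n [enx eb]] := be [set y | 2^-1 < b y] x.
  + exact: (open_comp (fun y _ => cb y) (@open_gt _ 2^-1)).
  + by rewrite /= bx invf_lt1// ltr1n.
  exists n => m nm.
  have gnx : g n x = 1.
    have [_ _ _ _ hgood] := hg n; have [|_ _ _ _ ->//] := hgood.
    exists (fun y => Num.min (2 * b y) 1); split.
    + move=> y; apply: (@continuous_min _ _ (fun y => 2 * b y) (cst 1)).
        by apply: cvgM; [exact: cvg_cst|exact: cb].
      exact: cvg_cst.
    + have [C cC hC] := sb; exists C => // y; apply: contra_neqP => nC.
      have -> : b y = 0 by apply/eqP; apply: contra_notT nC => /hC.
      by rewrite mulr0 min_l.
    + move=> y; have /andP[b0 b1] := b01 y.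
      by rewrite le_min ge_min lexx orbT ler01 mulr_ge0.
    + move=> y; apply: contra_neqP => nU.
      have -> : b y = 0 by apply/eqP; apply: contra_notT nU => /bU.
      by rewrite mulr0 min_l.
    + move=> y /eb /= hb; apply: min_r.
      by rewrite -(@ler_pM2l _ 2^-1) ?invr_gt0// mulKf// mulr1 ltW.
  have h01 k y : h k y <= 1.
    elim: k => [|k IH]; first by have [_ _ /(_ y)/andP[]] := hg 0%N.
    by rewrite hS /= ge_max IH /=; have [_ _ /(_ y)/andP[]] := hg k.+1.
  have hn : 1 <= h n x.
    rewrite -gnx; case: (n) => [|k]; first by [].
    by rewrite hS /= le_max lexx orbT.
  apply/eqP; rewrite eq_le h01 /=.
  apply: le_trans hn _; elim: m nm => [|m IH]; first by rewrite leqn0 => /eqP ->.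
  rewrite leq_eqVlt => /predU1P[->//|]; rewrite ltnS => /IH /le_trans; apply.
  by rewrite hS /= le_max lexx.
Qed.

Definition compactly_finite (m : {measure set borel X -> \bar R}) : Prop :=
  forall K : set X, compact K -> (m K < +oo)%E.

(** The sets are $\{h_n>1/2\}$ for an exhaustion $h_n$ of the whole space by
    compactly supported functions. *)
Lemma finite_exhaustion : exists W : nat -> set X,
  [/\ forall n, open (W n), forall n k, (n <= k)%N -> W n `<=` W k,
      forall x, exists N, forall n, (N <= n)%N -> W n x &
      forall (m : {measure set borel X -> \bar R}) n,
        compactly_finite m -> (m (W n) < +oo)%E].
Proof.
have [h [ch sh h01 hm [_ h1]]] := open_exhaustion openT.
exists (fun n => [set x | 2^-1 < h n x]); split.
- by move=> n; exact: (open_comp (fun y _ => ch n y) (@open_gt _ 2^-1)).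
- by move=> n k nk x /= /lt_le_trans; apply; exact: hm.
- move=> x; have [N hN] := h1 x Logic.I; exists N => n /hN /= ->.
  by rewrite invf_lt1// ltr1n.
- move=> m n fm; have [C cC hC] := sh n.
  have oW : open [set x | 2^-1 < h n x].
    exact: (open_comp (fun y _ => ch n y) (@open_gt _ 2^-1)).
  apply: le_lt_trans (fm C cC); apply: le_measure.
  + exact: mem_set (borel_open oW).
  + exact: mem_set (borel_compact cC).
  + move=> x /= hx; apply: hC; rewrite gt_eqF// (lt_trans _ hx)//.
Qed.

Lemma measure_open_lim (m : {measure set borel X -> \bar R}) (U : set X)
    (h : nat -> X -> R) :
  open U -> (forall n, continuous (h n)) -> (forall n x, 0 <= h n x <= 1) ->
  (forall n k x, (n <= k)%N -> h n x <= h k x) -> (forall n x, h n x != 0 -> U x) ->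
  (forall x, U x -> exists N, forall n, (N <= n)%N -> h n x = 1) ->
  (fun n => \int[m]_x (h n x)%:E)%E @ \oo --> m U.
Proof.
move=> oU ch h01 hm hU h1.
have h0 n x : 0 <= h n x by have /andP[] := h01 n x.
have -> : m U = (\int[m]_x limn (fun n => (h n x)%:E))%E.
  rewrite -[U in LHS]setIT -integral_indic//; last exact: borel_open.
  apply: eq_integral => x _; apply/esym/cvg_lim => //.
  rewrite indicE; have [xU|xU] := boolP (x \in U).
    have [N hN] := h1 x (set_mem xU).
    apply: cvg_near_cst; exists N => // n /= /hN ->; by [].
  apply: cvg_near_cst; apply: nearW => n.
  have -> // : h n x = 0.
  by apply/eqP; apply: contraNT xU => /hU /mem_set.
apply: (@cvg_monotone_convergence _ _ _ m setT measurableT (fun n x => (h n x)%:E)).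
- by move=> n; apply/measurable_EFinP; exact: continuous_borel.
- by move=> n x _; rewrite lee_fin.
- by move=> x _ n k nk; rewrite lee_fin hm.
Qed.

(** Riesz uniqueness: open sets are exhausted by test functions and generate the
    Borel sets. *)
Lemma measure_eq_test (m1 m2 : {measure set borel X -> \bar R}) :
  compactly_finite m1 ->
  (forall h : X -> R, continuous h -> csupported h -> (forall x, 0 <= h x <= 1) ->
    (\int[m1]_x (h x)%:E = \int[m2]_x (h x)%:E)%E) ->
  forall A : set (borel X), measurable A -> m1 A = m2 A.
Proof.
move=> f1 h12.
have [W [oW _ covW fW]] := finite_exhaustion.
move=> A mA.
apply: (@measure_unique _ R (borel X) (@open X : set (set (borel X))) W
  _ _ _ _ m1 m2 _ _ A mA) => //.
- exact: openI.
- by apply/seteqP; split=> // x _; have [N hN] := covW x; exists N => //; exact: hN.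
- move=> U oU; have [h [ch sh h01 hm [hU h1]]] := open_exhaustion oU.
  have c1 := @measure_open_lim m1 U h oU ch h01 hm hU h1.
  have c2 := @measure_open_lim m2 U h oU ch h01 hm hU h1.
  have E : (fun n => \int[m1]_x (h n x)%:E)%E = (fun n => \int[m2]_x (h n x)%:E)%E.
    by apply/funext => n; rewrite h12.
  by rewrite E in c1; exact: cvg_unique c1 c2.
- by move=> k; exact: fW.
Qed.

End BorelMeasures.

Lemma continuous_borel_map (X Y : ptopologicalType) (f : X -> Y) :
  continuous f -> measurable_fun setT (f : borel X -> borel Y).
Proof.
move=> cf; apply: (@measurability _ _ _ _ _ _ (@open Y : set (set (borel Y)))) => //.
move=> _ [Q oQ <-]; rewrite setTI; apply: borel_open.
by apply: open_comp => // x _; exact: cf.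
Qed.

(** * Density of compactly supported functions *)

Section DominatedL2.
Context d (T : measurableType d) (R : realType) (m : {measure set T -> \bar R}).

Lemma sqmod_real (t : R) : sqmod (t%:C%C : R[i]) = t ^+ 2.
Proof. by rewrite /sqmod /= expr0n addr0. Qed.

Lemma cmeasurable_real (h : T -> R) : measurable_fun setT h ->
  cmeasurable (fun x => (h x)%:C%C).
Proof. by move=> mh; split=> //; exact: measurable_cst. Qed.

Lemma toL2_dominated (f_ : nat -> T -> R[i]) (f : T -> R[i]) (g : T -> R) :
  (forall n, square_integrable m (f_ n)) -> square_integrable m f ->
  m.-integrable setT (EFin \o g) ->
  (forall n x, sqmod (f_ n x - f x) <= g x) ->
  (forall x, (fun n => sqmod (f_ n x - f x)) @ \oo --> (0 : R)) ->
  forall e : R, 0 < e -> exists n, nrm (toL2 m f - toL2 m (f_ n)) <= e.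
Proof.
move=> sf_ sf ig fg f0 e e0.
have sB n : square_integrable m (fun x => f_ n x - f x) by exact: square_integrableB.
have h : (fun n => \int[m]_x (sqmod (f_ n x - f x))%:E)%E @ \oo --> (\int[m]_x (cst 0) x)%E.
  apply: (@dominated_cvg _ _ _ m setT measurableT
    (fun n x => (sqmod (f_ n x - f x))%:E) (cst 0) (EFin \o g)) => //.
  - by move=> n; apply: measurable_sqmod; case: (sB n).
  - move=> x _; apply/cvg_EFin; first exact: nearW.
    exact: (f0 x).
  - by move=> n x _ /=; rewrite lee_fin ger0_norm ?sqmod_ge0.
move: h; rewrite integral0 => /fine_cvgP[_ /cvgrPdist_le/(_ (e ^+ 2))].
rewrite exprn_gt0// => /(_ isT)[n _ /(_ n (leqnn _))] /= h.
exists n; apply: sqr_ler; first exact: ltW.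
have := toL2_dist_sqr (sf_ n) sf; rewrite nrmB /sqint => E.
move: h; rewrite -E /= sub0r normrN ger0_norm ?sqr_ge0//.
Qed.

End DominatedL2.

Section Density.
Context (R : realType) (X : ptopologicalType).
Hypothesis Xhaus : hausdorff_space X.
Hypothesis Xlc : locally_compact [set: X].
Hypothesis Xsc : @second_countable X.

Lemma Cc_bounded (f : X -> R[i]) : Cc f ->
  exists2 M : R, 0 <= M & forall x, sqmod (f x) <= M.
Proof.
move=> /(CcP Xhaus)[/continuous_complexP[cR cI] [C cC hC]].
have ch : continuous (fun x => sqmod (f x)).
  have -> : (fun x => sqmod (f x)) =
      (fun y => (Re \o f) y * (Re \o f) y + (Im \o f) y * (Im \o f) y).
    by apply/funext => y; rewrite /sqmod !expr2.
  by move=> x; apply: cvgD; apply: cvgM; (exact: cR || exact: cI).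
have : compact ((fun x => sqmod (f x)) @` C).
  by apply: continuous_compact => //; exact: continuous_subspaceT.
move=> /compact_bounded[N [_ hN]].
exists (`|N| + 1) => [|x]; first by rewrite addr_ge0.
have [fx0|/hC Cx] := eqVneq (f x) 0.
  by rewrite fx0 (sqmod_real 0) expr0n addr_ge0.
have := hN (`|N| + 1); rewrite (le_lt_trans (ler_norm N)) ?ltrDl// => /(_ isT).
by move=> /(_ (sqmod (f x)) (ex_intro2 _ _ x Cx erefl)) /(le_trans (ler_norm _)).
Qed.

Variable m : {measure set borel X -> \bar R}.
Hypothesis mfin : compactly_finite m.

Lemma Cc_square_integrable (f : X -> R[i]) : Cc f -> square_integrable m f.
Proof.
move=> Cf; have mf := continuous_cmeasurable (Cc_continuous Cf).
have [M M0 hM] := Cc_bounded Cf; have /(CcP Xhaus)[_ [C cC hC]] := Cf.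
split=> //; have mC := borel_compact Xhaus cC.
apply: (@le_lt_trans _ _ (\int[m]_x (M%:E * (\1_C x)%:E))%E).
  apply: ge0_le_integral => //.
  - by move=> x _; exact: sqmod_ge0E.
  - exact: measurable_sqmod.
  - by apply/measurable_EFinP; apply: measurable_funM => //; exact: measurable_indic.
  move=> x _; rewrite -EFinM lee_fin; have [fx0|/hC Cx] := eqVneq (f x) 0.
    by rewrite fx0 (sqmod_real 0) expr0n mulr_ge0.
  by rewrite indicE mem_set// mulr1.
rewrite ge0_integralZl_EFin//; last first.
  by apply/measurable_EFinP; exact: measurable_indic.
rewrite integral_indic// setIT.
by apply: lte_mul_pinfty => //; exact: mfin.
Qed.

Let D (F : L2 m) : Prop :=
  forall e : R, 0 < e -> exists g, Cc g /\ nrm (F - toL2 m g) <= e.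

Let Dlin (a : R[i]) F G : D F -> D G -> D (a *: F + G).
Proof.
move=> DF DG e e0.
have a1 : 0 < Re `|a| + 1.
  by rewrite ltr_wpDl//; have := nrm_ge0 (a : R[i]^o).
have [|f [Cf hf]] := DF (e / 2 / (Re `|a| + 1)); first by rewrite !divr_gt0.
have [|g [Cg hg]] := DG (e / 2); first by rewrite divr_gt0.
exists (fun x => a * f x + g x); split; first by apply: CcD => //; exact: CcZ.
rewrite toL2_lin; [|exact: Cc_square_integrable|exact: Cc_square_integrable].
rewrite opprD addrACA -scalerBr; apply: le_trans (nrmD _ _) _.
rewrite [leRHS](splitr e) lerD// nrmZ.
apply: (@le_trans _ _ ((Re `|a| + 1) * nrm (F - toL2 m f))).
  by rewrite ler_wpM2r ?nrm_ge0// lerDl.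
by rewrite mulrC -ler_pdivlMr.
Qed.

Let Dlim F : (forall e : R, 0 < e -> exists G, D G /\ nrm (F - G) <= e) -> D F.
Proof.
move=> h e e0; have e2 : 0 < e / 2 by rewrite divr_gt0.
have [G [DG FG]] := h _ e2; have [g [Cg hg]] := DG _ e2; exists g; split=> //.
by apply: le_trans (nrm_tri _ G _) _; rewrite (splitr e) lerD.
Qed.

Let ind (A : set X) (x : X) : R[i] := (\1_A x : R)%:C%C.

Let sqmod_ind A x : sqmod (ind A x) = \1_A x.
Proof. by rewrite sqmod_real indicE; case: (x \in A); rewrite ?expr1n ?expr0n. Qed.

Let ind_square_integrable (A : set (borel X)) : measurable A -> (m A < +oo)%E ->
  square_integrable m (ind A).
Proof.
move=> mA fA; split; first by apply: cmeasurable_real; exact: measurable_indic.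
by under eq_integral do rewrite sqmod_ind; rewrite integral_indic// setIT.
Qed.

Let ind_integrable (A : set (borel X)) : measurable A -> (m A < +oo)%E ->
  m.-integrable setT (EFin \o (\1_A : X -> R)).
Proof.
move=> mA fA; have := integrable_sqmod (ind_square_integrable mA fA).
by congr (integrable _ _ _); apply/funext => x /=; rewrite sqmod_ind.
Qed.

Let cvg_eventually0 (u : nat -> R) :
  (exists N, forall n, (N <= n)%N -> u n = 0) -> u @ \oo --> (0 : R).
Proof. by move=> [N hN]; apply: cvg_near_cst; exists N. Qed.

Let Dopen (W : set X) : open W -> (m W < +oo)%E -> D (toL2 m (ind W)).
Proof.
move=> oW fW; have [h [ch sh h01 hm [hU h1]]] := open_exhaustion R Xhaus Xlc Xsc oW.
move=> e e0; have Ch n := Cc_real Xhaus (ch n) (sh n).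
have mW := borel_open oW.
have [||||n hn] := @toL2_dominated _ _ _ m (fun n x => (h n x)%:C%C) (ind W) \1_W _
    (ind_square_integrable mW fW) _ _ _ e e0.
- by move=> n; exact: Cc_square_integrable.
- exact: ind_integrable.
- move=> n x; rewrite /ind -rmorphB sqmod_real indicE.
  have [xW|xW] := boolP (x \in W); last first.
    have -> : h n x = 0 by apply/eqP; apply: contraNT xW => /hU /mem_set.
    by rewrite subr0 expr0n.
  by have /andP[] := h01 n x; rewrite /= mulr1n; nra.
- move=> x; apply: cvg_eventually0.
  have [Wx|nWx] := pselect (W x).
    have [N hN] := h1 x Wx; exists N => n /hN ->.
    by rewrite /ind indicE mem_set// subrr sqmod_real expr0n.
  exists 0%N => n _.
  have -> : h n x = 0 by apply/eqP; apply: contra_notT nWx => /hU.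
  by rewrite /ind indicE memNset// subrr sqmod_real expr0n.
by exists (fun x => (h n x)%:C%C).
Qed.

(** Dynkin induction starting from the open sets, inside an open set of finite
    measure so that complements and unions stay square integrable. *)
Let Dborel (W : set X) : open W -> (m W < +oo)%E ->
  forall S : set (borel X), measurable S -> D (toL2 m (ind (S `&` W))).
Proof.
move=> oW fW; have mW := borel_open oW.
have fin (S : set (borel X)) : measurable S -> (m (S `&` W) < +oo)%E.
  move=> mS; apply: le_lt_trans fW; apply: le_measure; last exact: subIsetr.
  - by apply: mem_set; exact: measurableI.
  - exact: mem_set mW.
have sI (S : set (borel X)) : measurable S -> square_integrable m (ind (S `&` W)).
  move=> mS; apply: ind_square_integrable; last exact: fin.
  exact: measurableI.
pose P (S : set (borel X)) := D (toL2 m (ind (S `&` W))).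
move=> S0 mS0; rewrite -/(P S0).
apply: (@dynkin_induction _ (borel X) (@open X : set (set (borel X))) P
  erefl _ _ _ _ _ S0 mS0); rewrite /P.
- exact: openI.
- by rewrite setTI; exact: Dopen.
- move=> U oU; apply: Dopen; first exact: openI.
  by apply: fin; exact: borel_open.
- move=> S mS DS.
  have -> : ind (~` S `&` W) = (fun x => -1 * ind (S `&` W) x + ind W x).
    apply/funext => x; rewrite /ind mulN1r addrC -rmorphB; congr (_%:C%C).
    rewrite !indicE !in_setI in_setC.
    by case: (x \in S); case: (x \in W); rewrite /= ?subrr ?subr0.
  rewrite toL2_lin; [|exact: sI|exact: ind_square_integrable].
  exact: (Dlin (-1) DS (Dopen oW fW)).
- move=> F mF tF DF; apply: Dlim => e e0.
  pose Q n := \big[setU/set0]_(k < n) F k.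
  have mQ n : measurable (Q n : set (borel X)) by apply: bigsetU_measurable.
  have DQ n : D (toL2 m (ind (Q n `&` W))).
    elim: n => [|n IH].
      have -> : ind (Q 0%N `&` W) = (fun x => -1 * ind W x + ind W x).
        apply/funext => x; rewrite mulN1r addNr /Q big_ord0 set0I /ind indicE.
        by rewrite in_set0.
      rewrite toL2_lin; [|exact: ind_square_integrable|exact: ind_square_integrable].
      exact: (Dlin (-1) (Dopen oW fW) (Dopen oW fW)).
    have -> : ind (Q n.+1 `&` W) = (fun x => 1 * ind (Q n `&` W) x + ind (F n `&` W) x).
      apply/funext => x; rewrite /ind mul1r -rmorphD; congr (_%:C%C).
      rewrite /Q big_ord_recr /= -/(Q n) !indicE !in_setI in_setU.
      have : ~~ ((x \in Q n) && (x \in F n)).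
        apply/negP => /andP[/set_mem]; rewrite /Q -bigcup_mkord => -[k /= kn Fk] /set_mem Fn.
        have /trivIsetP/(_ k n Logic.I Logic.I) := tF.
        by rewrite ltn_eqF// => /(_ isT); apply/eqP/set0P; exists x.
      by case: (x \in Q n); case: (x \in F n); case: (x \in W); rewrite /= ?addr0 ?add0r.
    by rewrite toL2_lin; [exact: (Dlin 1 IH (DF n))|exact: sI|exact: sI].
  have mU : measurable (\bigcup_k F k : set (borel X)) by exact: bigcup_measurable.
  have QU n : Q n `<=` \bigcup_k F k.
    by rewrite /Q -bigcup_mkord => x [k _ Fk]; exists k.
  have [||||n hn] := @toL2_dominated _ _ _ m (fun n => ind (Q n `&` W))
     (ind (\bigcup_k F k `&` W)) \1_W _ (sI _ mU) _ _ _ e e0.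
  + by move=> n; exact: sI.
  + exact: ind_integrable.
  + move=> n x; rewrite /ind -rmorphB sqmod_real !indicE !in_setI.
    case: (x \in W); last by rewrite !andbF subrr expr0n.
    by rewrite !andbT; case: (x \in Q n); case: (x \in \bigcup_k F k);
      rewrite /= ?subrr ?subr0 ?sub0r ?sqrrN ?expr1n ?expr0n.
  + move=> x; apply: cvg_eventually0.
    have [[k _ Fk]|nU] := pselect ((\bigcup_k F k) x).
      exists k.+1 => n kn; rewrite /ind !indicE !in_setI mem_set; last first.
        by rewrite /Q -bigcup_mkord; exists k.
      rewrite [x \in \bigcup_k F k]mem_set; last by exists k.
      by rewrite -rmorphB sqmod_real subrr expr0n.
    exists 0%N => n _; rewrite /ind !indicE !in_setI memNset; last by move/QU.
    by rewrite [x \in \bigcup_k F k]memNset// -rmorphB sqmod_real subrr expr0n.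
  by exists (toL2 m (ind (Q n `&` W))).
Qed.

(** Simple functions cut down to the sets of a finite exhaustion increase to
    $f$. *)
Let Dpos (f : X -> R) : measurable_fun setT (f : borel X -> R) -> (forall x, 0 <= f x) ->
  square_integrable m (fun x => (f x)%:C%C) -> D (toL2 m (fun x => (f x)%:C%C)).
Proof.
move=> mf f0 sf; apply: Dlim => e e0.
have [W [oW mW covW fW]] := finite_exhaustion R Xhaus Xlc Xsc.
have mfE : measurable_fun setT (EFin \o (f : borel X -> R)) by exact/measurable_EFinP.
pose s n : {nnsfun borel X >-> R} := nnsfun_approx measurableT mfE n.
pose t n x := s n x * \1_(W n) x.
have t0 n x : 0 <= t n x by rewrite mulr_ge0.
have cs x : (fun n => s n x) @ \oo --> f x.
  have f0E y : [set: borel X] y -> (0 <= (EFin \o f) y)%E by rewrite /= lee_fin.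
  have := @cvg_nnsfun_approx _ (borel X) R setT measurableT _ mfE f0E x Logic.I.
  by move=> /fine_cvgP[_].
have st n x : s n x <= f x.
  rewrite -(cvg_lim (@Rhausdorff R) (cs x)).
  apply: (@nondecreasing_cvgn_le _ (fun n => s n x)); last by apply/cvg_ex; exists (f x).
  by move=> k l kl; exact/lefP/nd_nnsfun_approx.
have tf n x : t n x <= f x.
  apply: le_trans (st n x); rewrite /t indicE.
  by case: (x \in W n); rewrite ?mulr1// mulr0.
have mt n : cmeasurable (fun x => (t n x)%:C%C : R[i]).
  apply: cmeasurable_real; apply: measurable_funM => //.
  by apply: measurable_indic; exact: borel_open.
have sq2 n x : sqmod ((t n x)%:C%C - (f x)%:C%C : R[i]) <= sqmod ((f x)%:C%C : R[i]).
  rewrite -rmorphB !sqmod_real; have := tf n x; have := t0 n x; have := f0 x; nra.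
have sti n : square_integrable m (fun x => (t n x)%:C%C).
  have fin : (\int[m]_x (sqmod ((f x)%:C%C : R[i]))%:E < +oo)%E by case: sf.
  split=> //; apply: le_lt_trans fin; apply: ge0_le_integral => //.
  - by move=> x _; exact: sqmod_ge0E.
  - exact: measurable_sqmod.
  - by apply: measurable_sqmod; case: sf.
  - move=> x _; rewrite lee_fin !sqmod_real.
    by have := tf n x; have := t0 n x; nra.
have [|||n hn] := @toL2_dominated _ _ _ m (fun n x => (t n x)%:C%C)
  (fun x => (f x)%:C%C) (fun x => sqmod ((f x)%:C%C : R[i])) sti sf _ _ _ e e0.
- exact: integrable_sqmod sf.
- exact: sq2.
- move=> x.
  have -> : (fun n => sqmod ((t n x)%:C%C - (f x)%:C%C : R[i])) =
      (fun n => (t n x - f x) * (t n x - f x)).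
    by apply/funext => n; rewrite -rmorphB sqmod_real expr2.
  rewrite -(mulr0 0) -(subrr (f x)).
  have ct : (fun n => t n x) @ \oo --> f x.
    apply: (cvg_trans _ (cs x)); apply: near_eq_cvg.
    have [N hN] := covW x; exists N => // n /= /hN Wx.
    by rewrite /t indicE mem_set// mulr1.
  by apply: cvgM; apply: cvgB => //; exact: cvg_cst.
exists (toL2 m (fun x => (t n x)%:C%C)); split=> //.
have -> : (fun x => (t n x)%:C%C) =
    (fun x => \sum_(y <- fset_set (range (s n))) y%:C%C * ind (s n @^-1` [set y] `&` W n) x).
  apply/funext => x; rewrite /t fimfunE fsbig_finite//= mulr_suml rmorph_sum.
  by apply: eq_bigr => y _; rewrite /ind indicI -mulrA rmorphM.
elim: (finmap.enum_fset _) => [|y r IH].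
  under eq_fun do rewrite big_nil.
  move=> d d0; exists 0; split; first exact: Cc0.
  by rewrite subrr nrm0 ltW.
under eq_fun do rewrite big_cons.
have mSW : measurable (s n @^-1` [set y] `&` W n : set (borel X)).
  by apply: measurableI; [exact: measurable_sfunP|exact: borel_open].
have fSW : (m (s n @^-1` [set y] `&` W n) < +oo)%E.
  apply: le_lt_trans (fW m n mfin); apply: le_measure; last exact: subIsetr.
  - exact: mem_set.
  - by apply: mem_set; exact: borel_open.
have sIn A : measurable (A : set (borel X)) -> square_integrable m (ind (A `&` W n)).
  move=> mA; apply: ind_square_integrable; first by apply: measurableI => //; exact: borel_open.
  apply: le_lt_trans (fW m n mfin); apply: le_measure; last exact: subIsetr.
  - by apply: mem_set; apply: measurableI => //; exact: borel_open.
  - by apply: mem_set; exact: borel_open.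
have sr : square_integrable m
    (fun x => \sum_(j <- r) j%:C%C * ind (s n @^-1` [set j] `&` W n) x).
  elim: (r) => [|z r' IHr].
    by under eq_fun do rewrite big_nil; exact: square_integrable0.
  under eq_fun do rewrite big_cons.
  have mz : measurable (s n @^-1` [set z] : set (borel X)) by exact: measurable_sfunP.
  exact: (square_integrable_lin z%:C%C (sIn _ mz) IHr).
rewrite toL2_lin//; last by apply: sIn; exact: measurable_sfunP.
have mSy : measurable (s n @^-1` [set y] : set (borel X)) by exact: measurable_sfunP.
exact: (Dlin _ (Dborel (oW n) (fW m n mfin) mSy) IH).
Qed.

Lemma Cc_dense (F : L2 m) (e : R) : 0 < e ->
  exists g, Cc g /\ nrm (F - toL2 m g) <= e.
Proof.
suff : D F by apply.
have sF := @L2_square_integrable _ _ _ _ F; have [[mR mI] finF] := sF.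
pose pos (h : X -> R) x := Num.max (h x) 0.
have pos0 h x : 0 <= pos h x by rewrite le_max lexx orbT.
have mpos (h : X -> R) : measurable_fun setT (h : borel X -> R) ->
    measurable_fun setT (pos h : borel X -> R).
  by move=> mh; apply: measurable_maxr => //; exact: measurable_cst.
have spos (h : X -> R) : measurable_fun setT (h : borel X -> R) ->
    (forall x, h x ^+ 2 <= sqmod (F x)) -> square_integrable m (fun x => (pos h x)%:C%C).
  move=> mh hF; split; first by apply: cmeasurable_real; exact: mpos.
  apply: le_lt_trans finF; apply: ge0_le_integral => //.
  - by move=> x _; exact: sqmod_ge0E.
  - by apply: measurable_sqmod; apply: cmeasurable_real; exact: mpos.
  - exact: measurable_sqmod.
  move=> x _; rewrite lee_fin sqmod_real; apply: le_trans (hF x).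
  by rewrite /pos /Num.max; case: ifP => // _; rewrite expr0n sqr_ge0.
have Dp (h : X -> R) : measurable_fun setT (h : borel X -> R) ->
    (forall x, h x ^+ 2 <= sqmod (F x)) -> D (toL2 m (fun x => (pos h x)%:C%C)).
  by move=> mh hF; apply: Dpos; [exact: mpos|exact: pos0|exact: spos].
have neg (h : X -> R) x : pos h x - pos (fun y => - h y) x = h x.
  by rewrite /pos /Num.max oppr_lt0 ltNge; case: ltrgt0P => //= h0; lra.
have Dreal (h : X -> R) : measurable_fun setT (h : borel X -> R) ->
    (forall x, h x ^+ 2 <= sqmod (F x)) ->
    square_integrable m (fun x => (h x)%:C%C) /\ D (toL2 m (fun x => (h x)%:C%C)).
  move=> mh hF.
  have mNh : measurable_fun setT ((fun y => - h y) : borel X -> R) by apply: measurableT_comp mh; exact: oppr_measurable.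
  have hNF x : (- h x) ^+ 2 <= sqmod (F x) by rewrite sqrrN.
  have -> : (fun x => (h x)%:C%C) =
      (fun x => -1 * (pos (fun y => - h y) x)%:C%C + (pos h x)%:C%C).
    by apply/funext => x; rewrite mulN1r addrC -rmorphB neg.
  split; first exact: (square_integrable_lin (-1) (spos _ mNh hNF) (spos _ mh hF)).
  by rewrite toL2_lin; [exact: (Dlin (-1) (Dp _ mNh hNF) (Dp _ mh hF))|exact: spos|
    exact: spos].
have [|sR DR] := Dreal (Re \o F) mR.
  by move=> x; rewrite /sqmod /= lerDl sqr_ge0.
have [|sI DI] := Dreal (Im \o F) mI.
  by move=> x; rewrite /sqmod /= lerDr sqr_ge0.
have <- : toL2 m (fun x => 'i%C * (Im (F x))%:C%C + (Re (F x))%:C%C) = F.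
  rewrite -[RHS]toL2_repr; congr (toL2 m _); apply/funext => x.
  by rewrite [RHS]complexE addrC mulrC.
rewrite (toL2_lin _ sI sR); exact: (Dlin _ DI DR).
Qed.

End Density.

(** * Operators given pointwise, and tests on nonnegative functions *)

Section PointwiseOperators.
Context d d' (T : measurableType d) (T' : measurableType d') (R : realType).
Variables (m : {measure set T -> \bar R}) (m' : {measure set T' -> \bar R}).
Variables (L : (T -> R[i]) -> T' -> R[i]) (M : R).
Hypothesis M0 : 0 <= M.
Hypothesis Llin : forall (a : R[i]) f g,
  L (fun x => a * f x + g x) = (fun y => a * L f y + L g y).
Hypothesis Lmeas : forall f, cmeasurable f -> cmeasurable (L f).
Hypothesis Lbound : forall f, cmeasurable f ->
  (sqint m' (L f) <= (M ^+ 2)%:E * sqint m f)%E.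

Lemma pointwise_square_integrable f :
  square_integrable m f -> square_integrable m' (L f).
Proof.
move=> [mf ff]; split; first exact: Lmeas.
apply: le_lt_trans (Lbound mf) _; apply: lte_mul_pinfty => //.
by rewrite lee_fin sqr_ge0.
Qed.

Lemma sqint0_ae f : square_integrable m' f -> (sqint m' f <= 0)%E -> ae_zero m' f.
Proof.
move=> sf h; apply: ae_zero_sqmod => //.
have h0 : sqint m' f = 0%E.
  by apply/eqP; rewrite eq_le h; apply: integral_ge0 => x _; exact: sqmod_ge0E.
by rewrite /Rintegral -/(sqint m' f) h0.
Qed.

(** The norm bound makes $L$ compatible with equality almost everywhere, so that
    it descends to classes. *)
Lemma pointwise_ae f g : square_integrable m f -> square_integrable m g ->
  {ae m, forall x, f x = g x} -> toL2 m' (L f) = toL2 m' (L g).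
Proof.
move=> sf sg fg.
have sd : square_integrable m (fun x => -1 * g x + f x).
  exact: (square_integrable_lin (-1) sg sf).
apply: toL2_ext; [exact: pointwise_square_integrable..|].
have : ae_zero m' (L (fun x => -1 * g x + f x)).
  apply: sqint0_ae; first exact: pointwise_square_integrable.
  apply: le_trans (Lbound (proj1 sd)) _.
  have -> : sqint m (fun x => (-1 * g x + f x)%R) = 0%E; last by rewrite mule0.
  rewrite (@sqint_eq_ae _ _ _ m _ (fun=> 0)).
  - rewrite /sqint; under eq_integral do rewrite (sqmod_real 0) expr0n.
    by rewrite integral0.
  - by case: sd.
  - by split; exact: measurable_cst.
  - by apply: filterS fg => x ->; rewrite mulN1r addNr.
rewrite Llin; apply: filterS => y /eqP.
by rewrite mulN1r addrC subr_eq0 => /eqP.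
Qed.

Definition pointwise_op (F : L2 m) : L2 m' := toL2 m' (L F).

Lemma pointwise_opE f : square_integrable m f ->
  pointwise_op (toL2 m f) = toL2 m' (L f).
Proof.
move=> sf; apply: pointwise_ae => //; first exact: L2_square_integrable.
exact: toL2E.
Qed.

Lemma pointwise_op_linear : linear pointwise_op.
Proof.
move=> a F G.
have sF := @L2_square_integrable _ _ _ _ F; have sG := @L2_square_integrable _ _ _ _ G.
rewrite -[F in LHS]toL2_repr -[G in LHS]toL2_repr -toL2_lin// pointwise_opE.
  by rewrite Llin toL2_lin//; exact: pointwise_square_integrable.
exact: (square_integrable_lin a sF sG).
Qed.

Lemma pointwise_op_bound : bounded_by pointwise_op M.
Proof.
move=> F; have sF := @L2_square_integrable _ _ _ _ F.
apply: toL2_nrm_le; [by apply: Lmeas; case: sF| |].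
  by rewrite mulr_ge0 ?nrm_ge0.
apply: le_trans (Lbound (proj1 sF)) _.
by rewrite -L2_nrm_sqr -EFinM exprMn.
Qed.

Lemma pointwise_op_bounded_linear : bounded_linear pointwise_op.
Proof. exact: bounded_linearI pointwise_op_linear pointwise_op_bound. Qed.

End PointwiseOperators.

Section CcNonnegative.
Context (R : realType) (X : ptopologicalType).
Hypothesis Xhaus : hausdorff_space X.

(** Positive and negative parts reduce linear identities to nonnegative
    functions. *)
Lemma Cc_nonneg_ind (P : (X -> R[i]) -> Prop) :
  (forall (a : R[i]) f g, Cc f -> Cc g -> P f -> P g ->
     P (fun x => a * f x + g x)) ->
  (forall h : X -> R, continuous h -> csupported h -> (forall x, 0 <= h x) ->
     P (fun x => (h x)%:C%C)) ->
  forall f, Cc f -> P f.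
Proof.
move=> Plin Ppos f /(CcP Xhaus)[/continuous_complexP[cR cI] [C cC hC]].
pose pos (h : X -> R) x := Num.max (h x) 0.
have pos0 h x : 0 <= pos h x by rewrite le_max lexx orbT.
have cpos (h : X -> R) : continuous h -> continuous (pos h).
  move=> ch x; apply: (@continuous_max _ _ h (cst 0)); first exact: ch.
  exact: cvg_cst.
have spos (h : X -> R) : (forall x, h x != 0 -> C x) -> csupported (pos h).
  move=> hh; exists C => // x; rewrite /pos; apply: contra_neqP => nC.
  have -> : h x = 0 by apply/eqP; apply: contra_notT nC => /hh.
  by rewrite max_l.
have neg (h : X -> R) x : pos h x - pos (fun y => - h y) x = h x.
  by rewrite /pos /Num.max oppr_lt0 ltNge; case: ltrgt0P => //= h0; lra.
have Preal (h : X -> R) : continuous h -> (forall x, h x != 0 -> C x) ->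
    Cc (fun x => (h x)%:C%C) /\ P (fun x => (h x)%:C%C).
  move=> ch hh.
  have cN : continuous (fun y => - h y) by move=> y; apply: cvgN; exact: ch.
  have hN x : - h x != 0 -> C x by rewrite oppr_eq0; exact: hh.
  have C1 := Cc_real Xhaus (cpos _ ch) (spos _ hh).
  have C2 := Cc_real Xhaus (cpos _ cN) (spos _ hN).
  split; first by apply: Cc_real => //; exists C.
  have -> : (fun x => (h x)%:C%C) =
      (fun x => -1 * (pos (fun y => - h y) x)%:C%C + (pos h x)%:C%C).
    by apply/funext => x; rewrite mulN1r addrC -rmorphB neg.
  by apply: Plin => //; apply: Ppos => //; [exact: cpos|exact: spos|exact: cpos|
    exact: spos].
have [|CR PR] := Preal (Re \o f) cR.
  by move=> x /= fx; apply: hC; apply: contra_neq fx => ->.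
have [|CI PI] := Preal (Im \o f) cI.
  by move=> x /= fx; apply: hC; apply: contra_neq fx => ->.
have -> : f = (fun x => 'i%C * (Im (f x))%:C%C + (Re (f x))%:C%C).
  by apply/funext => x; rewrite [LHS]complexE addrC mulrC.
exact: Plin.
Qed.

End CcNonnegative.

Section KernelBound.
Context d (T : measurableType d) (R : realType) (m : {measure set T -> \bar R}).

Lemma Re_cintegral (f : T -> R[i]) :
  Re (cintegral m setT f) = \int[m]_x Re (f x).
Proof. by []. Qed.

Lemma cintegral_sum (I : Type) (s : seq I) (f : I -> T -> R[i]) :
  (forall i, cintegrable m (f i)) ->
  cintegrable m (fun x => \sum_(i <- s) f i x) /\
  cintegral m setT (fun x => \sum_(i <- s) f i x) =
  \sum_(i <- s) cintegral m setT (f i).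
Proof.
move=> fi; elim: s => [|i s [IH1 IH2]].
  rewrite big_nil; under eq_fun do rewrite big_nil; split.
    by split; exact: integrable0.
  rewrite (@cintegralE _ _ _ _ _ (fun=> 0) (fun=> 0)) => [|x //].
  by rewrite Rintegral_cst// mul0r.
rewrite big_cons; under eq_fun do rewrite big_cons; split.
  have [a1 a2] := fi i; have [b1 b2] := IH1.
  split.
    have := integrableD measurableT a1 b1; congr integrable.
    by apply/funext => x /=; rewrite ReD.
  have := integrableD measurableT a2 b2; congr integrable.
  by apply/funext => x /=; case: (f i x) (\sum_(_ <- _) _) => ? ? [].
by rewrite cintegralD// IH2.
Qed.

(** Cauchy-Schwarz for a sum of inner products whose total integrand is
    dominated by a product. *)
Lemma dot_sum_le (I : Type) (s : seq I) (f g : I -> T -> R[i]) (P Q : T -> R) (e : R) :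
  0 <= e -> (forall x, 0 <= P x) -> (forall x, 0 <= Q x) ->
  (forall i, square_integrable m (f i)) -> (forall i, square_integrable m (g i)) ->
  square_integrable m (fun x => (P x)%:C%C) ->
  square_integrable m (fun x => (Q x)%:C%C) ->
  {ae m, forall x, `|Re (\sum_(i <- s) (f i x)^*%C * g i x)| <= e * (P x * Q x)} ->
  Re (\sum_(i <- s) dot (toL2 m (f i)) (toL2 m (g i))) <=
  e * (nrm (toL2 m (fun x => (P x)%:C%C)) * nrm (toL2 m (fun x => (Q x)%:C%C))).
Proof.
move=> e0 P0 Q0 sf sg sP sQ h.
under eq_bigr do rewrite dot_toL2//.
have fgi i : cintegrable m (fun x => (f i x)^*%C * g i x) by exact: cintegrable_conjM.
have [[iR _] <-] := cintegral_sum s fgi.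
have [iPQ _] := cintegrable_conjM sP sQ.
apply: (@le_trans _ _ (e * Re (dot (toL2 m (fun x => (P x)%:C%C)) (toL2 m (fun x => (Q x)%:C%C))))).
  rewrite dot_toL2// !Re_cintegral -RintegralZl//.
  have PQE x : Re ((P x)%:C%C^*%C * (Q x)%:C%C : R[i]) = P x * Q x.
    by rewrite /= oppr0 mul0r subr0.
  have iePQ := integrableZl measurableT e iPQ.
  apply: fine_le; [exact: integrable_fin_num|exact: integrable_fin_num|].
  have /integrableP[mS _] := iR; have /integrableP[mQ _] := iePQ.
  apply: le_trans (lee_abs _) _; apply: le_trans (le_abse_integral _ _ _) _ => //.
  apply: ae_ge0_le_integral => //.
  - exact: measurableT_comp.
  - move=> x _; rewrite lee_fin mulr_ge0//.
    by rewrite [X in 0 <= X](PQE x : _ = _) mulr_ge0.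
  - by apply: filterS h => x + _; rewrite -lee_fin -(PQE x).
by rewrite ler_wpM2l//; apply: le_trans (ler_norm _) _; exact: Re_dot_le.
Qed.

End KernelBound.

Section Unitary.
Context (R : realType) (U V : innerProductType R) (A : U -> V).
Hypothesis uA : unitary A.

Lemma unitary_nrm x : nrm (A x) = nrm x.
Proof.
have [_ dA _] := uA.
by apply/eqP; rewrite -(@eqrXn2 _ 2)// ?nrm_ge0// -!Re_dotxx dA.
Qed.

Lemma unitary_inj x y : A x = A y -> x = y.
Proof.
have [lA _ _] := uA; move=> /eqP; rewrite -subr_eq0 -(linear_sub lA) => /eqP h.
apply/eqP; rewrite -subr_eq0; apply/eqP/nrm_eq0.
by rewrite -unitary_nrm h nrm0.
Qed.

Lemma unitary_inverse : exists B : V -> U,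
  [/\ linear B, forall y, nrm (B y) = nrm y & forall y, A (B y) = y].
Proof.
have [lA dA rA] := uA.
have /choice[B hB] y : exists x, A x = y.
  have : range A y by rewrite rA.
  by move=> [x _ <-]; exists x.
exists B; split=> //; last by move=> y; rewrite -unitary_nrm hB.
by move=> a x y; apply: unitary_inj; rewrite lA !hB.
Qed.

End Unitary.

(** * Locally compact groupoids *)

Section MoreBorel.
Context (R : realType) (X : ptopologicalType).
Hypothesis Xhaus : hausdorff_space X.
Hypothesis Xlc : locally_compact [set: X].
Hypothesis Xsc : @second_countable X.

Lemma Cc_cintegrable (m : {measure set borel X -> \bar R}) (f : X -> R[i]) :
  compactly_finite m -> Cc f -> cintegrable m f.
Proof.
move=> mfin Cf; have /(CcP Xhaus)[cf [C cC hC]] := Cf.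
have [k [ck sk _ kC _]] := compact_cutoff R Xhaus Xlc cC openT (@subsetT _ _).
have := cintegrable_conjM (Cc_square_integrable Xhaus mfin (Cc_real Xhaus ck sk))
  (Cc_square_integrable Xhaus mfin Cf).
congr cintegrable; apply/funext => x.
have [->|/hC Cx] := eqVneq (f x) 0; first by rewrite mulr0.
by rewrite kC// conjc_real mul1r.
Qed.

(** Second countability makes the product $\sigma$-algebra contain all open sets
    of the product. *)
Lemma open_prod_measurable (U : set (X * X)) : open U ->
  measurable (U : set (borel X * borel X)).
Proof.
move=> oU; have [e [oe be]] := countable_base Xsc.
have -> : U = \bigcup_i \bigcup_(j in [set j | e i `*` e j `<=` U]) (e i `*` e j).
  apply/seteqP; split=> [[x y] Uxy|[x y] [i _ [j ij xy]]]; last exact: ij.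
  have : nbhs (x, y) U by exact: open_nbhs_nbhs.
  case=> -[A B] /= [nA nB] AB.
  have [i [ix iA]] := be _ x (@open_interior _ A) nA.
  have [j [jy jB]] := be _ y (@open_interior _ B) nB.
  exists i => //; exists j => //=.
  by move=> [a b] [/= ea eb]; apply: AB; split=> /=; apply: interior_subset;
    [exact: iA|exact: jB].
apply: bigcup_measurable => i _; apply: bigcup_measurable => j _.
by apply: measurableX; exact: borel_open.
Qed.

(** Maps that are continuous on a closed set only, such as the multiplication,
    are made Borel everywhere by extending them arbitrarily. *)
Lemma within_preimage_open (Y Z : topologicalType) (F : set Y) (m : Y -> Z)
    (O : set Z) : open O ->
  (forall y, F y -> m @ within F (nbhs y) --> m y) ->
  exists2 U : set Y, open U & F `&` m @^-1` O = F `&` U.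
Proof.
move=> oO cm; exists ([set y | F y -> O (m y)]°); first exact: open_interior.
apply/seteqP; split=> y [Fy h]; split=> //.
  have : nbhs (m y) O by exact: open_nbhs_nbhs.
  by move/(cm y Fy).
by have := interior_subset h; apply.
Qed.

End MoreBorel.

Section Groupoid.
Context (G0 G : ptopologicalType) (g : groupoid G0 G).
Hypothesis Gtop : topological_groupoid g.
Hypothesis Ghaus : hausdorff_space G.

Let cr : continuous (grng g). Proof. by case: Gtop. Qed.
Let cs : continuous (gsrc g). Proof. by case: Gtop. Qed.
Let cinv : continuous (ginv g). Proof. by case: Gtop. Qed.

Lemma ginvK x : ginv g (ginv g x) = x.
Proof.
have h1 : gsrc g (ginv g (ginv g x)) = grng g (ginv g x) by rewrite gsrc_inv.
rewrite -[LHS](gmul1r g) gsrc_inv grng_inv -(gmulVl g x).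
rewrite gmulA ?gsrc_inv ?grng_inv// gmulVl gsrc_inv.
by rewrite gmul1l.
Qed.

Lemma gmulKV x y : grng g x = grng g y -> gmul g x (gmul g (ginv g x) y) = y.
Proof.
move=> xy; rewrite gmulA ?gsrc_inv ?grng_inv//.
by rewrite gmulVr xy gmul1l.
Qed.

Lemma gmulK x y : gsrc g x = grng g y -> gmul g (ginv g x) (gmul g x y) = y.
Proof.
move=> xy; rewrite gmulA ?gsrc_inv ?grng_inv//.
by rewrite gmulVl xy gmul1l.
Qed.

(** The unit space embeds into the groupoid. *)
Lemma unit_space_hausdorff : hausdorff_space G0.
Proof.
move=> u v uv; have [_ _ cu _ _] := Gtop.
suff : gunit g u = gunit g v.
  by move=> /(congr1 (grng g)); rewrite !grng_unit.
apply: Ghaus => A B nA nB.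
have [w [Aw Bw]] := uv _ _ (cu u A nA) (cu v B nB).
by exists (gunit g w).
Qed.

Let G0haus := unit_space_hausdorff.

Definition Gsr : set (G * G) := [set p | gsrc g p.1 = grng g p.2].
Definition Grr : set (G * G) := [set p | grng g p.1 = grng g p.2].

Lemma closed_eq_locus (Y : topologicalType) (f h : Y -> G0) :
  continuous f -> continuous h -> closed [set y | f y = h y].
Proof.
move=> cf ch y hy; apply: G0haus => A B nA nB.
have n : nbhs y (f @^-1` A `&` h @^-1` B).
  by apply: filterI; [exact: cf|exact: ch].
have [z [/= fhz [Az Bz]]] := hy _ n.
by exists (f z); split=> //; rewrite fhz.
Qed.

Lemma closed_Gsr : closed Gsr.
Proof.
apply: (@closed_eq_locus _ (fun p : G * G => gsrc g p.1) (fun p => grng g p.2)).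
- by move=> p; apply: continuous_comp; [exact: cvg_fst|exact: cs].
- by move=> p; apply: continuous_comp; [exact: cvg_snd|exact: cr].
Qed.

Lemma closed_Grr : closed Grr.
Proof.
apply: (@closed_eq_locus _ (fun p : G * G => grng g p.1) (fun p => grng g p.2)).
- by move=> p; apply: continuous_comp; [exact: cvg_fst|exact: cr].
- by move=> p; apply: continuous_comp; [exact: cvg_snd|exact: cr].
Qed.

Lemma closed_fiber u : closed (grfib g u).
Proof. by apply: closed_eq_locus => // x; exact: cvg_cst. Qed.

Lemma gmul_cvg p : Gsr p ->
  (fun q : G * G => gmul g q.1 q.2) @ within Gsr (nbhs p) --> gmul g p.1 p.2.
Proof. by have [_ _ _ _ /subspace_continuousP] := Gtop; apply. Qed.

Lemma shear_cvg p : Grr p -> (fun q : G * G => gmul g (ginv g q.1) q.2) @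
  within Grr (nbhs p) --> gmul g (ginv g p.1) p.2.
Proof.
move=> rp.
have Sp : Gsr (ginv g p.1, p.2) by rewrite /Gsr /= gsrc_inv.
apply: (@cvg_comp _ _ _ (fun q : G * G => (ginv g q.1, q.2))
  (fun q => gmul g q.1 q.2) _ _ _ _ (gmul_cvg Sp)) => A.
rewrite /= !nbhs_simpl /within /= => nA.
have c : (fun q : G * G => (ginv g q.1, q.2)) @ nbhs p --> nbhs (ginv g p.1, p.2).
  have h : continuous (fun q : G * G => ginv g q.1).
    by move=> q; apply: continuous_comp; [exact: cvg_fst|exact: cinv].
  by apply: cvg_pair; [exact: h|exact: cvg_snd].
have n : nbhs p ((fun q : G * G => (ginv g q.1, q.2)) @^-1` [set z | Gsr z -> A z]).
  exact: (c _ nA).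
suff : nbhs p [set q : G * G | Grr q -> A (ginv g q.1, q.2)] by [].
by move: n; apply: filterS => q h rq; apply: h; rewrite /Gsr /= gsrc_inv.
Qed.

Lemma translate_cvg x y : gsrc g x = grng g y ->
  gmul g x @ within (grfib g (gsrc g x)) (nbhs y) --> gmul g x y.
Proof.
move=> xy; apply: (@cvg_comp _ _ _ (fun q : G => (x, q))
  (fun q => gmul g q.1 q.2) _ _ _ _ (gmul_cvg (xy : Gsr (x, y)))) => A.
rewrite /= !nbhs_simpl /within /= => nA.
have c : (fun q : G => (x, q)) @ nbhs y --> nbhs (x, y).
  by apply: cvg_pair; [exact: cvg_cst|exact: cvg_id].
have n : nbhs y ((fun q : G => (x, q)) @^-1` [set z | Gsr z -> A z]).
  exact: (c _ nA).
suff : nbhs y [set q : G | grfib g (gsrc g x) q -> A (x, q)] by [].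
by move: n; apply: filterS => q h rq; apply: h; rewrite /Gsr /= rq.
Qed.

Lemma within_compact_image (Y Z : topologicalType) (F : set Y) (m : Y -> Z)
    (K : set Y) : closed F -> compact K ->
  (forall y, F y -> m @ within F (nbhs y) --> m y) ->
  compact (m @` (K `&` F)).
Proof.
move=> clF cK cm; apply: continuous_compact.
  by apply: (@continuous_subspaceW _ _ _ F); [exact: subIsetr|exact/subspace_continuousP].
exact: compact_closedI.
Qed.

Lemma ginv_compact (K : set G) : compact K -> compact (ginv g @^-1` K).
Proof.
move=> cK; have -> : ginv g @^-1` K = ginv g @` K.
  apply/seteqP; split=> x /=; first by move=> Kx; exists (ginv g x) => //; rewrite ginvK.
  by move=> [y Ky <-]; rewrite ginvK.
by apply: continuous_compact => //; exact: continuous_subspaceT.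
Qed.

Lemma Cc_ginv (R : realType) (f : G -> R[i]) : Cc f -> Cc (fun x => f (ginv g x)).
Proof.
move=> /(CcP Ghaus)[cf [C cC hC]]; apply/(CcP Ghaus); split.
  by move=> x; apply: continuous_comp; [exact: cinv|exact: cf].
by exists (ginv g @^-1` C); [exact: ginv_compact|move=> x /hC].
Qed.

(** Products of compact sets, along composable pairs, are compact. *)
Lemma shear_supports (K L : set G) : compact K -> compact L ->
  (exists2 M : set G, compact M & forall x y, grng g x = grng g y -> K x ->
     L (gmul g (ginv g x) y) -> M y) /\
  (exists2 M : set G, compact M & forall x z, gsrc g x = grng g z -> K x ->
     L (gmul g x z) -> M z).
Proof.
move=> cK cL; split.
  exists ((fun q : G * G => gmul g q.1 q.2) @` ((K `*` L) `&` Gsr)).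
    apply: (@within_compact_image (G * G)%type G Gsr
      (fun q : G * G => gmul g q.1 q.2)).
    - exact: closed_Gsr.
    - exact: compact_setX.
    - exact: gmul_cvg.
  move=> x y xy Kx Ly; exists (x, gmul g (ginv g x) y); last exact: gmulKV.
  by split=> //; rewrite /Gsr /= grng_mul ?gsrc_inv// grng_inv.
exists ((fun q : G * G => gmul g (ginv g q.1) q.2) @` ((K `*` L) `&` Grr)).
  apply: (@within_compact_image (G * G)%type G Grr
    (fun q : G * G => gmul g (ginv g q.1) q.2)).
  - exact: closed_Grr.
  - exact: compact_setX.
  - exact: shear_cvg.
move=> x z xz Kx Lz; exists (x, gmul g x z); last exact: gmulK.
by split=> //; rewrite /Grr /= grng_mul.
Qed.

End Groupoid.

(** * Image measures, densities and almost everywhere statements *)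

Section ImageMeasure.
Context d d' (T : measurableType d) (T' : measurableType d') (R : realType).
Variables (m : {measure set T -> \bar R}) (f : T -> T').
Hypothesis mf : measurable_fun setT f.

(** The image measure, packed with the measurability of the map. *)
Definition image_measure & measurable_fun setT f : set T' -> \bar R :=
  pushforward m f.

Let im := image_measure mf.

Let im0 : im set0 = 0%E.
Proof. by rewrite /im /image_measure /pushforward preimage_set0 measure0. Qed.

Let im_ge0 A : (0 <= im A)%E.
Proof. exact: measure_ge0. Qed.

Let im_additive : semi_sigma_additive im.
Proof.
have mpre A : measurable A -> measurable (f @^-1` A).
  by move=> mA; rewrite -[X in measurable X]setTI; exact: mf.
move=> F mF tF mUF; rewrite /im /image_measure /pushforward preimage_bigcup.
apply: measure_semi_sigma_additive.
- by move=> n; exact: mpre.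
- apply/trivIsetP => /= i j _ _ ij; rewrite -preimage_setI.
  by move/trivIsetP : tF => /(_ _ _ _ _ ij) ->//; rewrite preimage_set0.
- by rewrite -preimage_bigcup; exact: mpre.
Qed.

HB.instance Definition _ := isMeasure.Build _ _ _ im im0 im_ge0 im_additive.

Definition image_meas : {measure set T' -> \bar R} := im.

Lemma integral_image_meas (h : T' -> \bar R) : measurable_fun setT h ->
  (forall y, 0 <= h y)%E ->
  (\int[image_meas]_y h y = \int[m]_x h (f x))%E.
Proof.
by move=> mh h0; rewrite [LHS](@ge0_integral_pushforward _ _ _ _ _ _ mf).
Qed.

End ImageMeasure.

Section IntegralDensity.
Context d (T : measurableType d) (R : realType).
Variables (n1 n2 : {measure set T -> \bar R}) (D : T -> R).
Hypothesis mD : measurable_fun setT D.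
Hypothesis D0 : forall x, 0 <= D x.
Hypothesis n12 : forall A, measurable A -> (n1 A = \int[n2]_(x in A) (D x)%:E)%E.

Lemma integral_density (f : T -> R) : measurable_fun setT f -> (forall x, 0 <= f x) ->
  (\int[n1]_x (f x)%:E = \int[n2]_x (f x * D x)%:E)%E.
Proof.
move=> mf f0.
have key (s : {nnsfun T >-> R}) :
    (\int[n1]_x (s x)%:E = \int[n2]_x (s x * D x)%:E)%E.
  rewrite integralT_nnsfun sintegralE fsbig_finite//=.
  have mA y : measurable (s @^-1` [set y]) by exact: measurable_sfunP.
  transitivity (\int[n2]_x
      (\sum_(y <- fset_set (range s)) (y * \1_(s @^-1` [set y]) x * D x)%:E))%E; last first.
    by apply: eq_integral => x _; rewrite fimfunE fsbig_finite//= mulr_suml sumEFin.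
  have pos y x : 0 <= y * \1_(s @^-1` [set y]) x * D x.
    rewrite mulr_ge0// indicE; have [/set_mem /= <-|_] := boolP (x \in _).
      by rewrite mulr1.
    by rewrite mulr0.
  have mpos y : measurable_fun setT (fun x => (y * \1_(s @^-1` [set y]) x * D x)%:E).
    apply/measurable_EFinP; apply: measurable_funM => //.
    by apply: measurable_funM => //; exact: measurable_indic.
  rewrite ge0_integral_sum//; last by move=> y x _; rewrite lee_fin.
  rewrite big_seq [RHS]big_seq; apply: eq_bigr => y.
  rewrite in_fset_set//= => /set_mem[x0 _ sx0].
  have y0 : 0 <= y by rewrite -sx0.
  transitivity (y%:E * \int[n2]_x (\1_(s @^-1` [set y]) x * D x)%:E)%E; last first.
    rewrite -ge0_integralZl_EFin//.
    - by apply: eq_integral => x _; rewrite -EFinM mulrA.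
    - by move=> x _; rewrite lee_fin mulr_ge0.
    - by apply/measurable_EFinP; apply: measurable_funM => //; exact: measurable_indic.
  rewrite n12//; congr (_ * _)%E; rewrite integral_mkcond; apply: eq_integral => x _.
  by rewrite patchE indicE; case: ifP => _; rewrite ?mul1r ?mul0r.
have mfE : measurable_fun setT (EFin \o f) by exact/measurable_EFinP.
pose s n : {nnsfun T >-> R} := nnsfun_approx measurableT mfE n.
have f0E y : [set: T] y -> (0 <= (EFin \o f) y)%E by rewrite /= lee_fin.
have sf x : (fun n => (s n x)%:E) @ \oo --> (f x)%:E.
  exact: (@cvg_nnsfun_approx _ T R setT measurableT _ mfE f0E x Logic.I).
have nd x n k : (n <= k)%N -> s n x <= s k x.
  by move=> nk; have /lefP := nd_nnsfun_approx measurableT mfE nk; apply.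
have c1 : (\int[n1]_x (s n x)%:E)%E @[n --> \oo] --> (\int[n1]_x (f x)%:E)%E.
  have -> : (\int[n1]_x (f x)%:E = \int[n1]_x limn (fun n => (s n x)%:E))%E.
    by apply: eq_integral => x _; apply/esym/cvg_lim.
  apply: (@cvg_monotone_convergence _ _ _ n1 setT measurableT (fun n x => (s n x)%:E)).
  - by move=> n; apply/measurable_EFinP.
  - by move=> n x _; rewrite lee_fin.
  - by move=> x _ n k nk; rewrite lee_fin nd.
have c2 : (\int[n2]_x (s n x * D x)%:E)%E @[n --> \oo] --> (\int[n2]_x (f x * D x)%:E)%E.
  have -> : (\int[n2]_x (f x * D x)%:E = \int[n2]_x limn (fun n => (s n x * D x)%:E))%E.
    apply: eq_integral => x _; apply/esym/cvg_lim => //.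
    apply/cvg_EFin; first exact: nearW.
    by apply: cvgM; [have /fine_cvgP[_] := sf x|exact: cvg_cst].
  apply: (@cvg_monotone_convergence _ _ _ n2 setT measurableT (fun n x => (s n x * D x)%:E)).
  - by move=> n; apply/measurable_EFinP; exact: measurable_funM.
  - by move=> n x _; rewrite lee_fin mulr_ge0.
  - by move=> x _ n k nk; rewrite lee_fin ler_wpM2r ?nd.
have E : (fun n => \int[n1]_x (s n x)%:E)%E = (fun n => \int[n2]_x (s n x * D x)%:E)%E.
  by apply/funext => n; exact: key.
by rewrite E in c1; exact: cvg_unique c1 c2.
Qed.

End IntegralDensity.

Section ZeroIntegrals.
Context d (T : measurableType d) (R : realType) (m : {measure set T -> \bar R}).
Variable f : T -> R.
Hypothesis mf : measurable_fun setT f.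
Hypothesis f0 : forall x, 0 <= f x.

Lemma integral0_ae : (\int[m]_x (f x)%:E = 0)%E -> {ae m, forall x, f x = 0}.
Proof.
move=> h; have mE : measurable_fun setT (EFin \o f) by exact/measurable_EFinP.
have : (\int[m]_x `|(EFin \o f) x| = 0)%E.
  by rewrite -[RHS]h; apply: eq_integral => x _; rewrite gee0_abs// lee_fin.
move=> /(ae_eq_integral_abs m measurableT mE).
by apply: filterS => x /(_ Logic.I) [].
Qed.

Lemma ae0_integral : {ae m, forall x, f x = 0} -> (\int[m]_x (f x)%:E = 0)%E.
Proof.
move=> h; rewrite -[RHS](@integral0 _ _ _ m setT); apply: ge0_ae_eq_integral => //.
- exact/measurable_EFinP.
- by move=> x _; rewrite lee_fin.
- by apply: filterS h => x -> _.
Qed.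

End ZeroIntegrals.

Lemma norm_conj (R : realType) (z : R[i]) : Re `|z^*%C| = Re `|z|.
Proof. by rewrite !normc_def; case: z => a b /=; rewrite sqrrN. Qed.

Section AbsoluteValue.
Context d (T : measurableType d) (R : realType) (m : {measure set T -> \bar R}).

Lemma sqmod_norm (z : R[i]) : sqmod ((Re `|z|)%:C%C : R[i]) = sqmod z.
Proof.
rewrite sqmod_real normc_def /= sqr_sqrtr //.
by rewrite addr_ge0 ?sqr_ge0.
Qed.

Lemma square_integrable_norm (f : T -> R[i]) : square_integrable m f ->
  square_integrable m (fun x => (Re `|f x|)%:C%C).
Proof.
move=> [mf ff]; split; last by under eq_integral do rewrite sqmod_norm.
apply: cmeasurable_real.
have -> : (fun x => Re `|f x|) = (fun x => (sqmod (f x)) `^ 2^-1).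
  by apply/funext => x; rewrite powR12_sqrt ?sqmod_ge0// normc_def.
apply: (measurableT_comp (measurable_powR _)); exact: cmeasurable_sqmod.
Qed.

Lemma nrm_toL2_norm (f : T -> R[i]) : square_integrable m f ->
  nrm (toL2 m (fun x => (Re `|f x|)%:C%C)) = nrm (toL2 m f).
Proof.
move=> sf; have sn := square_integrable_norm sf.
have E : sqint m (fun x => (Re `|f x|)%:C%C) = sqint m f.
  by apply: eq_integral => x _; rewrite sqmod_norm.
have h1 := toL2_nrm_sqr sn; have h2 := toL2_nrm_sqr sf.
rewrite E -h2 in h1; have {}h1 := EFin_inj h1.
have n1 := nrm_ge0 (toL2 m (fun x => (Re `|f x|)%:C%C)); have n2 := nrm_ge0 (toL2 m f).
have gen (a b : R) : 0 <= a -> 0 <= b -> a ^+ 2 = b ^+ 2 -> a = b.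
  by move=> a0 b0 ab; apply/eqP; rewrite -(@eqrXn2 _ 2 _ _ isT a0 b0) ab eqxx.
apply: (gen _ _ n1 n2).
apply: h1.
Qed.

End AbsoluteValue.

Lemma sqmodM (R : realType) (a b : R[i]) : sqmod (a * b) = sqmod a * sqmod b.
Proof. by case: a b => ? ? [? ?]; rewrite /sqmod /=; ring. Qed.

Lemma ae_imp d (T : measurableType d) (R : realType) (m : {measure set T -> \bar R})
    (P Q : T -> Prop) : (forall x, P x -> Q x) ->
  {ae m, forall x, P x} -> {ae m, forall x, Q x}.
Proof. by move=> PQ; apply: filterS. Qed.

Lemma ae_and d (T : measurableType d) (R : realType) (m : {measure set T -> \bar R})
    (P Q : T -> Prop) : {ae m, forall x, P x} -> {ae m, forall x, Q x} ->
  {ae m, forall x, P x /\ Q x}.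
Proof. by move=> h k; apply: filterS2 h k. Qed.

(** * Haar systems *)

Section HaarSystem.
Context (R : realType) (G0 G : ptopologicalType) (g : groupoid G0 G).
Hypothesis Gtop : topological_groupoid g.
Hypothesis Ghaus : hausdorff_space G.
Hypothesis Glc : locally_compact [set: G].
Hypothesis Gsc : @second_countable G.
Variable lam : G0 -> {measure set borel G -> \bar R}.
Hypothesis lamH : left_haar_system g lam.

Let G0haus : hausdorff_space G0 := unit_space_hausdorff Gtop Ghaus.

Lemma lam_fin u : compactly_finite (lam u).
Proof. by have [+ _ _ _] := lamH => /(_ u)[]. Qed.

Lemma measurable_fiber u : measurable (grfib g u : set (borel G)).
Proof. by apply: borel_closed; exact: closed_fiber. Qed.

(** The complement of the support is a union of null sets of a countable
    base. *)
Lemma lam_null u : lam u (~` grfib g u) = 0%E.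
Proof.
have [_ supp _ _] := lamH; have [e [oe be]] := countable_base Gsc.
have cover : ~` grfib g u `<=` \bigcup_(n in [set n | lam u (e n) = 0%E]) e n.
  move=> x; rewrite -(supp u) => nx.
  have [U [oU Ux U0]] : exists U : set G, [/\ open U, U x & ~ (0 < lam u U)%E].
    by apply: contrapT => h; apply: nx => U oU Ux; apply: contrapT => U0; apply: h; exists U.
  have [n [nx' nU]] := be U x oU Ux; exists n => //=.
  apply/eqP; rewrite eq_le measure_ge0 andbT.
  rewrite leNgt; apply/negP => h; apply: U0; apply: lt_le_trans h _.
  by apply: le_measure => //; apply: mem_set; exact: borel_open.
apply/eqP; rewrite eq_le measure_ge0 andbT.
have m0 : lam u (\bigcup_(n in [set n | lam u (e n) = 0%E]) e n) = 0%E.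
  have : (lam u).-negligible (\bigcup_(n in [set n | lam u (e n) = 0%E]) e n).
    rewrite bigcup_mkcond; apply: negligible_bigcup => n.
    case: ifPn => [/set_mem h|_]; last exact: negligible_set0.
    by exists (e n); split=> //; exact: borel_open.
  move/measure_negligible; apply.
  by apply: bigcup_measurable => n _; exact: borel_open.
rewrite -m0; apply: le_measure => //; apply: mem_set.
  by apply: measurableC; exact: measurable_fiber.
by apply: bigcup_measurable => n _; exact: borel_open.
Qed.

Lemma fiber_setD u : setT `\` (~` grfib g u) = grfib g u.
Proof. by rewrite setTD setCK. Qed.

Lemma fiber_integral u (f : borel G -> \bar R) : measurable_fun setT f ->
  (forall x, 0 <= f x)%E ->
  (\int[lam u]_(x in grfib g u) f x = \int[lam u]_x f x)%E.
Proof.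
move=> mf f0; rewrite [RHS](@ge0_negligible_integral _ (borel G) R (lam u) setT (~` grfib g u)) ?fiber_setD//.
- by apply: measurableC; exact: measurable_fiber.
- exact: lam_null.
Qed.

Definition haar (f : G -> R[i]) (u : G0) : R[i] := cintegral (lam u) setT f.
Definition rhaar (h : G -> R) (u : G0) : R := \int[lam u]_x h x.

Lemma fiber_cintegral u f : Cc f -> cintegral (lam u) (grfib g u) f = haar f u.
Proof.
move=> Cf; have [iR iI] := Cc_cintegrable Ghaus Glc (lam_fin u) Cf.
have E (h : G -> R) : (lam u).-integrable setT (EFin \o (h : borel G -> R)) ->
    \int[lam u]_(x in grfib g u) h x = \int[lam u]_x h x.
  move=> ih; rewrite /Rintegral; congr fine.
  rewrite [RHS](@negligible_integral _ (borel G) R (lam u) setT (~` grfib g u)) ?fiber_setD//.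
  - by apply: measurableC; exact: measurable_fiber.
  - exact: lam_null.
by rewrite /haar /cintegral !E.
Qed.

Lemma haar_lin (a : R[i]) f1 f2 u : Cc f1 -> Cc f2 ->
  haar (fun x => a * f1 x + f2 x) u = a * haar f1 u + haar f2 u.
Proof.
move=> C1 C2; have i1 := Cc_cintegrable Ghaus Glc (lam_fin u) C1.
have i2 := Cc_cintegrable Ghaus Glc (lam_fin u) C2.
rewrite /haar cintegralD//; last first.
  exact: (Cc_cintegrable Ghaus Glc (lam_fin u) (CcZ Ghaus a C1)).
by rewrite cintegralZ.
Qed.

Lemma haar_eq0 f u : (forall x, grfib g u x -> f x = 0) -> Cc f -> haar f u = 0.
Proof.
move=> f0 Cf; rewrite -fiber_cintegral//.
have E (h : G -> R) : (forall x, grfib g u x -> h x = 0) ->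
    \int[lam u]_(x in grfib g u) h x = 0.
  move=> h0.
  have -> : \int[lam u]_(x in grfib g u) h x = \int[lam u]_(x in grfib g u) (cst 0 x).
    by apply: eq_Rintegral => x /set_mem /h0.
  by rewrite Rintegral_cst ?mul0r//; exact: measurable_fiber.
by rewrite /cintegral !E// => x /f0 ->.
Qed.

(** Continuity is part of the definition of a Haar system, and the support lies
    in the image of the support of $f$ under the range map. *)
Lemma haar_Cc f : Cc f -> Cc (haar f).
Proof.
move=> Cf; have /(CcP Ghaus)[cf [C cC hC]] := Cf; apply/(CcP G0haus); split.
  have -> : haar f = (fun u => cintegral (lam u) (grfib g u) f).
    by apply/funext => u; rewrite fiber_cintegral.
  by have [_ _ + _] := lamH => /(_ f Cf).
exists (grng g @` C).
  apply: continuous_compact => //; apply: continuous_subspaceT.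
  by case: Gtop.
move=> u; apply: contra_neqP => nu; apply: haar_eq0 => // x xu.
by apply/eqP; apply: contra_notT nu => /hC Cx; exists x.
Qed.

Lemma rhaarE h u : haar (fun x => (h x)%:C%C) u = (rhaar h u)%:C%C.
Proof.
rewrite /haar (@cintegralE _ (borel G) R (lam u) _ h (fun=> 0))//.
by rewrite Rintegral_cst// mul0r.
Qed.

Lemma rhaar_fin h u : continuous h -> csupported h ->
  (\int[lam u]_x (h x)%:E = (rhaar h u)%:E)%E.
Proof.
move=> ch sh; rewrite /rhaar /Rintegral fineK//.
have [iR _] := Cc_cintegrable Ghaus Glc (lam_fin u) (Cc_real Ghaus ch sh).
exact: (integrable_fin_num _ iR).
Qed.

Lemma rhaar_ge0 h u : (forall x, 0 <= h x) -> 0 <= rhaar h u.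
Proof. by move=> h0; apply: Rintegral_ge0. Qed.

Lemma rhaar_continuous h : continuous h -> csupported h -> continuous (rhaar h).
Proof.
move=> ch sh; have [+ _] := haar_Cc (Cc_real Ghaus ch sh).
by move=> /continuous_complexP[+ _].
Qed.

Lemma rhaar_csupported h : continuous h -> csupported h -> csupported (rhaar h).
Proof.
move=> ch sh; have /(CcP G0haus)[_ [C cC hC]] := haar_Cc (Cc_real Ghaus ch sh).
exists C => // u hu; apply: hC; rewrite rhaarE; apply: contra_neq hu.
by move=> [].
Qed.

Lemma rhaar_bound h : continuous h -> csupported h ->
  exists2 M : R, 0 <= M & forall u, rhaar h u <= M ^+ 2.
Proof.
move=> ch sh; have := Cc_bounded G0haus
  (Cc_real G0haus (rhaar_continuous ch sh) (rhaar_csupported ch sh)).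
move=> [M M0 hM]; exists (M + 1); first by rewrite addr_ge0.
by move=> u; have := hM u; rewrite sqmod_real; nra.
Qed.

Lemma sqmod_Cc (a : G -> R[i]) : Cc a ->
  continuous (fun x => sqmod (a x)) /\ csupported (fun x => sqmod (a x)).
Proof.
move=> /(CcP Ghaus)[/continuous_complexP[cR cI] [C cC hC]]; split.
  have -> : (fun x => sqmod (a x)) =
      (fun y => (Re \o a) y * (Re \o a) y + (Im \o a) y * (Im \o a) y).
    by apply/funext => y; rewrite /sqmod !expr2.
  by move=> x; apply: cvgD; apply: cvgM; (exact: cR || exact: cI).
exists C => // x hx; apply: hC; apply: contra_neq hx => ->.
by rewrite (sqmod_real 0) expr0n.
Qed.

(** Haar invariance is assumed for test functions only; uniqueness of measures
    extends it to Borel functions. *)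
Lemma left_invariance x (f : borel G -> \bar R) : measurable_fun setT f ->
  (forall y, 0 <= f y)%E ->
  (\int[lam (gsrc g x)]_(y in grfib g (gsrc g x)) f (gmul g x y) =
   \int[lam (grng g x)]_y f y)%E.
Proof.
move=> mf f0; set u := gsrc g x.
(* Left translation, extended by a constant outside of its fibre. *)
pose t (y : borel G) : borel G := if pselect (u = grng g y) then gmul g x y else x.
have tE y : grfib g u y -> t y = gmul g x y.
  by rewrite /grfib /= /t => yu; case: pselect => // ne; case: ne.
have tN y : ~ grfib g u y -> t y = x.
  by rewrite /grfib /= /t => nyu; case: pselect => // uy; case: nyu.
have mt : measurable_fun setT t.
  apply: (@measurability _ _ _ _ _ _ (@open G : set (set (borel G)))) => //.
  move=> _ [Q oQ <-]; rewrite setTI.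
  have [|U oU FU] := @within_preimage_open _ _ (grfib g u) (gmul g x) Q oQ.
    by move=> y yu; apply: translate_cvg.
  have /seteqP[FU1 FU2] := FU.
  have -> : t @^-1` Q = (grfib g u `&` U) `|` (~` grfib g u `&` [set y | Q x]).
    apply/seteqP; split=> y /=.
      have [yu|yu] := pselect (grfib g u y).
        by rewrite tE// => h; left; apply: FU1.
      by rewrite tN// => h; right.
    move=> [/FU2[yu h]|[yu Qx]]; first by rewrite tE.
    by rewrite tN.
  have mu := measurable_fiber u.
  apply: measurableU; first by apply: measurableI => //; exact: borel_open.
  apply: measurableI; first exact: measurableC.
  - have [Qx|nQx] := pselect (Q x).
      by rewrite (_ : [set _ | _] = setT)//; apply/seteqP; split.
    by rewrite (_ : [set _ | _] = set0)//; apply/seteqP; split.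
have -> : (\int[lam u]_(y in grfib g u) f (gmul g x y) = \int[lam u]_y f (t y))%E.
  rewrite -fiber_integral//.
  - by apply: eq_integral => y /set_mem yu; rewrite tE.
  - exact: measurableT_comp.
pose P := image_meas (lam u) mt.
have PE (h : borel G -> \bar R) : measurable_fun setT h -> (forall y, 0 <= h y)%E ->
    (\int[P]_y h y = \int[lam u]_y h (t y))%E.
  exact: integral_image_meas.
rewrite -(PE f mf f0); apply/esym.
have PA A : measurable A -> lam (grng g x) A = P A.
  apply: (measure_eq_test Ghaus Glc Gsc) => //; first exact: lam_fin.
  move=> h ch sh h01.
  have h0 y : 0 <= h y by have /andP[] := h01 y.
  have mh := continuous_borel ch.
  rewrite PE; [|exact/measurable_EFinP|by move=> y; rewrite lee_fin].
  have Ch := Cc_real Ghaus ch sh.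
  have [_ _ _ /(_ x _ Ch)] := lamH.
  rewrite (fiber_cintegral (grng g x) Ch) rhaarE.
  have mht : measurable_fun setT (fun y => (h (t y))%:E).
    by apply/measurable_EFinP; exact: measurableT_comp.
  rewrite rhaar_fin// => -[hE _].
  rewrite -hE -fiber_integral//.
  rewrite /Rintegral fineK; last first.
    have [C cC hC] := sh.
    have [_ [M cM hM]] := shear_supports Gtop Ghaus (@compact_set1 _ x) cC.
    rewrite ge0_fin_numE; last by apply: integral_ge0 => y _; rewrite lee_fin.
    apply: (@le_lt_trans _ _ (\int[lam u]_(y in grfib g u) (\1_M y)%:E)%E).
      apply: ge0_le_integral => //.
      - exact: measurable_fiber.
      - by move=> y _; rewrite lee_fin.
      - apply: (@eq_measurable_fun _ _ _ _ _ (fun y => (h (t y))%:E)).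
          by move=> y /set_mem yu; rewrite tE.
        exact: measurable_funTS.
      - apply/measurable_EFinP; apply: measurable_indic; exact: borel_compact.
      - move=> y yu; rewrite lee_fin indicE.
        have [->|/hC hy] := eqVneq (h (gmul g x y)) 0; first by rewrite ler0n.
        rewrite mem_set; last exact: (hM x y).
        by have /andP[] := h01 (gmul g x y).
    rewrite integral_indic; [|exact: measurable_fiber|exact: borel_compact].
    apply: le_lt_trans (lam_fin u cM); apply: le_measure; last exact: subIsetl.
      apply: mem_set; apply: measurableI; last exact: measurable_fiber.
      exact: borel_compact.
    by apply: mem_set; exact: borel_compact.
    by apply: eq_integral => y /set_mem yu; rewrite tE.
  by move=> y; rewrite lee_fin.
by apply: (@eq_measure_integral _ (borel G) R setT P) => A mA _; exact: PA.
Qed.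

(** * The measures of a groupoid *)

Variable mu : {measure set borel G0 -> \bar R}.
Hypothesis muR : radon_measure mu.
Variable nu : {measure set borel G -> \bar R}.
Hypothesis nuE : is_nu g lam mu nu.

Lemma measurable_grng : measurable_fun setT (grng g : borel G -> borel G0).
Proof. by apply: continuous_borel_map; case: Gtop. Qed.

Lemma measurable_gsrc : measurable_fun setT (gsrc g : borel G -> borel G0).
Proof. by apply: continuous_borel_map; case: Gtop. Qed.

Lemma measurable_ginv : measurable_fun setT (ginv g : borel G -> borel G).
Proof. by apply: continuous_borel_map; case: Gtop. Qed.

Section weight.
Variable h : G -> R.
Hypotheses (ch : continuous h) (sh : csupported h) (h0 : forall x, 0 <= h x).

Let mh : measurable_fun setT (h : borel G -> R). Proof. exact: continuous_borel. Qed.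
Let mrh : measurable_fun setT (rhaar h : borel G0 -> R).
Proof. by apply: continuous_borel; exact: rhaar_continuous. Qed.
Let rh0 u : 0 <= rhaar h u. Proof. exact: rhaar_ge0. Qed.
Let rhE u : (\int[lam u]_x (h x)%:E = (rhaar h u)%:E)%E.
Proof. exact: rhaar_fin. Qed.

(** Disintegration of $\nu$ along the range map. *)
Lemma nu_range_integral (psi : borel G0 -> R) : measurable_fun setT psi ->
  (forall u, 0 <= psi u) ->
  (\int[nu]_x (h x * psi (grng g x))%:E = \int[mu]_u (rhaar h u * psi u)%:E)%E.
Proof.
move=> mpsi psi0; rewrite nuE; last first.
- by move=> x; rewrite lee_fin mulr_ge0.
- apply/measurable_EFinP; apply: measurable_funM => //.
  exact: (measurableT_comp mpsi measurable_grng).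
apply: eq_integral => u _.
transitivity (\int[lam u]_(x in grfib g u) ((psi u)%:E * (h x)%:E))%E.
  by apply: eq_integral => x /set_mem /= ->; rewrite -EFinM mulrC.
rewrite fiber_integral; last 2 first.
- by apply/measurable_EFinP; apply: measurable_funM.
- by move=> x; rewrite -EFinM lee_fin mulr_ge0.
rewrite ge0_integralZl_EFin//; last 2 first.
- by move=> x _; rewrite lee_fin.
- exact/measurable_EFinP.
by rewrite rhE -EFinM mulrC.
Qed.

Lemma second_integral (m : {measure set (borel G * borel G) -> \bar R})
    (rho : borel G -> borel G0) (K : borel G -> R) : measurable_fun setT rho ->
  (forall f : borel G * borel G -> \bar R, measurable_fun setT f ->
     (forall p, 0 <= f p)%E ->
     (\int[m]_p f p = \int[mu]_u \int[lam u]_(x in grfib g u)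
        \int[lam (rho x)]_(y in grfib g (rho x)) f (x, y))%E) ->
  measurable_fun setT K -> (forall x, 0 <= K x) ->
  (\int[m]_p (K p.1 * h p.2)%:E = \int[nu]_x (K x * rhaar h (rho x))%:E)%E.
Proof.
move=> mrho mE mK K0; rewrite mE; last first.
- by move=> p; rewrite lee_fin mulr_ge0.
- apply/measurable_EFinP; apply: measurable_funM.
    exact: (measurableT_comp mK measurable_fst).
  exact: (measurableT_comp mh measurable_snd).
rewrite nuE; last first.
- by move=> x; rewrite lee_fin mulr_ge0.
- apply/measurable_EFinP; apply: measurable_funM => //.
  exact: (measurableT_comp mrh mrho).
apply: eq_integral => u _; apply: eq_integral => x _ /=.
under eq_integral do rewrite EFinM.
rewrite fiber_integral; last 2 first.
- by apply/measurable_EFinP; apply: measurable_funM.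
- by move=> y; rewrite -EFinM lee_fin mulr_ge0.
rewrite ge0_integralZl_EFin//; last 2 first.
- by move=> y _; rewrite lee_fin.
- exact/measurable_EFinP.
by rewrite rhE.
Qed.

Lemma nu2_rng_integralC (m : {measure set (borel G * borel G) -> \bar R})
    (K : borel G -> R) : is_nu2_rr g lam mu m -> measurable_fun setT K ->
  (forall x, 0 <= K x) ->
  (\int[m]_p (h p.1 * K p.2)%:E = \int[nu]_y (K y * rhaar h (grng g y))%:E)%E.
Proof.
move=> mE mK K0; rewrite mE; last first.
- by move=> p; rewrite lee_fin mulr_ge0.
- apply/measurable_EFinP; apply: measurable_funM.
    exact: (measurableT_comp mh measurable_fst).
  exact: (measurableT_comp mK measurable_snd).
rewrite nuE; last first.
- by move=> x; rewrite lee_fin mulr_ge0.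
- apply/measurable_EFinP; apply: measurable_funM => //.
  exact: (measurableT_comp mrh measurable_grng).
apply: eq_integral => u _ /=.
pose c := (\int[lam u]_y (K y)%:E)%E.
have c0 : (0 <= c)%E by apply: integral_ge0 => y _; rewrite lee_fin.
have inner (k : R) : 0 <= k ->
    (\int[lam u]_(y in grfib g u) (k * K y)%:E = k%:E * c)%E.
  move=> k0; under eq_integral do rewrite EFinM.
  rewrite fiber_integral; last 2 first.
  - by apply/measurable_EFinP; apply: measurable_funM.
  - by move=> y; rewrite -EFinM lee_fin mulr_ge0.
  by rewrite ge0_integralZl_EFin//; [move=> y _; rewrite lee_fin|exact/measurable_EFinP].
transitivity (\int[lam u]_(x in grfib g u) ((h x)%:E * c))%E.
  by apply: eq_integral => x _; exact: inner.
rewrite fiber_integral; last 2 first.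
- by apply: emeasurable_funM => //; exact/measurable_EFinP.
- by move=> y; rewrite mule_ge0 ?lee_fin.
rewrite ge0_integralZr//; last 2 first.
- exact/measurable_EFinP.
- by move=> y _; rewrite lee_fin.
rewrite rhE -inner//.
by apply: eq_integral => y /set_mem /= ->; rewrite mulrC.
Qed.

Lemma nu_test_finite : (\int[nu]_x (h x)%:E < +oo)%E.
Proof.
have -> : (\int[nu]_x (h x)%:E = \int[mu]_u (rhaar h u)%:E)%E.
  have := @nu_range_integral (fun=> 1) (measurable_cst _) (fun=> ler01).
  by under eq_integral do rewrite mulr1; under [X in _ = X]eq_integral do rewrite mulr1.
have [M M0 hM] := rhaar_bound ch sh.
have [C cC hC] := rhaar_csupported ch sh.
have mC := borel_compact G0haus cC.
apply: (@le_lt_trans _ _ (\int[mu]_u ((M ^+ 2)%:E * (\1_C u)%:E))%E).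
  apply: ge0_le_integral => //.
  - by move=> x _; rewrite lee_fin.
  - exact/measurable_EFinP.
  - by apply/measurable_EFinP; apply: measurable_funM => //; exact: measurable_indic.
  move=> u _; rewrite -EFinM lee_fin indicE.
  have [->|/hC Cu] := eqVneq (rhaar h u) 0; first by rewrite mulr_ge0 ?sqr_ge0.
  by rewrite mem_set// mulr1.
rewrite ge0_integralZl_EFin//; last 2 first.
- by apply/measurable_EFinP; exact: measurable_indic.
- exact: sqr_ge0.
rewrite integral_indic// setIT; apply: lte_mul_pinfty => //; last by case: muR => + _ _; apply.
by rewrite lee_fin sqr_ge0.
Qed.

End weight.

(** Both measures on pairs integrate out a function of the second variable to a
    function of $\rho(x)$, with $\rho=r$ on $G^2_{r,r}$ and $\rho=s$ on
    $G^2_{s,r}$. *)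
Definition second_weight (m : {measure set (borel G * borel G) -> \bar R})
    (rho : borel G -> borel G0) : Prop :=
  measurable_fun setT rho /\
  forall (h : G -> R) (K : borel G -> R), continuous h -> csupported h ->
    (forall x, 0 <= h x) -> measurable_fun setT K -> (forall x, 0 <= K x) ->
    (\int[m]_p (K p.1 * h p.2)%:E = \int[nu]_x (K x * rhaar h (rho x))%:E)%E.

Lemma rng_weight m : is_nu2_rr g lam mu m -> second_weight m (grng g).
Proof.
move=> mE; split=> [|h K ch sh h0 mK K0]; first exact: measurable_grng.
apply: (@second_integral h ch sh h0 m (grng g) K measurable_grng _ mK K0) => f mf f0.
rewrite (mE f mf f0).
by apply: eq_integral => u _; apply: eq_integral => x /set_mem /= ->.
Qed.

Lemma src_weight m : is_nu2_sr g lam mu m -> second_weight m (gsrc g).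
Proof.
move=> mE; split=> [|h K ch sh h0 mK K0]; first exact: measurable_gsrc.
exact: (@second_integral h ch sh h0 m (gsrc g) K measurable_gsrc mE mK K0).
Qed.

(** A cut-off of a compact set has a continuous compactly supported Haar
    integral, whose $\mu$-integral is finite. *)
Lemma nu_fin : compactly_finite nu.
Proof.
move=> K cK; have [h [ch sh h01 hK _]] := compact_cutoff R Ghaus Glc cK openT (@subsetT _ _).
have h0 x : 0 <= h x by have /andP[] := h01 x.
apply: le_lt_trans (nu_test_finite ch sh h0).
have mK := borel_compact Ghaus cK.
rewrite -[K in leLHS]setIT -integral_indic//; apply: ge0_le_integral => //.
- by apply/measurable_EFinP; exact: measurable_indic.
- by apply/measurable_EFinP; exact: continuous_borel.
- move=> x _; rewrite lee_fin indicE; have [/set_mem/hK ->//|_] := boolP (x \in K).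
  exact: h0.
Qed.

Definition nuV : {measure set borel G -> \bar R} := image_meas nu measurable_ginv.

Lemma nuV_integral (f : borel G -> \bar R) : measurable_fun setT f ->
  (forall x, 0 <= f x)%E -> (\int[nuV]_x f x = \int[nu]_x f (ginv g x))%E.
Proof. exact: integral_image_meas. Qed.

Lemma nuV_fin : compactly_finite nuV.
Proof. by move=> K cK; apply: nu_fin; exact: ginv_compact. Qed.

Variable D : borel G -> R.
Hypothesis DE : is_modular_density g nu D.

Lemma nu_density (f : borel G -> R) : measurable_fun setT f -> (forall x, 0 <= f x) ->
  (\int[nu]_x (f x)%:E = \int[nuV]_x (f x * D x)%:E)%E.
Proof.
by have [mD D0 hD] := DE; apply: integral_density => // A mA; rewrite hD.
Qed.

Let nufin : compactly_finite nu := nu_fin.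

(** * The factorizations of a groupoid and their creation operators *)

Local Notation sq a := (fun x => sqmod (a x)).

(** $M$ bounds the norm of $a$ in the module $L^2(G,\lambda)$. *)
Definition fiber_bound (a : G -> R[i]) (M : R) : Prop :=
  forall u, rhaar (sq a) u <= M ^+ 2.

Lemma fiber_bound_ex a : Cc a -> exists2 M : R, 0 <= M & fiber_bound a M.
Proof. by move=> /sqmod_Cc[ca sa]; exact: rhaar_bound. Qed.

Definition jlift (a : G -> R[i]) (phi : G0 -> R[i]) (x : G) : R[i] :=
  a x * phi (grng g x).

Lemma jlift_meas a phi : Cc a -> cmeasurable (phi : borel G0 -> R[i]) ->
  cmeasurable (jlift a phi : borel G -> R[i]).
Proof.
move=> /Cc_continuous /continuous_cmeasurable[aR aI] [pR pI].
have mr := measurable_grng.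
have qR := measurableT_comp pR mr; have qI := measurableT_comp pI mr.
split.
  have := measurable_funB (measurable_funM aR qR) (measurable_funM aI qI).
  by congr measurable_fun; apply/funext => x /=; rewrite /jlift;
    case: (a x) (phi _) => ? ? [? ?].
have := measurable_funD (measurable_funM aR qI) (measurable_funM aI qR).
by congr measurable_fun; apply/funext => x /=; rewrite /jlift;
  case: (a x) (phi _) => ? ? [? ?].
Qed.

Lemma jlift_sqint a phi : Cc a -> cmeasurable (phi : borel G0 -> R[i]) ->
  sqint nu (jlift a phi) = (\int[mu]_u (rhaar (sq a) u * sqmod (phi u))%:E)%E.
Proof.
move=> /sqmod_Cc[ca sa] mphi; rewrite /sqint.
under eq_integral do rewrite /jlift sqmodM.
exact: (nu_range_integral ca sa
  (fun x => sqmod_ge0 (a x)) (cmeasurable_sqmod mphi) (fun u => sqmod_ge0 _)).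
Qed.

Lemma weighted_sqint_le d (T : measurableType d) (m : {measure set T -> \bar R})
    (phi : T -> R[i]) (w : T -> R) (M : R) : cmeasurable phi ->
  measurable_fun setT w -> (forall x, 0 <= w x) -> (forall x, w x <= M ^+ 2) ->
  (\int[m]_x (sqmod (phi x) * w x)%:E <= (M ^+ 2)%:E * sqint m phi)%E.
Proof.
move=> mphi mw w0 wM; rewrite -ge0_integralZl_EFin ?sqr_ge0//; last 2 first.
- by move=> x _; exact: sqmod_ge0E.
- exact: measurable_sqmod.
apply: ge0_le_integral => //.
- by move=> x _; rewrite lee_fin mulr_ge0 ?sqmod_ge0.
- apply/measurable_EFinP; apply: measurable_funM => //.
  exact: cmeasurable_sqmod.
- apply/measurable_EFinP; apply: measurable_funM => //.
  exact: cmeasurable_sqmod.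
- by move=> x _; rewrite -EFinM lee_fin mulrC ler_wpM2r ?sqmod_ge0.
Qed.

Let rhaar_meas a : Cc a -> measurable_fun setT (rhaar (sq a) : borel G0 -> R).
Proof.
move=> /sqmod_Cc[ca sa]; apply: continuous_borel.
exact: rhaar_continuous.
Qed.

Let rhaar_pos a u : 0 <= rhaar (sq a) u.
Proof. by apply: rhaar_ge0 => x; exact: sqmod_ge0. Qed.

Lemma jlift_bound a M phi : Cc a -> fiber_bound a M ->
  cmeasurable (phi : borel G0 -> R[i]) ->
  (sqint nu (jlift a phi) <= (M ^+ 2)%:E * sqint mu phi)%E.
Proof.
move=> Ca aM mphi; rewrite jlift_sqint//.
under eq_integral do rewrite mulrC.
by apply: weighted_sqint_le => //; exact: rhaar_meas.
Qed.

Lemma jlift_lin a (c : R[i]) f1 f2 :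
  jlift a (fun x => c * f1 x + f2 x) = (fun y => c * jlift a f1 y + jlift a f2 y).
Proof. by apply/funext => x; rewrite /jlift; ring. Qed.

Lemma jmap_bounded a : Cc a -> bounded_linear (jmap g nu a : L2 mu -> L2 nu).
Proof.
move=> Ca; have [M M0 aM] := fiber_bound_ex Ca.
apply: (@pointwise_op_bounded_linear _ _ _ _ _ mu nu (jlift a) M M0).
- by move=> *; exact: jlift_lin.
- by move=> f; exact: jlift_meas.
- by move=> f; exact: jlift_bound.
Qed.

Lemma jmap_toL2 a phi : Cc a -> square_integrable mu phi ->
  square_integrable nu (jlift a phi) /\
  jmap g nu a (toL2 mu phi) = toL2 nu (jlift a phi).
Proof.
move=> Ca sphi; have [M M0 aM] := fiber_bound_ex Ca; split.
  apply: (@pointwise_square_integrable _ _ _ _ _ mu nu (jlift a) M) => //.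
  - by move=> f; exact: jlift_meas.
  - by move=> f; exact: jlift_bound.
apply: (@pointwise_opE _ _ _ _ _ mu nu (jlift a) M) => //.
- by move=> *; exact: jlift_lin.
- by move=> f; exact: jlift_meas.
- by move=> f; exact: jlift_bound.
Qed.

Lemma module_sqnorm0 fib (m : G0 -> {measure set borel G -> \bar R}) (f : G -> R[i]) :
  (module_sqnorm fib m (f - f)%R <= 0)%E.
Proof.
apply: ge_ereal_sup => _ [u _ <-]; rewrite integral0_eq// => x _.
by rewrite subrr (sqmod_real 0) expr0n.
Qed.

Lemma completed_image_incl fib (m : G0 -> {measure set borel G -> \bar R}) j a :
  Cc a -> bounded_linear (j a : L2 mu -> L2 nu) -> completed_image fib m j (j a).
Proof.
move=> Ca ba; split=> //; exists (fun=> a); split=> // e e0.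
  exists 0%N => p q _ _; apply: le_trans (module_sqnorm0 _ _ _) _.
  by rewrite lee_fin sqr_ge0.
by apply: nearW => n; have [N hN] := opcvg_cst (j a) e0; exact: (hN N (leqnn N)).
Qed.

Lemma jmap_alpha a : Cc a -> alpha_fact g lam mu nu (jmap g nu a).
Proof. by move=> Ca; apply: completed_image_incl => //; exact: jmap_bounded. Qed.

Lemma alpha_bounded xi : alpha_fact g lam mu nu xi -> bounded_linear xi.
Proof. by case. Qed.

(** The Cauchy condition in the module norm is kept because it controls the
    creation operators. *)
Lemma alpha_approx xi : alpha_fact g lam mu nu xi -> exists a : nat -> G -> R[i],
  [/\ forall n, Cc (a n), opcvg (fun n => jmap g nu (a n)) xi &
      forall e : R, 0 < e -> exists N, forall p q, (N <= p)%N -> (N <= q)%N ->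
        fiber_bound (fun x => a p x - a q x) e].
Proof.
move=> [_ [a [Ca cauchy lim]]]; exists a; split=> //.
  by move=> e e0; have [N _ hN] := lim e e0; exists N => n /hN.
move=> e e0; have [N hN] := cauchy e e0; exists N => p q Np Nq u.
have Cd := CcB Ghaus (Ca p) (Ca q); have [cd sd] := sqmod_Cc Cd.
rewrite -lee_fin -rhaar_fin//.
apply: le_trans (hN p q Np Nq).
rewrite -fiber_integral.
- by apply: ereal_sup_ubound; exists u.
- by apply: measurable_sqmod; exact/continuous_cmeasurable/Cc_continuous.
- by move=> x; exact: sqmod_ge0E.
Qed.

Lemma indicator_square_integrable (K : set G0) : compact K ->
  square_integrable mu (fun u => (\1_K u : R)%:C%C).
Proof.
move=> cK; have mK := borel_compact G0haus cK.
split; first by apply: cmeasurable_real; exact: measurable_indic.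
under eq_integral => u _.
  rewrite sqmod_real (_ : _ ^+ 2 = \1_K u); last first.
    by rewrite indicE; case: (u \in _); rewrite ?expr1n ?expr0n.
  over.
by rewrite integral_indic// setIT; case: muR => + _ _; apply.
Qed.

(** $j(a)$ applied to the indicator function of the compact set
    $r(\mathrm{supp}\,a)$ is $a$. *)
Lemma Cc_jmap a : Cc a -> exists zeta : L2 mu, jmap g nu a zeta = toL2 nu a.
Proof.
move=> Ca; have /(CcP Ghaus)[ca [C cC hC]] := Ca.
have cr : compact (grng g @` C).
  by apply: continuous_compact => //; apply: continuous_subspaceT; case: Gtop.
have s1 := indicator_square_integrable cr.
exists (toL2 mu (fun u => (\1_(grng g @` C) u : R)%:C%C)).
have [_ ->] := jmap_toL2 Ca s1; congr (toL2 nu _); apply/funext => x.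
rewrite /jlift; have [->|/hC Cx] := eqVneq (a x) 0; first by rewrite mul0r.
by rewrite indicE mem_set ?mulr1//; exists x.
Qed.

Lemma alpha_acts_densely : acts_densely (alpha_fact g lam mu nu).
Proof.
move=> F e e0; have [f [Cf hf]] := Cc_dense Ghaus Glc Gsc nufin F e0.
have [zeta hz] := Cc_jmap Cf.
exists (toL2 nu f) => //; exists (jmap g nu f), zeta; split=> //.
exact: jmap_alpha.
Qed.

Let mD : measurable_fun setT D. Proof. by case: DE. Qed.
Let D0 x : 0 <= D x. Proof. by case: DE. Qed.

Definition jhatlift (a : G -> R[i]) (phi : G0 -> R[i]) (x : G) : R[i] :=
  a x * ((Num.sqrt (D x))^-1)%:C%C * phi (gsrc g x).

Let msD : measurable_fun setT (fun x : borel G => (Num.sqrt (D x))^-1).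
Proof.
have -> : (fun x : borel G => (Num.sqrt (D x))^-1) = (fun x => (D x) `^ (- 2^-1)).
  apply/funext => x; rewrite powRN powR12_sqrt//.
exact: (measurableT_comp (measurable_powR _) mD).
Qed.

Lemma cmeasurableM d (T : measurableType d) (f1 f2 : T -> R[i]) :
  cmeasurable f1 -> cmeasurable f2 -> cmeasurable (fun x => f1 x * f2 x).
Proof.
move=> [aR aI] [qR qI]; split.
  have := measurable_funB (measurable_funM aR qR) (measurable_funM aI qI).
  by congr measurable_fun; apply/funext => x /=; case: (f1 x) (f2 x) => ? ? [? ?].
have := measurable_funD (measurable_funM aR qI) (measurable_funM aI qR).
by congr measurable_fun; apply/funext => x /=; case: (f1 x) (f2 x) => ? ? [? ?].
Qed.

Lemma cmeasurable_comp d d' (T : measurableType d) (T' : measurableType d')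
    (f : T' -> R[i]) (h : T -> T') :
  cmeasurable f -> measurable_fun setT h -> cmeasurable (fun x => f (h x)).
Proof.
by move=> [fR fI] mh; split; [exact: (measurableT_comp fR mh)|exact: (measurableT_comp fI mh)].
Qed.

Let Cc_meas a : Cc a -> cmeasurable (a : borel G -> R[i]).
Proof. by move=> Ca; exact/continuous_cmeasurable/Cc_continuous. Qed.

Lemma jhatlift_meas a phi : Cc a -> cmeasurable (phi : borel G0 -> R[i]) ->
  cmeasurable (jhatlift a phi : borel G -> R[i]).
Proof.
move=> Ca mphi; apply: cmeasurableM; last first.
  exact: (cmeasurable_comp mphi measurable_gsrc).
by apply: cmeasurableM; [exact: Cc_meas|exact: cmeasurable_real].
Qed.

Let sqrtD2 x : (Num.sqrt (D x))^-1 ^+ 2 * D x <= 1.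
Proof.
rewrite exprVn sqr_sqrtr//; have [->|n0] := eqVneq (D x) 0; first by rewrite mulr0.
by rewrite mulVf.
Qed.

(** The factor $D^{-1/2}$ turns $\nu$ into $\nu^{-1}$, and inversion exchanges
    the source and the range. *)
Lemma jhatlift_bound a M phi : Cc a -> fiber_bound (fun x => a (ginv g x)) M ->
  cmeasurable (phi : borel G0 -> R[i]) ->
  (sqint nu (jhatlift a phi) <= (M ^+ 2)%:E * sqint mu phi)%E.
Proof.
move=> Ca aM mphi; have CV := Cc_ginv Gtop Ghaus Ca.
apply: le_trans (jlift_bound CV aM mphi).
rewrite {1}/sqint nu_density; last 2 first.
- by apply: cmeasurable_sqmod; exact: jhatlift_meas.
- by move=> x; exact: sqmod_ge0.
have -> : sqint nu (jlift (fun x => a (ginv g x)) phi) =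
    (\int[nuV]_x (sqmod (a x * phi (gsrc g x)))%:E)%E.
  rewrite nuV_integral.
  - by apply: eq_integral => x _; rewrite /jlift gsrc_inv.
  - apply: measurable_sqmod; apply: cmeasurableM; first exact: Cc_meas.
    exact: (cmeasurable_comp mphi measurable_gsrc).
  - by move=> x; exact: sqmod_ge0E.
apply: ge0_le_integral => //.
- by move=> x _; rewrite lee_fin mulr_ge0// sqmod_ge0.
- apply/measurable_EFinP; apply: measurable_funM => //.
  by apply: cmeasurable_sqmod; exact: jhatlift_meas.
- apply: measurable_sqmod; apply: cmeasurableM; first exact: Cc_meas.
  exact: (cmeasurable_comp mphi measurable_gsrc).
move=> x _; rewrite lee_fin /jhatlift !sqmodM sqmod_real.
have := sqrtD2 x; have := sqmod_ge0 (a x); have := sqmod_ge0 (phi (gsrc g x)).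
move: (sqmod (a x)) (sqmod (phi _)) (_^-1 ^+ 2) => A P S P0 A0 h.
have -> : A * S * P * D x = (A * P) * (S * D x) by ring.
by rewrite ler_piMr// mulr_ge0.
Qed.

Lemma jhatlift_lin a (c : R[i]) f1 f2 :
  jhatlift a (fun x => c * f1 x + f2 x) =
  (fun y => c * jhatlift a f1 y + jhatlift a f2 y).
Proof. by apply/funext => x; rewrite /jhatlift; ring. Qed.

Lemma jhatmap_bounded a : Cc a -> bounded_linear (jhatmap g nu D a : L2 mu -> L2 nu).
Proof.
move=> Ca; have [M M0 aM] := fiber_bound_ex (Cc_ginv Gtop Ghaus Ca).
apply: (@pointwise_op_bounded_linear _ _ _ _ _ mu nu (jhatlift a) M M0).
- by move=> *; exact: jhatlift_lin.
- by move=> f; exact: jhatlift_meas.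
- by move=> f; exact: jhatlift_bound.
Qed.

Lemma jhatmap_toL2 a phi : Cc a -> square_integrable mu phi ->
  square_integrable nu (jhatlift a phi) /\
  jhatmap g nu D a (toL2 mu phi) = toL2 nu (jhatlift a phi).
Proof.
move=> Ca sphi; have [M M0 aM] := fiber_bound_ex (Cc_ginv Gtop Ghaus Ca); split.
  apply: (@pointwise_square_integrable _ _ _ _ _ mu nu (jhatlift a) M) => //.
  - by move=> f; exact: jhatlift_meas.
  - by move=> f; exact: jhatlift_bound.
apply: (@pointwise_opE _ _ _ _ _ mu nu (jhatlift a) M) => //.
- by move=> *; exact: jhatlift_lin.
- by move=> f; exact: jhatlift_meas.
- by move=> f; exact: jhatlift_bound.
Qed.

Lemma betahat_bounded xi : betahat_fact g lam mu nu D xi -> bounded_linear xi.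
Proof. by case. Qed.

Lemma jhatmap_betahat a : Cc a -> betahat_fact g lam mu nu D (jhatmap g nu D a).
Proof.
move=> Ca; have mi := measurable_ginv.
exact: (@completed_image_incl (gsfib g) (fun u => image_meas (lam u) mi)
  (jhatmap g nu D) a Ca (jhatmap_bounded Ca)).
Qed.

(** As $\hat j(f)$ maps an indicator function to $fD^{-1/2}$, a vector $F$ is
    approximated by approximating $FD^{1/2}$ by $f$ in $L^2(G,\nu^{-1})$. *)
Lemma betahat_acts_densely : acts_densely (betahat_fact g lam mu nu D).
Proof.
move=> y e e0; set F : L2 nu := y.
have sF := @L2_square_integrable _ _ _ _ F; have [mF finF] := sF.
have finV := nuV_fin.
pose F' x := F x * (Num.sqrt (D x))%:C%C.
have msq : measurable_fun setT (fun x : borel G => Num.sqrt (D x)).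
  have -> : (fun x : borel G => Num.sqrt (D x)) = (fun x => (D x) `^ (2^-1)).
    by apply/funext => x; rewrite powR12_sqrt.
  exact: (measurableT_comp (measurable_powR _) mD).
have mF' : cmeasurable F' by apply: cmeasurableM => //; exact: cmeasurable_real.
have sF' : square_integrable nuV F'.
  split=> //; apply: le_lt_trans finF.
  rewrite [leRHS]nu_density; last 2 first.
  - exact: cmeasurable_sqmod.
  - by move=> x; exact: sqmod_ge0.
  rewrite le_eqVlt; apply/orP; left; apply/eqP; apply: eq_integral => x _.
  by rewrite /F' sqmodM sqmod_real sqr_sqrtr.
have [f [Cf hf]] := Cc_dense Ghaus Glc Gsc finV (toL2 nuV F') e0.
have /(CcP Ghaus)[cf [C cC hC]] := Cf.
have cr : compact (gsrc g @` C).
  by apply: continuous_compact => //; apply: continuous_subspaceT; case: Gtop.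
have s1 := indicator_square_integrable cr.
have [sJ jE] := jhatmap_toL2 Cf s1.
exists (toL2 nu (jhatlift f (fun u => (\1_(gsrc g @` C) u : R)%:C%C))).
  exists (jhatmap g nu D f), (toL2 mu (fun u => (\1_(gsrc g @` C) u : R)%:C%C)).
  by split; [exact: jhatmap_betahat|].
have sf := Cc_square_integrable Ghaus finV Cf.
rewrite -[F]toL2_repr; apply: sqr_ler; first exact: ltW.
rewrite -lee_fin toL2_dist_sqr//.
apply: (@le_trans _ _ ((nrm (toL2 nuV F' - toL2 nuV f) ^+ 2)%:E)); last first.
  by rewrite lee_fin ler_pXn2r ?nnegrE ?nrm_ge0 ?(ltW e0).
rewrite toL2_dist_sqr// /sqint nu_density; last 2 first.
- by apply: cmeasurable_sqmod; case: (square_integrableB sF sJ).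
- by move=> x; exact: sqmod_ge0.
apply: ge0_le_integral => //.
- by move=> x _; rewrite lee_fin mulr_ge0// sqmod_ge0.
- apply/measurable_EFinP; apply: measurable_funM => //.
  by apply: cmeasurable_sqmod; case: (square_integrableB sF sJ).
- by apply: measurable_sqmod; case: (square_integrableB sF' sf).
move=> x _; rewrite lee_fin /jhatlift.
have -> : f x * ((Num.sqrt (D x))^-1)%:C%C * (\1_(gsrc g @` C) (gsrc g x) : R)%:C%C =
    f x * ((Num.sqrt (D x))^-1)%:C%C.
  have [->|/hC Cx] := eqVneq (f x) 0; first by rewrite !mul0r.
  by rewrite indicE mem_set ?mulr1//; exists x.
have [Dx0|Dx0] := eqVneq (D x) 0; first by rewrite Dx0 mulr0 sqmod_ge0.
have -> : F' x - f x = (F x - f x * ((Num.sqrt (D x))^-1)%:C%C) * (Num.sqrt (D x))%:C%C.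
  rewrite mulrBl -mulrA -rmorphM mulVf ?mulr1//.
  by rewrite gt_eqF // sqrtr_gt0 lt0r Dx0 D0.
by rewrite sqmodM sqmod_real sqr_sqrtr.
Qed.

Local Notation alpha := (alpha_fact g lam mu nu).
Local Notation j := (jmap g nu : (G -> R[i]) -> L2 mu -> L2 nu).

Let alphaB xi : alpha xi -> bounded_linear xi.
Proof. exact: alpha_bounded. Qed.

(** The functions representing $|j(b)\rangle_2\phi$ and $|j(a)\rangle_1\phi$. *)
Definition rlift (b phi : G -> R[i]) (p : G * G) : R[i] := phi p.1 * b p.2.
Definition llift (a phi : G -> R[i]) (p : G * G) : R[i] := a p.1 * phi p.2.

Lemma rlift_meas b phi : Cc b -> cmeasurable (phi : borel G -> R[i]) ->
  cmeasurable (rlift b phi : borel G * borel G -> R[i]).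
Proof.
move=> Cb mphi; apply: cmeasurableM.
  exact: (cmeasurable_comp mphi measurable_fst).
exact: (cmeasurable_comp (Cc_meas Cb) measurable_snd).
Qed.

Lemma llift_meas a phi : Cc a -> cmeasurable (phi : borel G -> R[i]) ->
  cmeasurable (llift a phi : borel G * borel G -> R[i]).
Proof.
move=> Ca mphi; apply: cmeasurableM.
  exact: (cmeasurable_comp (Cc_meas Ca) measurable_fst).
exact: (cmeasurable_comp mphi measurable_snd).
Qed.

Lemma rlift_lin b (c : R[i]) f1 f2 :
  rlift b (fun x => c * f1 x + f2 x) = (fun p => c * rlift b f1 p + rlift b f2 p).
Proof. by apply/funext => p; rewrite /rlift; ring. Qed.

Lemma llift_lin a (c : R[i]) f1 f2 :
  llift a (fun x => c * f1 x + f2 x) = (fun p => c * llift a f1 p + llift a f2 p).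
Proof. by apply/funext => p; rewrite /llift; ring. Qed.

Section ket2.
Variable m : {measure set (borel G * borel G) -> \bar R}.
Variable rho : borel G -> borel G0.
Hypothesis weight : second_weight m rho.

Let mrho : measurable_fun setT rho. Proof. by case: weight. Qed.

Lemma rlift_sqint b phi : Cc b -> cmeasurable (phi : borel G -> R[i]) ->
  sqint m (rlift b phi) =
  (\int[nu]_x (sqmod (phi x) * rhaar (sq b) (rho x))%:E)%E.
Proof.
move=> /sqmod_Cc[cb sb] mphi; rewrite /sqint.
under eq_integral do rewrite /rlift sqmodM.
have [_ wE] := weight; exact: (wE _ _ cb sb (fun x => sqmod_ge0 (b x)) (cmeasurable_sqmod mphi)
  (fun x => sqmod_ge0 _)).
Qed.

Lemma rlift_bound b M phi : Cc b -> fiber_bound b M ->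
  cmeasurable (phi : borel G -> R[i]) ->
  (sqint m (rlift b phi) <= (M ^+ 2)%:E * sqint nu phi)%E.
Proof.
move=> Cb bM mphi; rewrite rlift_sqint//; apply: weighted_sqint_le => //.
exact: (measurableT_comp (rhaar_meas Cb) mrho).
Qed.

Lemma rlift_square_integrable b phi : Cc b -> square_integrable nu phi ->
  square_integrable m (rlift b phi).
Proof.
move=> Cb; have [M M0 bM] := fiber_bound_ex Cb.
apply: (@pointwise_square_integrable _ _ _ _ _ nu m (rlift b) M) => f.
- exact: rlift_meas.
- exact: rlift_bound.
Qed.

Lemma rlift_toL2 b phi : Cc b -> square_integrable nu phi ->
  toL2 m (rlift b (toL2 nu phi)) = toL2 m (rlift b phi).
Proof.
move=> Cb; have [M M0 bM] := fiber_bound_ex Cb.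
apply: (@pointwise_opE _ _ _ _ _ nu m (rlift b) M).
- by move=> *; exact: rlift_lin.
- by move=> f; exact: rlift_meas.
- by move=> f; exact: rlift_bound.
Qed.

Lemma rlift_nrm b M (F : L2 nu) : Cc b -> 0 <= M -> fiber_bound b M ->
  nrm (toL2 m (rlift b F)) <= M * nrm F.
Proof.
move=> Cb M0 bM.
apply: (@pointwise_op_bound _ _ _ _ _ nu m (rlift b) M M0).
- by move=> f; exact: rlift_meas.
- by move=> f; exact: rlift_bound.
Qed.

Variable gamma : set (L2 mu -> L2 nu).
Hypothesis gammaB : forall xi, gamma xi -> bounded_linear xi.
Hypothesis gammaD : acts_densely gamma.
Variables (X : rtensor gamma alpha) (Phi : X -> L2 m).
Hypothesis PhiE : rtensor_identification Phi.
Hypothesis faithful : forall b, Cc b ->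
  (forall F : L2 nu, toL2 m (rlift b F) = 0) -> j b = cst 0.

Let Phiu : unitary Phi. Proof. by case: PhiE. Qed.

Lemma ket2_image b (F : L2 nu) : Cc b -> Phi (ket2 X (j b) F) = toL2 m (rlift b F).
Proof. by move=> Cb; case: PhiE => _ ->. Qed.

(** If $|j(b)\rangle_2$ did not exist, its default value would be zero, so the
    identification would force $j(b)=0$; but $|0\rangle_2=0$ exists. *)
Lemma ket2_jmap b : Cc b -> is_ket2 (j b) (ket2 X (j b)).
Proof.
move=> Cb; apply: contrapT => no.
have ket0 : ket2 X (j b) = cst 0.
  rewrite {1}/ket2; case: xgetP => // A _ hA.
  by exfalso; apply: no; exact: ket2P hA.
have jb0 : j b = cst 0.
  apply: faithful => // F; rewrite -ket2_image// ket0.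
  by have [lPhi _ _] := Phiu; exact: linear_zero.
apply: no; rewrite ket0 jb0; apply: is_ket2_zero.
- exact: L2_seq_complete.
- exact: gammaB.
- exact: alphaB.
- by rewrite -jb0; exact: jmap_alpha.
Qed.

Lemma ket2_bound b M : Cc b -> 0 <= M -> fiber_bound b M ->
  bounded_by (ket2 X (j b)) M.
Proof.
move=> Cb M0 bM F; rewrite -(unitary_nrm Phiu) ket2_image//; exact: rlift_nrm.
Qed.

Lemma ket2_cauchy (b : nat -> G -> R[i]) : (forall n, Cc (b n)) ->
  (forall e : R, 0 < e -> exists N, forall p q, (N <= p)%N -> (N <= q)%N ->
        fiber_bound (fun x => b p x - b q x) e) ->
  opcauchy (fun n => ket2 X (j (b n))).
Proof.
move=> Cb cb e e0; have [N hN] := cb e e0; exists N => p q Np Nq.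
apply/opdist_leP => F; rewrite -(unitary_nrm Phiu).
have [lPhi _ _] := Phiu; rewrite (linear_sub lPhi) !ket2_image//.
have sF := @L2_square_integrable _ _ _ _ (F : L2 nu).
rewrite -toL2B; [|exact: rlift_square_integrable|exact: rlift_square_integrable].
have -> : (fun x => rlift (b p) (F : L2 nu) x - rlift (b q) (F : L2 nu) x) =
    rlift (fun x => b p x - b q x) (F : L2 nu).
  by apply/funext => x; rewrite /rlift mulrBr.
apply: rlift_nrm; [exact: CcB|exact: ltW|exact: hN].
Qed.

Lemma ket2_alpha eta : alpha eta -> exists b : nat -> G -> R[i],
  [/\ forall n, Cc (b n), is_ket2 eta (ket2 X eta) &
      opcvg (fun n => ket2 X (j (b n))) (ket2 X eta)].
Proof.
move=> aeta; have [b [Cb lb cb]] := alpha_approx aeta.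
exists b.
have [|||k c] := ket2_opcvg (X := X) (@L2_seq_complete _ _ _ mu) gammaB alphaB gammaD
  _ aeta lb _ _.
- by move=> n; exact: jmap_alpha.
- by move=> n; exact: ket2_jmap.
- exact: ket2_cauchy.
by split.
Qed.

End ket2.

Let sq_meas (a : G -> R[i]) : Cc a -> measurable_fun setT (sq a : borel G -> R).
Proof. by move=> Ca; exact/cmeasurable_sqmod/Cc_meas. Qed.

(** The integral equals $\int(\lambda(|b|^2))^2d\mu$, so that $\lambda(|b|^2)=0$
    almost everywhere. *)
Lemma jmap_vanish b : Cc b ->
  (\int[nu]_x (sqmod (b x) * rhaar (sq b) (grng g x))%:E = 0)%E ->
  j b = cst 0.
Proof.
move=> Cb h.
have [cb sb] := sqmod_Cc Cb.
have mr := rhaar_meas Cb.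
have h2 : (\int[mu]_u (rhaar (sq b) u * rhaar (sq b) u)%:E = 0)%E.
  rewrite -[RHS]h; apply/esym.
  by apply: (nu_range_integral cb sb) => // x; exact: sqmod_ge0.
have ae0 : {ae mu, forall u, rhaar (sq b) u * rhaar (sq b) u = 0}.
  apply: (integral0_ae (measurable_funM mr mr) _ h2) => u.
  by rewrite mulr_ge0.
apply/funext => zeta; apply: nrm_eq0; apply/eqP; rewrite -sqrf_eq0.
have sz := @L2_square_integrable _ _ _ _ zeta.
have [sj jE] := jmap_toL2 Cb sz.
rewrite -[zeta]toL2_repr jE -eqe toL2_nrm_sqr//.
rewrite jlift_sqint//; last by case: sz.
apply/eqP; apply: ae0_integral.
- by apply: measurable_funM => //; apply: cmeasurable_sqmod; case: sz.
- by move=> u; rewrite mulr_ge0 ?sqmod_ge0.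
- by apply: ae_imp ae0 => u /eqP; rewrite mulf_eq0 orbb => /eqP ->; rewrite mul0r.
Qed.

Lemma toL2_0_sqint d (T : measurableType d) (m : {measure set T -> \bar R})
  (f : T -> R[i]) : square_integrable m f -> toL2 m f = 0 -> sqint m f = 0%E.
Proof. by move=> sf f0; rewrite -toL2_nrm_sqr// f0 nrm0 expr0n. Qed.

(** The function $b$ itself is tested. *)
Lemma faithful_rng (m : {measure set (borel G * borel G) -> \bar R}) b :
  is_nu2_rr g lam mu m -> Cc b ->
  (forall F : L2 nu, toL2 m (rlift b F) = 0) -> j b = cst 0.
Proof.
move=> mE Cb h; have wE := rng_weight mE.
have sb := Cc_square_integrable Ghaus nufin Cb.
have := h (toL2 nu b).
rewrite (rlift_toL2 wE Cb sb) => /toL2_0_sqint.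
rewrite (rlift_sqint wE Cb (Cc_meas Cb)) => /(_ _)/(jmap_vanish Cb); apply.
exact: (rlift_square_integrable wE).
Qed.

(** Testing against $b$ composed with inversion gives the vanishing of the same
    weight for $\nu^{-1}$, which dominates $\nu$. *)
Lemma faithful_src (m : {measure set (borel G * borel G) -> \bar R}) b :
  is_nu2_sr g lam mu m -> Cc b ->
  (forall F : L2 nu, toL2 m (rlift b F) = 0) -> j b = cst 0.
Proof.
move=> mE Cb h; have wE := src_weight mE.
have CbV := Cc_ginv Gtop Ghaus Cb.
have sb := Cc_square_integrable Ghaus nufin CbV.
have := h (toL2 nu (fun x => b (ginv g x))).
rewrite (rlift_toL2 wE Cb sb) => /toL2_0_sqint.
rewrite (rlift_sqint wE Cb (Cc_meas CbV)) => /(_ _).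
have mw : measurable_fun setT
    ((fun x => sqmod (b x) * rhaar (sq b) (grng g x)) : borel G -> R).
  apply: measurable_funM; first exact: sq_meas.
  exact: (measurableT_comp (rhaar_meas Cb) measurable_grng).
have w0 x : 0 <= sqmod (b x) * rhaar (sq b) (grng g x).
  by rewrite mulr_ge0 ?sqmod_ge0.
move=> H; have {}H : (\int[nu]_x (sqmod (b (ginv g x)) * rhaar (sq b) (gsrc g x))%:E = 0)%E.
  apply: H; exact: (rlift_square_integrable wE).
have hV : (\int[nuV]_x (sqmod (b x) * rhaar (sq b) (grng g x))%:E = 0)%E.
  rewrite nuV_integral.
  - by rewrite -[RHS]H; apply: eq_integral => x _; rewrite grng_inv.
  - exact/measurable_EFinP.
  - by move=> x; rewrite lee_fin.
apply: jmap_vanish => //; rewrite nu_density//.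
apply: ae0_integral.
- exact: measurable_funM.
- by move=> x; rewrite mulr_ge0.
- by apply: ae_imp (integral0_ae mw w0 hV) => x ->; rewrite mul0r.
Qed.

Variable nu2rr : {measure set (borel G * borel G) -> \bar R}.
Hypothesis nu2rrE : is_nu2_rr g lam mu nu2rr.
Variables (W : rtensor alpha alpha) (PhiW : W -> L2 nu2rr).
Hypothesis PhiWE : rtensor_identification PhiW.

Let alphaD : acts_densely alpha := alpha_acts_densely.
Let wE := rng_weight nu2rrE.
Let Phiu : unitary PhiW. Proof. by case: PhiWE. Qed.

Lemma nu2_rr_ae : {ae nu2rr, forall p : borel G * borel G, grng g p.1 = grng g p.2}.
Proof.
pose N : set (borel G * borel G) := ~` Grr g.
have mN : measurable N.
  apply: (open_prod_measurable Gsc); apply: closed_openC; exact: closed_Grr.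
exists N; split=> //.
rewrite -[N in LHS]setIT -integral_indic// nu2rrE.
- rewrite integral0_eq// => u _; rewrite integral0_eq// => x xu.
  rewrite integral0_eq// => y yu; rewrite indicE memNset//=.
  by apply; rewrite /Grr /= xu yu.
- by apply/measurable_EFinP; exact: measurable_indic.
- by move=> p; rewrite lee_fin indicE.
Qed.

Lemma llift_bound a M phi : Cc a -> fiber_bound a M ->
  cmeasurable (phi : borel G -> R[i]) ->
  (sqint nu2rr (llift a phi) <= (M ^+ 2)%:E * sqint nu phi)%E.
Proof.
move=> Ca aM mphi; have [ca sa] := sqmod_Cc Ca; rewrite {1}/sqint.
under eq_integral do rewrite /llift sqmodM.
rewrite [leLHS](nu2_rng_integralC ca sa
  (fun x => sqmod_ge0 (a x)) nu2rrE (cmeasurable_sqmod mphi) (fun x => sqmod_ge0 _)).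
apply: weighted_sqint_le => //.
exact: (measurableT_comp (rhaar_meas Ca) measurable_grng).
Qed.

Lemma llift_square_integrable a phi : Cc a -> square_integrable nu phi ->
  square_integrable nu2rr (llift a phi).
Proof.
move=> Ca; have [M M0 aM] := fiber_bound_ex Ca.
apply: (@pointwise_square_integrable _ _ _ _ _ nu nu2rr (llift a) M) => f.
- exact: llift_meas.
- exact: llift_bound.
Qed.

Lemma llift_toL2 a phi : Cc a -> square_integrable nu phi ->
  toL2 nu2rr (llift a (toL2 nu phi)) = toL2 nu2rr (llift a phi).
Proof.
move=> Ca; have [M M0 aM] := fiber_bound_ex Ca.
apply: (@pointwise_opE _ _ _ _ _ nu nu2rr (llift a) M).
- by move=> *; exact: llift_lin.
- by move=> f; exact: llift_meas.
- by move=> f; exact: llift_bound.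
Qed.

Lemma llift_nrm a M (F : L2 nu) : Cc a -> 0 <= M -> fiber_bound a M ->
  nrm (toL2 nu2rr (llift a F)) <= M * nrm F.
Proof.
move=> Ca M0 aM.
apply: (@pointwise_op_bound _ _ _ _ _ nu nu2rr (llift a) M M0).
- by move=> f; exact: llift_meas.
- by move=> f; exact: llift_bound.
Qed.

Lemma ket2_rng b : Cc b -> is_ket2 (j b) (ket2 W (j b)).
Proof.
move=> Cb; apply: (ket2_jmap alphaB PhiWE _ Cb) => b' Cb'.
exact: faithful_rng.
Qed.

(** On $j(e)\zeta$ both $|j(a)\rangle_1$ and $|j(e)\rangle_2$ are known, and
    $r(x)=r(y)$ almost everywhere. *)
Lemma llift_elem a e zeta : Cc a -> Cc e ->
  PhiW (rt_elem W (j a) zeta (j e)) = toL2 nu2rr (llift a (j e zeta)).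
Proof.
move=> Ca Ce; have [_ <-] := ket2_rng Ce; last exact: jmap_alpha.
rewrite ket2_image//.
have sz := @L2_square_integrable _ _ _ _ zeta.
have [sa jaE] := jmap_toL2 Ca sz.
have [se jeE] := jmap_toL2 Ce sz.
rewrite -[zeta]toL2_repr jaE jeE.
rewrite (rlift_toL2 wE)// llift_toL2//.
apply: toL2_ext.
- exact: (rlift_square_integrable wE).
- exact: llift_square_integrable.
- by apply: ae_imp nu2_rr_ae => p rp; rewrite /rlift /llift /jlift rp; ring.
Qed.

(** Multiplication by $a(x)$ defines an operator under the identification. It has
    the values required on $j(e)\zeta$, and by continuity in $\eta$ on all of
    $\alpha\mathfrak H$. *)
Lemma ket1_jmap a : Cc a -> is_ket1 (j a) (ket1 W (j a)) /\
  forall F : L2 nu, PhiW (ket1 W (j a) F) = toL2 nu2rr (llift a F).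
Proof.
move=> Ca; have [M M0 aM] := fiber_bound_ex Ca.
have [B [lB nB PB]] := unitary_inverse Phiu.
pose A (F : L2 nu) : W := B (toL2 nu2rr (llift a F)).
have lA : linear A.
  move=> c F F'; rewrite /A -lB; congr (B _).
  apply: (@pointwise_op_linear _ _ _ _ _ nu nu2rr (llift a) M).
  - by move=> *; exact: llift_lin.
  - by move=> f; exact: llift_meas.
  - by move=> f; exact: llift_bound.
have bA : bounded_linear A.
  apply: (@bounded_linearI _ _ _ _ M) => // F.
  by rewrite /A nB; exact: llift_nrm.
have kA : is_ket1 (j a) A.
  split=> // eta zeta aeta.
  have [e [Ce le _]] := alpha_approx aeta.
  have aj n : alpha (j (e n)) by exact: jmap_alpha.
  have aa : alpha (j a) by exact: jmap_alpha.
  apply: (@seq_limit_eq _ _ (fun n => A (j (e n) zeta))).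
    have [c c0 hc] := bounded_linear_bound bA.
    move=> d d0; have [|N hN] := opcvg_pointwise zeta le (e := d / c).
      by rewrite divr_gt0.
    exists N => n /hN h; rewrite -(linear_sub lA); apply: le_trans (hc _) _.
    by rewrite mulrC -ler_pdivlMr.
  have [c c0 hc] := bounded_linear_bound (alphaB aa).
  move=> d d0; have d1 : 0 < c * (nrm zeta + 1).
    by rewrite mulr_gt0// ltr_wpDl ?nrm_ge0.
  have [|N hN] := le (d / (c * (nrm zeta + 1))); first by rewrite divr_gt0.
  exists N => n /hN h1.
  have -> : A (j (e n) zeta) = rt_elem W (j a) zeta (j (e n)).
    by apply: (unitary_inj Phiu); rewrite /A PB llift_elem.
  have := rt_elem_dist2 W (@L2_seq_complete _ _ _ mu) alphaB alphaB zeta aa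
    (aj n) aeta (ltW c0) (ltW (divr_gt0 d0 d1)) hc h1.
  move=> /le_trans; apply.
  rewrite mulrA mulrAC (mulrAC c) ler_pdivrMr// mulrC ler_wpM2l ?(ltW d0)//.
  by rewrite ler_wpM2l ?(ltW c0)// lerDl.
split; first exact: ket1P kA.
by move=> F; rewrite (ket1_unique alphaD kA) /A PB.
Qed.

Lemma ket1_alpha xi : alpha xi -> exists a : nat -> G -> R[i],
  [/\ forall n, Cc (a n), is_ket1 xi (ket1 W xi) &
      opcvg (fun n => ket1 W (j (a n))) (ket1 W xi)].
Proof.
move=> axi; have [a [Ca la ca]] := alpha_approx axi.
exists a.
have [|||k c] := ket1_opcvg (X := W) (@L2_seq_complete _ _ _ mu) alphaB alphaB alphaD
  _ axi la _ _.
- by move=> n; exact: jmap_alpha.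
- by move=> n; have [] := ket1_jmap (Ca n).
- move=> e e0; have [N hN] := ca e e0; exists N => p q Np Nq.
  apply/opdist_leP => F; rewrite -(unitary_nrm Phiu).
  have [lPhi _ _] := Phiu; rewrite (linear_sub lPhi).
  have [_ ->] := ket1_jmap (Ca p); have [_ ->] := ket1_jmap (Ca q).
  have sF := @L2_square_integrable _ _ _ _ (F : L2 nu).
  rewrite -toL2B; [|exact: llift_square_integrable|exact: llift_square_integrable].
  have -> : (fun x => llift (a p) (F : L2 nu) x - llift (a q) (F : L2 nu) x) =
      llift (fun x => a p x - a q x) (F : L2 nu).
    by apply/funext => x; rewrite /llift mulrBl.
  apply: llift_nrm; [exact: CcB|exact: ltW|exact: hN].
by split.
Qed.

(** * The fundamental unitary *)

Variable nu2sr : {measure set (borel G * borel G) -> \bar R}.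
Hypothesis nu2srE : is_nu2_sr g lam mu nu2sr.

(** The second component of $(x,y)\mapsto(x,x^{-1}y)$, extended outside of
    $G^2_{r,r}$ so as to be Borel everywhere. *)
Definition shear2 (p : G * G) : G :=
  if pselect (Grr g p) then gmul g (ginv g p.1) p.2 else p.2.

Definition shear (p : G * G) : G * G := (p.1, shear2 p).

Lemma shear2E p : Grr g p -> shear2 p = gmul g (ginv g p.1) p.2.
Proof. by rewrite /shear2; case: pselect. Qed.

Lemma shear2N p : ~ Grr g p -> shear2 p = p.2.
Proof. by rewrite /shear2; case: pselect. Qed.

Lemma measurable_shear2 :
  measurable_fun setT (shear2 : borel G * borel G -> borel G).
Proof.
apply: (@measurability _ _ _ _ _ _ (@open G : set (set (borel G)))) => //.
move=> _ [Q oQ <-]; rewrite setTI.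
have [|U oU /seteqP[FU1 FU2]] := @within_preimage_open _ _ (Grr g)
    (fun p : G * G => gmul g (ginv g p.1) p.2) Q oQ; first exact: shear_cvg.
have mF : measurable (Grr g : set (borel G * borel G)).
  rewrite -[Grr g]setCK; apply: measurableC; apply: (open_prod_measurable Gsc).
  by apply: closed_openC; exact: closed_Grr.
have -> : (shear2 : borel G * borel G -> borel G) @^-1` Q =
    (Grr g `&` U) `|` (~` Grr g `&` snd @^-1` Q).
  apply/seteqP; split=> p /=.
    have [rp|rp] := pselect (Grr g p).
      by rewrite shear2E// => h; left; apply: FU1.
    by rewrite shear2N// => h; right.
  move=> [/FU2[rp h]|[rp h]]; first by rewrite shear2E.
  by rewrite shear2N.
apply: measurableU; first by apply: measurableI => //; exact: open_prod_measurable.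
apply: measurableI; first exact: measurableC.
rewrite -[X in measurable X]setTI; apply: measurable_snd => //.
exact: borel_open.
Qed.

Lemma measurable_shear : measurable_fun setT
  (shear : borel G * borel G -> borel G * borel G).
Proof. apply: measurable_fun_pair; [exact: measurable_fst|exact: measurable_shear2]. Qed.

(** The shear carries $\nu^2_{r,r}$ to $\nu^2_{s,r}$ by left invariance. *)
Lemma shear_integral (f : borel G * borel G -> \bar R) :
  measurable_fun setT f -> (forall p, 0 <= f p)%E ->
  (\int[nu2rr]_p f (shear p) = \int[nu2sr]_p f p)%E.
Proof.
move=> mf f0; rewrite nu2rrE//; last first.
  exact: (measurableT_comp mf measurable_shear).
rewrite [RHS](nu2srE mf f0).
apply: eq_integral => u _; apply: eq_integral => x /set_mem xu.
have mfx : measurable_fun setT (fun y : borel G => f (shear ((x : G), (y : G)))).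
  apply: (measurableT_comp (measurableT_comp mf measurable_shear)).
  exact: measurable_pair1.
rewrite (fiber_integral u mfx (fun y => f0 _)).
have <- : grng g x = u by [].
rewrite -(left_invariance x mfx (fun y => f0 _)).
apply: eq_integral => z /set_mem zx.
have xz : gsrc g x = grng g z by [].
by rewrite /shear /= shear2E ?gmulK// /Grr /= grng_mul.
Qed.

Lemma shear_ae (P : G * G -> Prop) : {ae nu2sr, forall p, P p} ->
  {ae nu2rr, forall p, P (shear p)}.
Proof.
move=> [N [mN N0 hN]].
have mS : measurable ((shear : borel G * borel G -> borel G * borel G) @^-1` N).
  by rewrite -[X in measurable X]setTI; exact: measurable_shear.
exists (shear @^-1` N); split=> //; last by move=> p h; exact: hN.
rewrite -[_ @^-1` _ in LHS]setIT -integral_indic//.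
rewrite -[RHS]N0 -[N in RHS]setIT -integral_indic//.
apply: (@shear_integral (fun p => (\1_N p)%:E)).
- by apply/measurable_EFinP; exact: measurable_indic.
- by move=> p; rewrite lee_fin indicE.
Qed.

Lemma shear_square_integrable f : square_integrable nu2sr f ->
  square_integrable nu2rr (fun p => f (shear p)).
Proof.
move=> [mf ff]; split; first exact: (cmeasurable_comp mf measurable_shear).
rewrite (@shear_integral (fun p => (sqmod (f p))%:E))//.
- exact: measurable_sqmod.
- by move=> p; exact: sqmod_ge0E.
Qed.

(** Both $V|j(b)\rangle_2$ and $|j(c)\rangle_2$ are multiplications by kernels, and
    only this enters the norm estimates. *)
Definition has_kernel (W : innerProductType R) (Phi : W -> L2 nu2rr)
    (U : L2 nu -> W) (k : G * G -> R[i]) : Prop :=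
  bounded_linear U /\ forall phi, square_integrable nu phi ->
    square_integrable nu2rr (fun p => phi p.1 * k p) /\
    Phi (U (toL2 nu phi)) = toL2 nu2rr (fun p => phi p.1 * k p).

Variables (S : rtensor (betahat_fact g lam mu nu D) alpha) (PhiS : S -> L2 nu2sr).
Hypothesis PhiSE : rtensor_identification PhiS.
Let vE := src_weight nu2srE.
Variable V : S -> W.
Hypothesis Vunitary : unitary V.
Hypothesis VE : forall z : S, {ae nu2rr, forall p, grng g p.1 = grng g p.2 ->
  PhiW (V z) p = PhiS z (p.1, gmul g (ginv g p.1) p.2)}.

Lemma ket2_src b : Cc b -> is_ket2 (j b) (ket2 S (j b)).
Proof.
move=> Cb; apply: (ket2_jmap _ PhiSE _ Cb).
- exact: betahat_bounded.
- by move=> b' Cb'; exact: (faithful_src nu2srE).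
Qed.

Lemma ket2_rng_kernel c : Cc c -> has_kernel PhiW (ket2 W (j c)) (fun p => c p.2).
Proof.
move=> Cc_; split.
  by have [] := ket2_rng Cc_.
move=> phi sphi; split; first exact: (rlift_square_integrable wE Cc_ sphi).
rewrite ket2_image//.
exact: (rlift_toL2 wE Cc_ sphi).
Qed.

(** The description of $V$ holds almost everywhere for $\nu^2_{r,r}$ and that of
    $|j(b)\rangle_2$ for $\nu^2_{s,r}$; the shear transports null sets. *)
Lemma V_ket2_kernel b : Cc b ->
  has_kernel PhiW (V \o ket2 S (j b)) (fun p => b (shear2 p)).
Proof.
move=> Cb; have [[lk ck] _] := ket2_src Cb; have [lV _ _] := Vunitary.
have [c c0 hc] := bounded_linear_bound (conj lk ck).
split.
  apply: (@bounded_linearI _ _ _ _ c).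
    by move=> a x y /=; rewrite lk lV.
  by move=> x /=; rewrite (unitary_nrm Vunitary).
move=> phi sphi.
have sr := rlift_square_integrable vE Cb sphi.
have sS := shear_square_integrable sr.
split=> //=; apply: L2_ext.
have h1 : {ae nu2sr, forall p, PhiS (ket2 S (j b) (toL2 nu phi)) p = rlift b phi p}.
  rewrite ket2_image// (rlift_toL2 vE Cb sphi).
  exact: toL2E.
have h2 := toL2E sS.
have h3 := nu2_rr_ae.
have h4 := VE (ket2 S (j b) (toL2 nu phi)).
apply: ae_imp (ae_and (ae_and (shear_ae h1) h2) (ae_and h3 h4)) => p [[e1 e2] [rp e4]].
rewrite e2 e4//.
have -> : (p.1, gmul g (ginv g p.1) p.2) = shear p by rewrite /shear shear2E.
exact: e1.
Qed.

Lemma V_ket2_bound b M : Cc b -> 0 <= M -> fiber_bound b M ->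
  bounded_by (V \o ket2 S (j b)) M.
Proof.
move=> Cb M0 bM F; rewrite /= (unitary_nrm Vunitary).
exact: (ket2_bound vE PhiSE Cb M0 bM).
Qed.

(** * Matrix coefficients *)

Lemma bra1_dot a (F : L2 nu) (z : W) : Cc a ->
  dot F (bra1 W (j a) z) = dot (toL2 nu2rr (llift a F)) (PhiW z).
Proof.
move=> Ca; have [[bk _] hk] := ket1_jmap Ca.
rewrite /bra1 -(adjP (@L2_seq_complete _ _ _ nu) bk) -hk.
by have [_ -> _] := Phiu.
Qed.

(** The Cauchy-Schwarz inequality for $p(x)|\omega'(y)|$ and $|\omega(x)|q(x,y)$
    turns a pointwise bound for the kernel into a bound for the matrix
    coefficients at $\omega'$ and $\omega$. *)
Lemma kernel_bound (I : Type) (s : seq I) (a0 : G -> R[i]) (U0 : L2 nu -> W)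
    (k0 : G * G -> R[i]) (a : I -> G -> R[i]) (U : I -> L2 nu -> W)
    (k : I -> G * G -> R[i]) (p : G -> R) (q : G * G -> R) (Q : L2 nu -> W)
    (M N e : R) :
  Cc a0 -> has_kernel PhiW U0 k0 ->
  (forall i, Cc (a i)) -> (forall i, has_kernel PhiW (U i) (k i)) ->
  Cc (fun x => (p x)%:C%C) -> (forall x, 0 <= p x) -> 0 <= M ->
  fiber_bound (fun x => (p x)%:C%C) M ->
  has_kernel PhiW Q (fun z => (q z)%:C%C) -> (forall z, 0 <= q z) -> 0 <= N ->
  bounded_by Q N -> 0 <= e ->
  {ae nu2rr, forall z : borel G * borel G,
    Re `|(a0 z.1)^*%C * k0 z - \sum_(i <- s) (a i z.1)^*%C * k i z|
    <= e * (p z.1 * q z)} ->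
  opdist_le (bra1 W (j a0) \o U0) (\sum_(i <- s) (bra1 W (j (a i)) \o U i))
    (e * (M * N)).
Proof.
move=> Ca0 hU0 Ca hU Cp p0 M0 pM hQ q0 N0 bQ e0 hae.
apply/opdist_leP => F'; pose F : L2 nu := F'; rewrite -[F']/F; apply: nrm_le_dot.
  by rewrite !mulr_ge0 ?nrm_ge0.
move=> E'; pose E : L2 nu := E'; rewrite -[E']/E fct_sumE dotBr.
rewrite (big_morph (dot E) (dotDr E) (dot0r E)).
have sE := @L2_square_integrable _ _ _ _ E.
have sF := @L2_square_integrable _ _ _ _ F.
have sN := square_integrable_norm sE; have sN' := square_integrable_norm sF.
have lsq b (phi : G -> R[i]) := @llift_square_integrable b phi.
have [_ hU0'] := hU0; have [s0 E0] := hU0' _ sF.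
have hU' i : square_integrable nu2rr (fun z => F z.1 * k i z) /\
    PhiW (U i F) = toL2 nu2rr (fun z => F z.1 * k i z).
  by have [_ /(_ _ sF)] := hU i; rewrite toL2_repr.
have [_ hQ'] := hQ; have [sQ EQ] := hQ' _ sN'.
rewrite toL2_repr in E0.
rewrite bra1_dot// E0.
under eq_bigr do rewrite (bra1_dot _ _ (Ca _)) (hU' _).2.
(* The leading term is indexed by None, the subtracted ones by Some i. *)
pose f (o : option I) := llift (if o is Some i then a i else a0) E.
pose h (o : option I) (z : G * G) :=
  if o is Some i then - (F z.1 * k i z) else F z.1 * k0 z.
have sf o : square_integrable nu2rr (f o) by apply: lsq => //; case: o.
have sh o : square_integrable nu2rr (h o).
  case: o => [i|] //=; have := square_integrable_lin (-1) (hU' i).1 (square_integrable0 nu2rr).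
  congr square_integrable; apply/funext => z.
  by rewrite -[LHS]/(-1 * (F z.1 * k i z) + 0) addr0 mulN1r.
have neg i : toL2 nu2rr (h (Some i)) = - toL2 nu2rr (fun z => F z.1 * k i z).
  rewrite -[RHS]scaleN1r -[RHS]addr0.
  have <- : toL2 nu2rr (fun=> 0) = 0 :> L2 nu2rr.
    have s00 := square_integrable0 nu2rr.
    have := toL2B s00 s00; rewrite subrr => <-; congr (toL2 _ _).
    by apply/funext => z; rewrite /= subrr.
  rewrite -(toL2_lin (-1) (hU' i).1 (square_integrable0 nu2rr)).
  by congr (toL2 _ _); apply/funext => z; rewrite /h mulN1r addr0.
pose P z := p z.1 * Re `|E z.2|; pose Q' z := Re `|F z.1| * q z.
have P0 z : 0 <= P z by rewrite mulr_ge0// -[Re _]/(nrm (E z.2 : R[i]^o)) nrm_ge0.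
have Q0 z : 0 <= Q' z by rewrite mulr_ge0// -[Re _]/(nrm (F z.1 : R[i]^o)) nrm_ge0.
have PE : (fun z => (P z)%:C%C) = llift (fun x => (p x)%:C%C) (fun y => (Re `|E y|)%:C%C).
  by apply/funext => z; rewrite /P rmorphM.
have QE : (fun z => (Q' z)%:C%C) = (fun z => (Re `|F z.1|)%:C%C * (q z)%:C%C).
  by apply/funext => z; rewrite /Q' rmorphM.
have sP : square_integrable nu2rr (fun z => (P z)%:C%C) by rewrite PE; exact: lsq.
have sQ' : square_integrable nu2rr (fun z => (Q' z)%:C%C) by rewrite QE.
have nP : nrm (toL2 nu2rr (fun z => (P z)%:C%C)) <= M * nrm E.
  rewrite PE -(llift_toL2 Cp sN).
  apply: le_trans (llift_nrm _ Cp M0 pM) _.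
  by rewrite nrm_toL2_norm// toL2_repr.
have nQ : nrm (toL2 nu2rr (fun z => (Q' z)%:C%C)) <= N * nrm F.
  rewrite QE -EQ (unitary_nrm Phiu); apply: le_trans (bQ _) _.
  by rewrite nrm_toL2_norm// toL2_repr.
have {}hae : {ae nu2rr, forall z, `|Re (\sum_(o <- None :: map Some s) (f o z)^*%C * h o z)|
    <= e * (P z * Q' z)}.
  apply: ae_imp hae => z hz; rewrite big_cons big_map /=.
  have -> : (f None z)^*%C * (F z.1 * k0 z) +
      \sum_(i <- s) (f (Some i) z)^*%C * - (F z.1 * k i z) =
      (E z.2)^*%C * F z.1 *
        ((a0 z.1)^*%C * k0 z - \sum_(i <- s) (a i z.1)^*%C * k i z).
    have cM (v w : R[i]) : (v * w)^*%C = v^*%C * w^*%C by rewrite rmorphM.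
    rewrite mulrBr mulr_sumr -sumrN /f /llift cM; congr (_ + _); first by ring.
    by apply: eq_bigr => i _; rewrite cM; ring.
  apply: le_trans (Re_norm_le _) _; rewrite !Re_normM norm_conj.
  have -> : e * (P z * Q' z) = Re `|E z.2| * Re `|F z.1| * (e * (p z.1 * q z)).
    by rewrite /P /Q'; ring.
  apply: ler_wpM2l => //.
  by rewrite mulr_ge0// -[Re _]/(nrm (_ : R[i]^o)) nrm_ge0.
have bound := @dot_sum_le _ (borel G * borel G)%type R nu2rr _ _ f h P Q' e e0 P0 Q0 sf sh sP sQ' hae.
have sumE : \sum_(o <- None :: map Some s) dot (toL2 nu2rr (f o)) (toL2 nu2rr (h o)) =
    dot (toL2 nu2rr (llift a0 E)) (toL2 nu2rr (fun z => F z.1 * k0 z)) -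
    \sum_(i <- s) dot (toL2 nu2rr (llift (a i) E)) (toL2 nu2rr (fun z => F z.1 * k i z)).
  rewrite big_cons big_map -sumrN; congr (_ + _); apply: eq_bigr => i _.
  by rewrite neg dotNr.
rewrite sumE in bound; apply: le_trans bound _.
have -> : e * (M * N) * nrm F * nrm E = e * ((M * nrm E) * (N * nrm F)) by ring.
by rewrite ler_wpM2l// ler_pM// nrm_ge0.
Qed.

Lemma nu_range_integral_signed (h : G -> R) (psi : borel G0 -> R) :
  continuous h -> csupported h -> (forall x, 0 <= h x) -> measurable_fun setT psi ->
  (\int[nu]_x (h x * psi (grng g x))%:E = \int[mu]_u (rhaar h u * psi u)%:E)%E.
Proof.
move=> ch sh h0 mpsi.
have part (s : R) :
    (\int[nu]_x (h x * Num.max (s * psi (grng g x)) 0)%:E =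
     \int[mu]_u (rhaar h u * Num.max (s * psi u) 0)%:E)%E.
  apply: (@nu_range_integral h ch sh h0
    (fun u => Num.max (s * psi u) 0)).
    by apply: measurable_maxr; [exact: measurable_funM|exact: measurable_cst].
  by move=> u; rewrite le_max lexx orbT.
rewrite integralE [RHS]integralE; congr (_ - _)%E.
- have := part 1; congr (_ = _); apply: eq_integral => x _.
    by rewrite funeposE -EFin_max maxr_pMr// mulr0 mul1r.
  by rewrite funeposE -EFin_max maxr_pMr ?rhaar_ge0// mulr0 mul1r.
- have := part (-1); congr (_ = _); apply: eq_integral => x _.
    by rewrite funenegE -EFinN -EFin_max maxr_pMr// mulr0 mulN1r mulrN.
  by rewrite funenegE -EFinN -EFin_max maxr_pMr ?rhaar_ge0// mulr0 mulN1r mulrN.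
Qed.

Lemma square_integrable_mult (phi f : G0 -> R[i]) : Cc phi ->
  square_integrable mu f -> square_integrable mu (fun u => phi u * f u).
Proof.
move=> Cphi sf; have [M M0 hM] := Cc_bounded G0haus Cphi.
apply: (square_integrable_dominated _ sf sf (c := M)).
  by apply: cmeasurableM; [exact/continuous_cmeasurable/Cc_continuous|case: sf].
move=> u; rewrite sqmodM; apply: (@le_trans _ _ (M * sqmod (f u))).
  by rewrite ler_wpM2r ?sqmod_ge0.
by rewrite ler_wpM2l// lerDl sqmod_ge0.
Qed.

(** A product of two square integrable functions has no sign, so that the
    disintegration of $\nu$ is extended linearly from nonnegative $k$. *)
Lemma haar_pairing (k : G -> R[i]) (f f' : G0 -> R[i]) : Cc k ->
  square_integrable mu f -> square_integrable mu f' ->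
  cintegral nu setT (fun x => k x * ((f (grng g x))^*%C * f' (grng g x))) =
  cintegral mu setT (fun u => haar k u * ((f u)^*%C * f' u)).
Proof.
move=> Ck sf sf'.
have inu k' : Cc k' ->
    cintegrable nu (fun x => k' x * ((f (grng g x))^*%C * f' (grng g x))).
  move=> Ck'; have /(CcP Ghaus)[_ [C cC hC]] := Ck'.
  have [h [ch sh _ hC' _]] := compact_cutoff R Ghaus Glc cC openT (@subsetT _ _).
  have [s1 _] := jmap_toL2 (Cc_real Ghaus ch sh) sf.
  have [s2 _] := jmap_toL2 Ck' sf'.
  have := cintegrable_conjM s1 s2; congr cintegrable; apply/funext => x.
  have cM (a b : R[i]) : (a * b)^*%C = a^*%C * b^*%C by rewrite rmorphM.
  rewrite /jlift cM conjc_real.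
  have [->|/hC /hC' ->] := eqVneq (k' x) 0; first by ring.
  by ring.
have Ch k' : Cc k' -> Cc (haar k') := @haar_Cc k'.
have imu phi : Cc phi -> cintegrable mu (fun u => phi u * ((f u)^*%C * f' u)).
  move=> Cphi; have := cintegrable_conjM sf (square_integrable_mult Cphi sf').
  by congr cintegrable; apply/funext => u; rewrite mulrCA.
pose P k := cintegral nu setT (fun x => k x * ((f (grng g x))^*%C * f' (grng g x))) =
  cintegral mu setT (fun u => haar k u * ((f u)^*%C * f' u)).
apply: (Cc_nonneg_ind (P := P) Ghaus _ _ Ck); rewrite /P.
  move=> c k1 k2 C1 C2 E1 E2.
  transitivity (c * cintegral nu setT (fun x => k1 x * ((f (grng g x))^*%C * f' (grng g x)))
      + cintegral nu setT (fun x => k2 x * ((f (grng g x))^*%C * f' (grng g x)))).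
    rewrite -cintegralZ; last exact: inu.
    rewrite -cintegralD; last 2 first.
    - have := inu _ (CcZ Ghaus c C1); congr cintegrable; apply/funext => x; ring.
    - exact: inu.
    by congr (cintegral _ _ _); apply/funext => x; ring.
  rewrite E1 E2 -cintegralZ; last exact: imu (Ch _ C1).
  rewrite -cintegralD; last 2 first.
  - have := imu _ (CcZ G0haus c (Ch _ C1)); congr cintegrable; apply/funext => u; ring.
  - exact: imu (Ch _ C2).
  congr (cintegral _ _ _); apply/funext => u.
  by rewrite haar_lin//; ring.
move=> h ch sh h0.
have mRe (psi : borel G0 -> R) : measurable_fun setT psi ->
    \int[nu]_x (h x * psi (grng g x)) = \int[mu]_u (rhaar h u * psi u).
  by move=> mpsi; rewrite /Rintegral nu_range_integral_signed.
have [/measurable_int/measurable_EFinP mR /measurable_int/measurable_EFinP mI] :=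
  cintegrable_conjM sf sf'.
rewrite (@cintegralE _ (borel G) R nu _ (fun x => h x * Re ((f (grng g x))^*%C * f' (grng g x)))
  (fun x => h x * Im ((f (grng g x))^*%C * f' (grng g x)))); last first.
  by move=> x; case: ((f _)^*%C * _) => v w; apply: complexP => /=; ring.
rewrite [RHS](@cintegralE _ (borel G0) R mu _ (fun u => rhaar h u * Re ((f u)^*%C * f' u))
  (fun u => rhaar h u * Im ((f u)^*%C * f' u))); last first.
  by move=> u; rewrite rhaarE; case: ((f _)^*%C * _) => v w; apply: complexP => /=; ring.
by congr Complex; [exact: (mRe _ mR)|exact: (mRe _ mI)].
Qed.

(** This is $\langle d|e\rangle$ in the module $L^2(G,\lambda)$, acting on
    $L^2(G^0,\mu)$. *)
Lemma adj_jmap d e (z : L2 mu) : Cc d -> Cc e ->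
  adj (j d) (j e z) = toL2 mu (fun u => haar (fun x => (d x)^*%C * e x) u * z u).
Proof.
move=> Cd Ce; apply: dot_inj => y'; pose y : L2 mu := y'; rewrite -[y']/y.
have sz := @L2_square_integrable _ _ _ _ z; have sy := @L2_square_integrable _ _ _ _ y.
have Ck := CcM Ghaus (Cc_conj Ghaus Cd) Ce.
have Ch := haar_Cc Ck.
have [s1 E1] := jmap_toL2 Cd sy.
have [s2 E2] := jmap_toL2 Ce sz.
have bd := jmap_bounded Cd.
rewrite -(adjP (@L2_seq_complete _ _ _ mu) bd).
rewrite -[z in j e z]toL2_repr -[y in LHS]toL2_repr E1 E2 dot_toL2//.
rewrite -[y in RHS]toL2_repr dot_toL2//; last exact: square_integrable_mult.
transitivity (cintegral nu setT (fun x => ((d x)^*%C * e x) *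
    ((y (grng g x))^*%C * z (grng g x)))).
  congr (cintegral _ _ _); apply/funext => x; rewrite /jlift.
  have -> : (d x * y (grng g x))^*%C = (d x)^*%C * (y (grng g x))^*%C by rewrite rmorphM.
  by ring.
by rewrite haar_pairing//; congr (cintegral _ _ _); apply/funext => u; ring.
Qed.

Lemma multiplications_commute (phi psi : G0 -> R[i]) (z : L2 mu) : Cc phi -> Cc psi ->
  toL2 mu (fun u => phi u * toL2 mu (fun v => psi v * z v) u) =
  toL2 mu (fun u => psi u * toL2 mu (fun v => phi v * z v) u).
Proof.
move=> C1 C2; have sz := @L2_square_integrable _ _ _ _ z.
have s1 := square_integrable_mult C1 sz; have s2 := square_integrable_mult C2 sz.
have s12 := square_integrable_mult C1 (@L2_square_integrable _ _ _ _ (toL2 mu (fun v => psi v * z v))).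
have s21 := square_integrable_mult C2 (@L2_square_integrable _ _ _ _ (toL2 mu (fun v => phi v * z v))).
apply: toL2_ext => //; apply: ae_imp (ae_and (toL2E s1) (toL2E s2)) => u [-> ->].
by ring.
Qed.

Lemma jmap_dense (F : L2 nu) (e : R) : 0 < e ->
  exists2 E, [set E | exists a (z : L2 mu), Cc a /\ E = j a z] E & nrm (F - E) <= e.
Proof.
move=> e0; have [f [Cf hf]] := Cc_dense Ghaus Glc Gsc nufin F e0.
have [z hz] := Cc_jmap Cf.
by exists (toL2 nu f) => //; exists f, z.
Qed.

(** By the Gram formula, since the operators $j(d)^*j(e)$ commute. *)
Lemma bra1_ket2 c d : Cc c -> Cc d ->
  bra1 W (j d) \o ket2 W (j c) = j c \o adj (j d).
Proof.
move=> Cc_ Cd; have cmu := @L2_seq_complete _ _ _ mu.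
have [[k1B k1E] _] := ket1_jmap Cd.
have [k2B k2E] := ket2_rng Cc_.
have bB := adj_bounded (@L2_seq_complete _ _ _ nu) k1B.
have aB := adj_bounded cmu (jmap_bounded Cd).
apply: (bounded_linear_eq_dense _ _ jmap_dense).
- exact: bounded_linear_comp.
- by apply: bounded_linear_comp => //; exact: jmap_bounded.
move=> _ [e [z [Ce ->]]]; apply/eqP; rewrite -subr_eq0; apply/eqP/nrm_eq0/eqP.
rewrite eq_le nrm_ge0 andbT.
apply: (nrm_le_dense (lexx 0) (jmap_dense _)) => _ [e' [z' [Ce' ->]]].
rewrite mul0r dotBr !compE /bra1 -(adjP (@L2_seq_complete _ _ _ nu) k1B).
rewrite k1E ?k2E; [|exact: jmap_alpha..].
rewrite (rt_dotE W cmu alphaB); [|exact: jmap_alpha..].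
rewrite (adjP cmu (jmap_bounded Cd)) (adjP cmu (jmap_bounded Ce')).
have H1 := haar_Cc (CcM Ghaus (Cc_conj Ghaus Cd) Ce).
have H2 := haar_Cc (CcM Ghaus (Cc_conj Ghaus Ce') Cc_).
have -> : adj (j d) (j e (adj (j e') (j c z))) = adj (j e') (j c (adj (j d) (j e z))).
  rewrite (adj_jmap z Ce' Cc_) (adj_jmap z Cd Ce) (adj_jmap _ Cd Ce) (adj_jmap _ Ce' Cc_).
  exact: (multiplications_commute z H1 H2).
by rewrite subrr.
Qed.

(** * Regularity *)

Let cmu := @L2_seq_complete _ _ _ mu.
Let cnu := @L2_seq_complete _ _ _ nu.

Let VB : bounded_linear V.
Proof.
have [lV _ _] := Vunitary; apply: (@bounded_linearI _ _ _ _ 1) => // z.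
by rewrite (unitary_nrm Vunitary) mul1r.
Qed.

Definition bra_V_ket : set (L2 nu -> L2 nu) :=
  [set bra1 W xi \o V \o ket2 S eta | xi in alpha & eta in alpha].

Definition rank_one : set (L2 nu -> L2 nu) :=
  [set xi \o adj eta | xi in alpha & eta in alpha].

Lemma lspan_sum (Y : set (L2 nu -> L2 nu)) (I : Type) (s : seq I)
    (f : I -> L2 nu -> L2 nu) : (forall i, Y (f i)) -> lspan Y (\sum_(i <- s) f i).
Proof.
move=> Yf; elim/big_ind : _ => //; first exact: lspan0.
- by move=> *; exact: lspanD.
- by move=> i _; exact: lspan_sub.
Qed.

Let scale_le (M N e : R) : 0 <= M -> 0 <= N -> 0 <= e -> e / (M * N + 1) * (M * N) <= e.
Proof.
move=> M0 N0 e0; have MN : 0 <= M * N by rewrite mulr_ge0.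
by rewrite mulrAC ler_pdivrMr ?ltr_wpDl// ler_wpM2l// lerDl.
Qed.

Lemma Cc_fst_conj (a : G -> R[i]) (w : G * G) : Cc a ->
  (fun v : G * G => (a v.1)^*%C : R[i]^o) @ w --> ((a w.1)^*%C : R[i]^o).
Proof.
move=> Ca; have c : continuous (fun v : G * G => a v.1 : R[i]^o).
  by move=> v; apply: continuous_comp; [exact: cvg_fst|exact: (Cc_continuous Ca)].
exact: (continuous_conj c).
Qed.

(** A kernel $\overline{a(x)}k_0$ that, in the coordinates $(x,t)$, is continuous
    with compact support on a closed set is a limit of sums of products, and
    the weights $p$, $q$ turn the pointwise error into an operator norm. *)
Lemma coefficient_approx (F : set (G * G)) (k : G * G -> R[i]) (K L : set G)
    (t : G * G -> G) (U : (G -> R[i]) -> L2 nu -> W) (a : G -> R[i])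
    (U0 : L2 nu -> W) (k0 : G * G -> R[i]) (e : R) :
  closed F -> compact K -> compact L ->
  (forall w, F w -> (k : G * G -> R[i]^o) @ within F (nbhs w) --> (k w : R[i]^o)) ->
  (forall w, F w -> k w != 0 -> K w.1 /\ L w.2) ->
  (forall b, Cc b -> has_kernel PhiW (U b) (fun z => b (t z))) ->
  (forall b M, Cc b -> 0 <= M -> fiber_bound b M -> bounded_by (U b) M) ->
  Cc a -> has_kernel PhiW U0 k0 ->
  (forall z, Grr g z -> F (z.1, t z) /\ k (z.1, t z) = (a z.1)^*%C * k0 z) ->
  0 < e -> exists (s : seq (G * G)) (A B : G * G -> G -> R[i]),
    (forall v, Cc (A v) /\ Cc (B v)) /\
    opdist_le (bra1 W (j a) \o U0) (\sum_(v <- s) (bra1 W (j (A v)) \o U (B v))) e.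
Proof.
move=> clF cK cL ck suppk kU bU Ca kU0 kz e0.
have [p [q [[p0 q0] Cp Cq h]]] := kernel_approx_all Ghaus Glc clF cK cL ck suppk.
have [M M0 pM] := fiber_bound_ex Cp; have [N N0 qN] := fiber_bound_ex Cq.
have e'0 : 0 < e / (M * N + 1) by rewrite divr_gt0// ltr_wpDl ?mulr_ge0.
have [s [A [B [CAB hAB]]]] := h _ e'0.
have CA v : Cc (fun x => (A v x)^*%C) by apply: (Cc_conj Ghaus); have [] := CAB v.
have CB v : Cc (B v) by have [] := CAB v.
exists s, (fun v x => (A v x)^*%C), B; split=> //.
apply: opdist_le_mono (scale_le M0 N0 (ltW e0)) _.
apply: (kernel_bound Ca kU0 CA (fun v => kU _ (CB v)) Cp p0 M0 pM (kU _ Cq)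
  (fun z => q0 _) N0 (bU _ _ Cq N0 qN) (ltW e'0)).
apply: ae_imp nu2_rr_ae => z rz; have [Fz <-] := kz z rz.
have := hAB z.1 (t z) Fz.
suff -> : \sum_(v <- s) (A v z.1)^*%C^*%C * B v (t z) = \sum_(v <- s) A v z.1 * B v (t z).
  by [].
by apply: eq_bigr => v _; rewrite conjcK.
Qed.

(** The kernel $\overline{a(x)}b(x^{-1}y)$ of $\langle j(a)|_1V|j(b)\rangle_2$ is
    approximated by the kernels $\overline{d(x)}c(y)$ of $j(c)j(d)^*$. *)
Lemma bra_V_ket_approx a b (e : R) : Cc a -> Cc b -> 0 < e ->
  exists2 T, lspan rank_one T &
    opdist_le (bra1 W (j a) \o V \o ket2 S (j b)) T e.
Proof.
move=> Ca Cb e0; have /(CcP Ghaus)[ca [K cK hK]] := Ca.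
have /(CcP Ghaus)[cb [L cL hL]] := Cb.
have [[M cM hM] _] := shear_supports Gtop Ghaus cK cL.
pose k (w : G * G) := (a w.1)^*%C * b (gmul g (ginv g w.1) w.2).
have [|||s [A [B [CAB h]]]] := @coefficient_approx (Grr g) k K M snd
    (fun c => ket2 W (j c)) a _ _ e (closed_Grr Gtop Ghaus) cK cM _ _
    ket2_rng_kernel (ket2_bound wE PhiWE) Ca (V_ket2_kernel Cb) _ e0.
- move=> w Fw; apply: (@cvgM R[i] _ (within (Grr g) (nbhs w))).
    by apply: cvg_within_filter; exact: Cc_fst_conj.
  exact: (@cvg_comp _ _ _ (fun v : G * G => gmul g (ginv g v.1) v.2) b _ _ _
    (shear_cvg Gtop Fw) (cb _)).
- move=> w Fw; rewrite /k mulf_eq0 negb_or => /andP[aw bw].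
  have Kw : K w.1 by apply: hK; apply: contra_neq aw => ->; rewrite conjc0.
  by split=> //; apply: (hM w.1) => //; exact: hL.
- by move=> z rz; rewrite /k shear2E//; case: z rz.
exists (\sum_(v <- s) (bra1 W (j (A v)) \o ket2 W (j (B v)))) => //.
apply: lspan_sum => v; have [CA CB] := CAB v.
exists (j (B v)); first exact: jmap_alpha.
by exists (j (A v)); [exact: jmap_alpha|rewrite bra1_ket2].
Qed.

(** In the coordinates $(x,z)=(x,x^{-1}y)$ the kernel of $j(c)j(d)^*$ is
    $\overline{d(x)}c(xz)$, and products in these coordinates are the kernels of
    $\langle j(a)|_1V|j(b)\rangle_2$. *)
Lemma rank_one_approx c d (e : R) : Cc c -> Cc d -> 0 < e ->
  exists2 T, lspan bra_V_ket T & opdist_le (j c \o adj (j d)) T e.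
Proof.
move=> Cc_ Cd e0; have /(CcP Ghaus)[cd [K cK hK]] := Cd.
have /(CcP Ghaus)[cc [L cL hL]] := Cc_.
have [_ [M cM hM]] := shear_supports Gtop Ghaus cK cL.
pose k (w : G * G) := (d w.1)^*%C * c (gmul g w.1 w.2).
have [|||s [A [B [CAB h]]]] := @coefficient_approx (Gsr g) k K M shear2
    (fun b => V \o ket2 S (j b)) d _ _ e (closed_Gsr Gtop Ghaus) cK cM _ _
    V_ket2_kernel V_ket2_bound Cd (ket2_rng_kernel Cc_) _ e0.
- move=> w Fw; apply: (@cvgM R[i] _ (within (Gsr g) (nbhs w))).
    by apply: cvg_within_filter; exact: Cc_fst_conj.
  exact: (@cvg_comp _ _ _ (fun v : G * G => gmul g v.1 v.2) c _ _ _
    (gmul_cvg Gtop Fw) (cc _)).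
- move=> w Fw; rewrite /k mulf_eq0 negb_or => /andP[dw cw].
  have Kw : K w.1 by apply: hK; apply: contra_neq dw => ->; rewrite conjc0.
  by split=> //; apply: (hM w.1) => //; exact: hL.
- move=> z rz; rewrite /k /= shear2E// gmulKV//; split=> //.
  by rewrite /Gsr /= grng_mul ?gsrc_inv// grng_inv.
exists (\sum_(v <- s) (bra1 W (j (A v)) \o (V \o ket2 S (j (B v))))).
  apply: lspan_sum => v; have [CA CB] := CAB v.
  exists (j (A v)); first exact: jmap_alpha.
  by exists (j (B v)); first exact: jmap_alpha.
by rewrite -(bra1_ket2 Cc_ Cd).
Qed.

Lemma regularity : regular V.
Proof.
rewrite /regular -/bra_V_ket -/rank_one; apply/seteqP; split.
- apply: clspan_subset => _ [xi axi [eta aeta <-]] e e0.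
  have [a [Ca [k1B _] ka]] :=
    ket1_alpha axi.
  have betahatB xi' : betahat_fact g lam mu nu D xi' -> bounded_linear xi'.
    exact: betahat_bounded.
  have betahatD := betahat_acts_densely.
  have faith b : Cc b -> (forall F : L2 nu, toL2 nu2sr (rlift b F) = 0) -> j b = cst 0.
    exact: (faithful_src nu2srE).
  have [b [Cb [k2B _] kb]] :=
    ket2_alpha vE betahatB betahatD PhiSE faith aeta.
  have lim : opcvg (fun n => bra1 W (j (a n)) \o (V \o ket2 S (j (b n))))
      (bra1 W xi \o (V \o ket2 S eta)).
    apply: opcvg_comp.
    - exact: adj_bounded.
    - exact: bounded_linear_comp.
    - apply: opcvg_adj => // n.
      by have [[]] := ket1_jmap (Ca n).
    - by apply: opcvg_comp => //; exact: opcvg_cst.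
  by apply: (opcvg_approx lim) => // n e' e'0; exact: bra_V_ket_approx.
- apply: clspan_subset => _ [xi axi [eta aeta <-]] e e0.
  have [a [Ca la _]] := alpha_approx axi.
  have [b [Cb lb _]] := alpha_approx aeta.
  have etaB : bounded_linear eta by case: aeta.
  have xiB : bounded_linear xi by case: axi.
  have lim : opcvg (fun n => j (a n) \o adj (j (b n))) (xi \o adj eta).
    apply: opcvg_comp => //; first exact: adj_bounded.
    by apply: opcvg_adj => // n; exact: jmap_bounded.
  by apply: (opcvg_approx lim) => // n e' e'0; exact: rank_one_approx.
Qed.

End HaarSystem.

Theorem proposition5p3 (R : realType) (G0 G : ptopologicalType)
    (g : groupoid G0 G)
    (Gtop : topological_groupoid g)
    (Ghaus : hausdorff_space G)
    (Glc : locally_compact [set: G])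
    (Gsc : @second_countable G)
    (lam : G0 -> {measure set borel G -> \bar R})
    (lamH : left_haar_system g lam)
    (mu : {measure set borel G0 -> \bar R})
    (muR : radon_measure mu)
    (muS : msupport mu = [set: G0])
    (nu : {measure set borel G -> \bar R})
    (nuE : is_nu g lam mu nu)
    (nuQ : quasi_invariant g nu)
    (D : borel G -> R)
    (DE : is_modular_density g nu D)
    (nu2sr nu2rr : {measure set (borel G * borel G) -> \bar R})
    (nu2srE : is_nu2_sr g lam mu nu2sr)
    (nu2rrE : is_nu2_rr g lam mu nu2rr)
    (S : rtensor (betahat_fact g lam mu nu D) (alpha_fact g lam mu nu))
    (W : rtensor (alpha_fact g lam mu nu) (alpha_fact g lam mu nu))
    (PhiS : S -> L2 nu2sr)
    (PhiSE : rtensor_identification PhiS)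
    (PhiW : W -> L2 nu2rr)
    (PhiWE : rtensor_identification PhiW)
    (V : S -> W)
    (Vunitary : unitary V)
    (VE : forall z : S, {ae nu2rr, forall p,
       grng g p.1 = grng g p.2 ->
       PhiW (V z) p = PhiS z (p.1, gmul g (ginv g p.1) p.2)}) :
  regular V.
Proof.
exact: (regularity Gtop Ghaus Glc Gsc lamH muR nuE DE nu2rrE PhiWE nu2srE PhiSE
  Vunitary VE).
Qed.
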